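(* As $t\to0$, the holonomy representation $\rho_t$ of $W_t$ converges algebraically to a representation $\rho_0$ with $\mathrm{Im}(\rho_0)=\mathrm{Im}(\rho)$, where $\rho$ is the (faithful and discrete) holonomy representation of the cuboctahedral manifold $C$.
   Context: $\mathbb{H}^4=\{x\in\mathbb{R}^5:\langle x,x\rangle=-1,\ x_0>0\}$ with $\langle v,w\rangle=-v_0w_0+v_1w_1+v_2w_2+v_3w_3+v_4w_4$, and $\mathbb{H}^3=\mathbb{H}^4\cap\{x_4=0\}$. A space-like vector $v$ determines the half-space $\{w\in\mathbb{H}^4:\langle v,w\rangle\le 0\}$. For $t\in(0,t_2)$, $t_2=\sqrt{1/2}$, $P_t$ is the intersection of the 22 half-spaces determined by the vectors $i^+=(\sqrt2,\varepsilon_i,(-1)^i/t)$ and $i^-=(\sqrt2,\varepsilon_i,-(-1)^i t)$, $i=0,\dots,7$, where $\varepsilon_0=(1,1,1)$, $\varepsilon_1=(1,-1,1)$, $\varepsilon_2=(1,-1,-1)$, $\varepsilon_3=(1,1,-1)$, $\varepsilon_4=(-1,1,-1)$, $\varepsilon_5=(-1,1,1)$, $\varepsilon_6=(-1,-1,1)$, $\varepsilon_7=(-1,-1,-1)$, and $(1,\pm\sqrt2,0,0,0)$, $(1,0,\pm\sqrt2,0,0)$, $(1,0,0,\pm\sqrt2,0)$. Each half-space contributes exactly one wall. The walls $i^+$ are positive (colour P), the walls $i^-$ negative (colour N), and the remaining six are letter walls (colour L). $W_t$ is the hyperbolic cone-manifold obtained from eight copies $P_t^{abc}$, $a,b,c\in\{0,1\}$,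 of $P_t$ by identifying, via the identity map, every P wall of $P_t^{0bc}$ with the same wall of $P_t^{1bc}$, every L wall of $P_t^{a0c}$ with the same wall of $P_t^{a1c}$, and every N wall of $P_t^{ab0}$ with the same wall of $P_t^{ab1}$. $\Sigma_t$ denotes its singular set. The holonomy representation of a hyperbolic cone-manifold is that of its regular locus; here $\rho_t:\pi_1(W_t\setminus\Sigma_t)\to\mathrm{Isom}(\mathbb{H}^4)$ is the holonomy obtained by developing the base copy $P_t^{000}$ onto $P_t\subset\mathbb{H}^4$, so that $\rho_t(g)$ is a composition of reflections along the hyperplanes bounding $P_t$. The topology of $W_t\setminus\Sigma_t$ does not change for $t\in(0,t_2)$, so the groups $\pi_1(W_t\setminus\Sigma_t)$ are identified; algebraic convergence means that $\rho_t(g)\to\rho_0(g)$ for every $g$. As $t\to0$ the polytope $P_t$ converges to an ideal right-angled cuboctahedron $P_0\subset\mathbb{H}^3$. The cuboctahedral manifold $C$ is the hyperbolic three-manifold obtained from four copies $P_0^{ab}$, $a,b\in\{0,1\}$, of $P_0$ by identifying each triangular face of $P_0^{0b}$ with the same face of $P_0^{1b}$ and each quadrilateral face of $P_0^{a0}$ with the same face of $P_0^{a1}$ via the identity maps; $\rho:\pi_1(C)\to\mathrm{Isom}(\mathbb{H}^3)<\mathrm{Isom}(\mathbb{H}^4)$ is its holonomy obtained by developing a copy of $P_0$ onto $P_0\subset\mathbb{H}^3$, where $\mathrm{Isom}(\mathbb{H}^3)$ is viewed as the subgroup of $\mathrm{Isom}(\mathbb{H}^4)$ preserving $\mathbb{H}^3$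 and acting trivially on the coordinate $x_4$. *)

(* Defs.v *)
From HB Require Import structures.
From Stdlib Require Import Relation_Operators.
From mathcomp Require Import all_boot all_order all_algebra.
From mathcomp Require Import generic_quotient.
From mathcomp Require Import all_classical all_reals all_analysis.

Set Implicit Arguments.
Unset Strict Implicit.
Unset Printing Implicit Defensive.

Import Order.TTheory GRing.Theory Num.Theory.
Import numFieldNormedType.Exports.

Local Open Scope classical_set_scope.
Local Open Scope ring_scope.

(* A path is a function on [R] of which only the restriction to [0,1] matters.
   The elements of the fundamental group of [A] at [b] are the loops of
   [loops A b] up to [homotopic A]; its product is induced by [loop_mul]. *)

Section Loops.
Context {R : realType} {M : topologicalType}.
Implicit Types (A : set M) (b : M) (g h : R -> M).

Definition loops A b : set (R -> M) :=
  [set g | [/\ {within `[0 : R, 1], continuous g}, g 0 = b, g 1 = b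
             & forall s : R, s \in `[0, 1] -> A (g s)]].

Definition loop_mul g h : R -> M :=
  fun s => if s <= 2^-1 then g (2 * s) else h (2 * s - 1).

Definition homotopic A g h : Prop :=
  exists H : R * R -> M,
    [/\ {within `[0 : R, 1] `*` `[0 : R, 1], continuous H},
        forall s u : R, s \in `[0, 1] -> u \in `[0, 1] -> A (H (s, u)),
        forall s : R, s \in `[0, 1] -> H (s, 0) = g s /\ H (s, 1) = h s
      & forall u : R, u \in `[0, 1] -> H (0, u) = g 0 /\ H (1, u) = g 1].

End Loops.

(* [S] indexes copies of [D]; [E x c c'] says that the point [x] of the copy
   [c] is identified with the same point of the copy [c']. *)

Section Gluing.
Context {X S : topologicalType} (D : set X) (E : X -> S -> S -> Prop).

Definition glue_step (p q : D * S) : Prop :=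
  p.1 = q.1 /\ E (val p.1) p.2 q.2.

Definition glue_rel (p q : D * S) : bool :=
  `[< clos_refl_sym_trans _ glue_step p q >].

Lemma glue_rel_refl : reflexive glue_rel.
Proof. by move=> p; apply/asboolP; exact: rst_refl. Qed.

Lemma glue_rel_sym : symmetric glue_rel.
Proof. by move=> p q; apply/asboolP/asboolP => h; exact: rst_sym. Qed.

Lemma glue_rel_trans : transitive glue_rel.
Proof.
by move=> q p r /asboolP h /asboolP h'; apply/asboolP; exact: rst_trans h h'.
Qed.

Definition glue_equiv : equiv_rel (D * S)%type :=
  EquivRel glue_rel glue_rel_refl glue_rel_sym glue_rel_trans.

Definition glued : topologicalType :=
  quotient_topology {eq_quot glue_equiv}%qT.

Definition cell (c : S) (x : D) : glued :=
  (\pi_{eq_quot glue_equiv} (x, c))%qT.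

End Gluing.

Arguments cell {X S D E}.

Section Hyperbolic.
Context {R : realType}.
Implicit Types (v w x : 'cV[R]_5) (A : 'M[R]_5).

Definition lorentz v w : R :=
  - (v ord0 0 * w ord0 0) + \sum_(i < 4) v (lift ord0 i) 0 * w (lift ord0 i) 0.

Definition H4 : set 'cV[R]_5 := [set x | lorentz x x = -1 /\ 0 < x ord0 0].

Definition H3 : set 'cV[R]_5 := H4 `&` [set x | x ord_max 0 = 0].

(* Isometries of the hyperboloid are represented by Lorentz matrices, which
   identifies Isom(H^4) with O^+(4,1). *)
Definition IsomH4 : set 'M[R]_5 :=
  [set A | (forall v w, lorentz (A *m v) (A *m w) = lorentz v w) /\
           (forall x, H4 x -> H4 (A *m x))].

Definition IsomH3 : set 'M[R]_5 :=
  IsomH4 `&` [set A | (forall x, H3 x -> H3 (A *m x)) /\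
                      (forall v, (A *m v) ord_max 0 = v ord_max 0)].

Definition vec5 (a b c d e : R) : 'cV[R]_5 :=
  \col_i nth 0 [:: a; b; c; d; e] i.

Definition origin : 'cV[R]_5 := vec5 1 0 0 0 0.

Lemma lorentz_originr v : lorentz v origin = - v ord0 0.
Proof.
rewrite /lorentz /origin !mxE /= mulr1 big1 ?addr0//.
by move=> [[|[|[|[|n]]]] lt_n4] _ //; rewrite !mxE/= mulr0.
Qed.

Lemma H4_origin : H4 origin.
Proof. by split; rewrite ?lorentz_originr !mxE/=. Qed.

Lemma H3_origin : H3 origin.
Proof. by split; [exact: H4_origin | rewrite /= !mxE]. Qed.

End Hyperbolic.

(* [D] is a polytope in the model space [X], and [G] is the group of
   isometries of [X]. *)

Section Holonomy.
Context {R : realType} {S : topologicalType}.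
Context (X : set 'cV[R]_5) (G : set 'M[R]_5).
Context {D : set 'cV[R]_5} {E : 'cV[R]_5 -> S -> S -> Prop}.
Local Notation M := (glued D E).

(* A homeomorphism from a neighbourhood of [p] onto an open subset of [X], given
   on each copy of the polytope by an isometry of [X]; in other words, a local
   isometry to [X]. *)
Definition chart_at (p : M) (phi : M -> 'cV[R]_5) : Prop :=
  exists U : set M,
    [/\ open U /\ U p,
        {in U &, injective phi},
        {within U, continuous phi},
        (forall V, open V -> V `<=` U ->
           exists2 O, open O & phi @` V = O `&` X)
      & forall c, exists2 A, G A &
          forall x : D, U (cell c x) -> phi (cell c x) = A *m val x].

Definition singular_set : set M := ~` [set p | exists phi, chart_at p phi].

(* Analytic continuation along [g] of the chart which develops the copy [c0]
   onto [D]: [phi s] is the continued chart at [g s], and when [g] is back in the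
   copy [c0] the continued chart is [A] times the initial one. *)
Definition develops (c0 : S) (g : R -> M) (A : 'M[R]_5) : Prop :=
  exists phi : R -> M -> 'cV[R]_5,
    [/\ forall s : R, s \in `[0, 1] -> chart_at (g s) (phi s),
        (forall s : R, s \in `[0, 1] -> \forall s' \near s, s' \in `[0, 1] ->
           \forall p \near g s', phi s' p = phi s p),
        (\forall p \near g 0, forall x : D, p = cell c0 x -> phi 0 p = val x)
      & \forall p \near g 1, forall x : D, p = cell c0 x ->
          phi 1 p = A *m val x].

Definition holonomy (c0 : S) (g : R -> M) : 'M[R]_5 :=
  xget 1%:M [set A | G A /\ develops c0 g A].

End Holonomy.

Definition representation {R : realType} {L : Type} (loop : set L)
    (equiv : L -> L -> Prop) (mul : L -> L -> L) (G : set 'M[R]_5)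
    (rho : L -> 'M[R]_5) : Prop :=
  [/\ forall g, loop g -> G (rho g),
      forall g h, loop g -> loop h -> equiv g h -> rho g = rho h
    & forall g h, loop g -> loop h -> rho (mul g h) = rho g *m rho h].

Inductive colour := colP | colL | colN.

Inductive wall :=
  | Pos of 'I_8
  | Neg of 'I_8
  | Letter of 'I_3 & bool.

Definition wall_colour (w : wall) : colour :=
  match w with Pos _ => colP | Neg _ => colN | Letter _ _ => colL end.

Definition flip (k : colour) (abc : bool * bool * bool) : bool * bool * bool :=
  let: (a, b, c) := abc in
  match k with
  | colP => (~~ a, b, c)
  | colL => (a, ~~ b, c)
  | colN => (a, b, ~~ c)
  end.

Section Polytope.
Context {R : realType}.
Implicit Types (t : R) (x : 'cV[R]_5).

Definition eps (i : 'I_8) : R * R * R :=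
  nth (0, 0, 0)
    [:: (1, 1, 1); (1, -1, 1); (1, -1, -1); (1, 1, -1);
        (-1, 1, -1); (-1, 1, 1); (-1, -1, 1); (-1, -1, -1)] i.

Definition eps_vec (i : 'I_8) (x4 : R) : 'cV[R]_5 :=
  let: (e1, e2, e3) := eps i in vec5 (Num.sqrt 2) e1 e2 e3 x4.

Definition letter_vec (k : 'I_3) (s : bool) : 'cV[R]_5 :=
  let r := (-1) ^+ s * Num.sqrt 2 in
  vec5 1 (r *+ (val k == 0%N)) (r *+ (val k == 1%N)) (r *+ (val k == 2%N)) 0.

Definition wall_vec t (w : wall) : 'cV[R]_5 :=
  match w with
  | Pos i => eps_vec i ((-1) ^+ i / t)
  | Neg i => eps_vec i (- ((-1) ^+ i * t))
  | Letter k s => letter_vec k s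
  end.

Definition P t : set 'cV[R]_5 :=
  H4 `&` [set x | forall w, lorentz (wall_vec t w) x <= 0].

Definition glued_along t x (c c' : bool * bool * bool) : Prop :=
  exists2 w, lorentz (wall_vec t w) x = 0 & c' = flip (wall_colour w) c.

Definition W t : topologicalType := glued (P t) (glued_along t).

Definition Sigma t : set (W t) := singular_set H4 IsomH4.
Arguments Sigma t : clear implicits.

Lemma P_origin t : origin \in P t.
Proof.
apply/mem_set; split; first exact: H4_origin.
move=> w /=; rewrite lorentz_originr oppr_le0.
case: w => [i|i|k s] /=; rewrite ?/eps_vec ?/letter_vec; last by rewrite mxE.
- by case: (eps i) => -[? ?] ?; rewrite mxE/= sqrtr_ge0.
- by case: (eps i) => -[? ?] ?; rewrite mxE/= sqrtr_ge0.
Qed.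

Definition base_copy : bool * bool * bool := (false, false, false).

Definition W_base t : W t := cell base_copy (exist _ origin (P_origin t)).

Definition rho_t t (g : R -> W t) : 'M[R]_5 := holonomy H4 IsomH4 base_copy g.

(* The identification of the groups pi_1(W_t minus Sigma_t), for 0 < t < t_2, is
   the one obtained by moving a loop continuously with [t]: an element of the
   common group is represented by a family of loops [g t] in [W_t] minus
   [Sigma_t], continuous in [t]. Continuity is expressed in the space [W_total]
   swept out by the [W_t]. Two families are the same element if they are so at
   every [t]. *)

Definition t2 : R := Num.sqrt 2^-1.

Definition P_total : set (R * 'cV[R]_5) :=
  [set q | 0 < q.1 < t2 /\ P q.1 q.2].

Definition W_total : topologicalType :=
  glued P_total (fun q => glued_along q.1 q.2).

Definition W_loops : set (forall t, R -> W t) :=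
  [set g |
    (forall t : R, 0 < t < t2 -> loops (~` Sigma t) (W_base t) (g t)) /\
    exists Gamma : R * R -> W_total,
      {within `]0, t2[ `*` `[0 : R, 1], continuous Gamma} /\
      forall t s : R, 0 < t < t2 -> s \in `[0, 1] ->
        exists (x : P t) (y : P_total) c,
          [/\ val y = (t, val x), g t s = cell c x & Gamma (t, s) = cell c y]].

Definition W_homotopic (g h : forall t, R -> W t) : Prop :=
  forall t : R, 0 < t < t2 -> homotopic (~` Sigma t) (g t) (h t).

Definition W_mul (g h : forall t, R -> W t) : forall t, R -> W t :=
  fun t => loop_mul (g t) (h t).

End Polytope.

(* As [t -> 0] the vector [i^-] converges to [(sqrt 2, eps_i, 0)], while [i^+],
   rescaled by [t], converges to [(0, 0, 0, 0, (-1)^i)]; the half-spaces of the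
   latter, with both signs, cut out H^3. *)

Inductive face0 :=
  | Triangle of 'I_8
  | Quadrilateral of 'I_3 & bool.

Definition flip0 (f : face0) (ab : bool * bool) : bool * bool :=
  let: (a, b) := ab in
  match f with
  | Triangle _ => (~~ a, b)
  | Quadrilateral _ _ => (a, ~~ b)
  end.

Section Cuboctahedron.
Context {R : realType}.
Implicit Type x : 'cV[R]_5.

Definition face0_vec (f : face0) : 'cV[R]_5 :=
  match f with
  | Triangle i => eps_vec i 0
  | Quadrilateral k s => letter_vec k s
  end.

Definition P0 : set 'cV[R]_5 :=
  H3 `&` [set x | forall f, lorentz (face0_vec f) x <= 0].

Definition glued_along0 x (c c' : bool * bool) : Prop :=
  exists2 f, lorentz (face0_vec f) x = 0 & c' = flip0 f c.

Definition C : topologicalType := glued P0 glued_along0.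

Lemma P0_origin : origin \in P0.
Proof.
apply/mem_set; split; first exact: H3_origin.
move=> f /=; rewrite lorentz_originr oppr_le0.
case: f => [i|k s] /=; rewrite ?/eps_vec ?/letter_vec; last by rewrite mxE.
by case: (eps i) => -[? ?] ?; rewrite mxE/= sqrtr_ge0.
Qed.

Definition base_copy0 : bool * bool := (false, false).

Definition C_base : C := cell base_copy0 (exist _ origin P0_origin).

Definition C_loops : set (R -> C) := loops setT C_base.

Definition rho (g : R -> C) : 'M[R]_5 := holonomy H3 IsomH3 base_copy0 g.

End Cuboctahedron.

Definition faithful {R : realType} {L : Type} (loop : set L)
    (equiv : L -> L -> Prop) (rho : L -> 'M[R]_5) : Prop :=
  forall g h, loop g -> loop h -> rho g = rho h -> equiv g h.

Definition discrete_image {R : realType} {L : Type} (loop : set L)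
    (rho : L -> 'M[R]_5) : Prop :=
  rho @` loop `<=` isolated (rho @` loop).

(* Main.v *)
Require Import Defs.
From mathcomp Require Import all_boot all_order all_algebra.
From mathcomp Require Import all_classical all_reals all_analysis.
From mathcomp Require Import ring lra.

Set Implicit Arguments.
Unset Strict Implicit.
Unset Printing Implicit Defensive.

Import Order.TTheory GRing.Theory Num.Theory.
Import numFieldNormedType.Exports.

Local Open Scope classical_set_scope.
Local Open Scope ring_scope.

(** A chart continued across a wall changes by the reflection in that wall.  As
    charts are injective, a point lies in the regular locus iff the walls through
    it are pairwise orthogonal and of different colours, and the holonomy of a
    loop is the product of the reflections in the walls along a lift of the loop
    to a word.  Orthogonality of walls of different colours does not depend on
    [t], so a continuous family of loops in the [W_t] has a constant word.  The
    reflections extend continuously to [t = 0] once the positive normal vectors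
    are rescaled by [t].  There all positive walls give one central reflection,
    which cancels as it occurs an even number of times, and what remains is a word
    in the faces of [P_0]; this identifies the two images.

    For the cuboctahedral manifold, ping-pong in the right-angled reflection group
    shows that the images of [P_0] do not overlap.  The group preserves a lattice,
    so it is discrete and the height function has a minimum on each orbit, whence
    the images cover [H^3].  A loop with trivial holonomy therefore lifts to a
    loop in [H^3], which contracts along geodesics. *)

(** * Lorentzian linear algebra *)

Section Lorentz.
Context {R : realType}.
Implicit Types (u v w x y z : 'cV[R]_5) (A B : 'M[R]_5) (a b : R).

(** [W_t] and [C] are handled by one scheme: a [system] knows only letters, colours and reflections,
    a [gluing] adds the topology, a [chamber] the geometry. The obstacle is that a loop may meet a
    wall in any closed set of times, and while it does so its word makes sense only modulo the walls
    through the current point. Lifts are therefore words taken modulo such walls, and their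
    existence, uniqueness and dependence on a parameter are all obtained by continuation along an
    interval. The same invariance statement serves homotopies at fixed [t] and the variation of [t],
    because words are compared through their matrices at all times simultaneously; this also permits
    an evaluation at [t = 0], where the polytope has collapsed. Conversely, every word returning to
    the base copy is realized by an explicit family of loops through the centres of facets, so that
    the image of the limit is computed from words alone. *)

Lemma lorentzC v w : lorentz v w = lorentz w v.
Proof.
by rewrite /lorentz mulrC; congr (_ + _); apply: eq_bigr => i _; rewrite mulrC.
Qed.

Lemma lorentzDl u v w : lorentz (u + v) w = lorentz u w + lorentz v w.
Proof.
rewrite /lorentz (eq_bigr (fun i : 'I_4 => u (lift ord0 i) 0 * w (lift ord0 i) 0 +
  v (lift ord0 i) 0 * w (lift ord0 i) 0)); last first.
  by move=> i _; rewrite mxE mulrDl.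
by rewrite big_split /= mxE; ring.
Qed.

Lemma lorentzZl a v w : lorentz (a *: v) w = a * lorentz v w.
Proof.
rewrite /lorentz (eq_bigr (fun i : 'I_4 =>
  a * (v (lift ord0 i) 0 * w (lift ord0 i) 0))); last first.
  by move=> i _; rewrite mxE mulrA.
by rewrite -mulr_sumr mxE; ring.
Qed.

Lemma lorentzNl v w : lorentz (- v) w = - lorentz v w.
Proof. by rewrite -scaleN1r lorentzZl mulN1r. Qed.

Lemma lorentz0l w : lorentz 0 w = 0.
Proof. by rewrite -(scale0r 0) lorentzZl mul0r. Qed.

Lemma lorentzDr u v w : lorentz u (v + w) = lorentz u v + lorentz u w.
Proof. by rewrite lorentzC lorentzDl !(lorentzC u). Qed.

Lemma lorentzZr a v w : lorentz v (a *: w) = a * lorentz v w.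
Proof. by rewrite lorentzC lorentzZl lorentzC. Qed.

Lemma lorentzNr v w : lorentz v (- w) = - lorentz v w.
Proof. by rewrite lorentzC lorentzNl lorentzC. Qed.

Lemma lorentz0r w : lorentz w 0 = 0.
Proof. by rewrite lorentzC lorentz0l. Qed.

Definition lorentzE := (lorentzDl, lorentzDr, lorentzZl, lorentzZr,
  lorentzNl, lorentzNr, lorentz0l, lorentz0r).

Lemma lorentz_inj v w : (forall y, lorentz v y = lorentz w y) -> v = w.
Proof.
move=> vw; apply/matrixP => i j; rewrite ord1.
have := vw (delta_mx i 0); rewrite /lorentz.
case: (unliftP ord0 i) => [k ->|->].
  rewrite !mxE /= !mulr0 !oppr0 !add0r (bigD1 k)//= [X in _ = X -> _](bigD1 k)//=.
  rewrite !mxE !eqxx !mulr1 !big1 ?addr0// => l /negPf lk;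
    by rewrite mxE (inj_eq (@lift_inj _ _)) lk mulr0.
rewrite !mxE !eqxx /= !mulr1 !big1 ?addr0; try by move=> l _; rewrite mxE mulr0.
by move=> /oppr_inj.
Qed.

(** The linear form [lorentz v] as a row, so that [reflection v] is a matrix expression in the
    entries of [v] and passes to limits. *)
Definition covec v : 'rV[R]_5 :=
  \row_j (if j == ord0 then - v j 0 else v j 0).

Lemma covecE v x : (covec v *m x) 0 0 = lorentz v x.
Proof.
rewrite !mxE big_ord_recl mxE /= mulNr /lorentz; congr (_ + _).
by apply: eq_bigr => i _; rewrite mxE.
Qed.

Definition reflection v : 'M[R]_5 :=
  1%:M - (2 / lorentz v v) *: (v *m covec v).

Lemma reflectionE v x : reflection v *m x = x - (2 * lorentz v x / lorentz v v) *: v.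
Proof.
rewrite mulmxBl mul1mx -scalemxAl -mulmxA [covec v *m x]mx11_scalar covecE.
by rewrite mul_mx_scalar scalerA; congr (_ - _ *: _); ring.
Qed.

Lemma eq_mulmx A B : (forall x, A *m x = B *m x) -> A = B.
Proof.
move=> AB; apply/matrixP => i j; have := AB (delta_mx j 0).
by rewrite -!colE => /matrixP /(_ i 0); rewrite !mxE.
Qed.

Lemma lorentz_reflection v x y : 0 < lorentz v v ->
  lorentz (reflection v *m x) y = lorentz x (reflection v *m y).
Proof.
by move=> v0; rewrite !reflectionE !lorentzE [lorentz x v]lorentzC; field; rewrite gt_eqF.
Qed.

Lemma reflectionK v : 0 < lorentz v v -> reflection v *m reflection v = 1%:M.
Proof.
move=> v0; apply: eq_mulmx => x; rewrite -mulmxA mul1mx !reflectionE !lorentzE.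
rewrite -addrA -opprD -scalerDl; set c := (X in X *: _).
suff -> : c = 0 by rewrite scale0r subr0.
by rewrite /c; field; rewrite gt_eqF.
Qed.

Lemma reflection_id v x : lorentz v x = 0 -> reflection v *m x = x.
Proof. by move=> vx; rewrite reflectionE vx mulr0 mul0r scale0r subr0. Qed.

Lemma reflection_self v : 0 < lorentz v v -> reflection v *m v = - v.
Proof.
move=> v0; rewrite reflectionE mulfK ?gt_eqF// -[X in X - _]scale1r -scalerBl.
by rewrite (_ : 1 - 2 = -1) ?scaleN1r//; ring.
Qed.

Lemma reflection_isometry v x y : 0 < lorentz v v ->
  lorentz (reflection v *m x) (reflection v *m y) = lorentz x y.
Proof. by move=> v0; rewrite lorentz_reflection// mulmxA reflectionK// mul1mx. Qed.

Lemma reflectionZ a v : a != 0 -> reflection (a *: v) = reflection v.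
Proof.
move=> a0; apply: eq_mulmx => x; rewrite !reflectionE !lorentzE scalerA.
have [v0|v0] := eqVneq (lorentz v v) 0.
  by rewrite v0 !mulr0 invr0 !mulr0 !mul0r.
by congr (_ - _ *: _); field; rewrite v0 a0.
Qed.

Lemma reflection_comm v w : 0 < lorentz v v -> 0 < lorentz w w -> lorentz v w = 0 ->
  reflection v *m reflection w = reflection w *m reflection v.
Proof.
move=> v0 w0 vw; apply: eq_mulmx => x; rewrite -!mulmxA !reflectionE !lorentzE.
rewrite (lorentzC w v) vw !mulr0 !subr0 -!addrA; congr (_ + _); exact: addrC.
Qed.

(** The future time-like vectors. Unlike the hyperboloid, this set is convex and stable under
    positive scaling: points are moved linearly in it and projected back by [nrm]. *)
Definition cone : set 'cV[R]_5 := [set x | lorentz x x < 0 /\ 0 < x ord0 0].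

Lemma space_ge0 z : z ord0 0 = 0 -> 0 <= lorentz z z.
Proof.
move=> z0; rewrite /lorentz z0 mul0r oppr0 add0r.
by apply: sumr_ge0 => i _; rewrite -expr2 sqr_ge0.
Qed.

Lemma space_eq0 z : z ord0 0 = 0 -> lorentz z z = 0 -> z = 0.
Proof.
move=> z0; rewrite /lorentz z0 mul0r oppr0 add0r => /psumr_eq0P h.
apply/matrixP => i j; rewrite ord1 mxE; case: (unliftP ord0 i) => [k ->|->//].
apply/eqP; rewrite -sqrf_eq0 expr2; apply/eqP; apply: h => // l _.
by rewrite -expr2 sqr_ge0.
Qed.

(** The combination [y_0 x - x_0 y] has no time component, hence a nonnegative square. The
    inequality stands in for the reverse Cauchy-Schwarz inequality. *)
Lemma lorentz_pair_ge0 x y :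
  0 <= (y ord0 0) ^+ 2 * lorentz x x - 2 * x ord0 0 * y ord0 0 * lorentz x y
       + (x ord0 0) ^+ 2 * lorentz y y.
Proof.
have /space_ge0 : (y ord0 0 *: x - x ord0 0 *: y) ord0 0 = 0.
  by rewrite !mxE; ring.
by rewrite !lorentzE (lorentzC y x); congr (0 <= _); ring.
Qed.

Lemma H4_cone x : H4 x -> cone x.
Proof. by case=> xx x0; split; rewrite ?xx ?oppr_lt0. Qed.

Lemma cone_lt0 x y : cone x -> cone y -> lorentz x y < 0.
Proof.
move=> [xx x0] [yy y0]; have := lorentz_pair_ge0 x y.
rewrite [_ < _]ltNge; move=> h; apply/negP => xy.
have : (y ord0 0) ^+ 2 * lorentz x x < 0 by rewrite nmulr_llt0// exprn_gt0.
have : (x ord0 0) ^+ 2 * lorentz y y < 0 by rewrite nmulr_llt0// exprn_gt0.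
have : 0 <= 2 * x ord0 0 * y ord0 0 * lorentz x y.
  by rewrite !mulr_ge0// ltW.
lra.
Qed.

Lemma coneD x y : cone x -> cone y -> cone (x + y).
Proof.
move=> cx cy; have := cone_lt0 cx cy; case: cx cy => xx x0 [yy y0] xy.
by split; [rewrite !lorentzE (lorentzC y x); lra | rewrite mxE addr_gt0].
Qed.

Lemma coneZ a x : 0 < a -> cone x -> cone (a *: x).
Proof.
move=> a0 [xx x0]; split; last by rewrite mxE mulr_gt0.
by rewrite !lorentzE pmulr_rlt0// pmulr_rlt0.
Qed.

Lemma cone_origin : cone (@origin R).
Proof. exact/H4_cone/H4_origin. Qed.

(** Positive definiteness of the orthogonal complement of a time-like vector: when the mixed term of
    [lorentz_pair_ge0] vanishes, so does the time coordinate of [v]. *)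
Lemma cone_orth x v : cone x -> lorentz v x = 0 -> lorentz v v <= 0 -> v = 0.
Proof.
move=> [xx x0] vx vv; have := lorentz_pair_ge0 v x; rewrite vx mulr0 subr0 => h.
have h1 : (x ord0 0) ^+ 2 * lorentz v v <= 0 by rewrite mulr_ge0_le0// sqr_ge0.
have h2 : (v ord0 0) ^+ 2 * lorentz x x <= 0.
  by rewrite mulr_ge0_le0// ?sqr_ge0// ltW.
have v0 : v ord0 0 = 0.
  have /eqP : (v ord0 0) ^+ 2 * lorentz x x = 0 by lra.
  by rewrite mulf_eq0 (lt_eqF xx) orbF sqrf_eq0 => /eqP.
apply: space_eq0 => //; apply/eqP; rewrite eq_le vv /=.
exact: space_ge0.
Qed.

Lemma norm1_neq0 x : lorentz x x < 0 -> x ord0 0 != 0.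
Proof. by apply: contraTneq => /space_ge0; rewrite -leNgt. Qed.

(** Otherwise [- y] would lie in the future cone, and the product with [x] would be positive. *)
Lemma cone_future x y : cone x -> lorentz y y < 0 -> lorentz x y < 0 -> cone y.
Proof.
move=> cx yy xy; split => //; case: (ltgtP (y ord0 0) 0) => [y0|//|/eqP]; last first.
  by rewrite (negPf (norm1_neq0 yy)).
have cy : cone (- y) by split; rewrite ?lorentzE ?opprK// mxE oppr_gt0.
by have := cone_lt0 cx cy; rewrite lorentzE oppr_lt0 ltNge (ltW xy).
Qed.

Definition nrm x := (Num.sqrt (- lorentz x x))^-1 *: x.

Lemma nrm_scale x : cone x -> 0 < (Num.sqrt (- lorentz x x))^-1.
Proof. by case=> xx _; rewrite invr_gt0 sqrtr_gt0 oppr_gt0. Qed.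

Lemma nrm_H4 x : cone x -> H4 (nrm x).
Proof.
move=> cx; have [_ h] := coneZ (nrm_scale cx) cx; split => //.
rewrite /nrm !lorentzE mulrA -invfM -expr2 sqr_sqrtr; last first.
  by rewrite oppr_ge0 ltW//; case: cx.
by rewrite -[X in _ * X]opprK mulrN mulVf// oppr_eq0 lt_eqF//; case: cx.
Qed.

Lemma nrm_id x : H4 x -> nrm x = x.
Proof. by case=> xx _; rewrite /nrm xx opprK sqrtr1 invr1 scale1r. Qed.

Lemma lorentz_nrm v x : lorentz v (nrm x) = (Num.sqrt (- lorentz x x))^-1 * lorentz v x.
Proof. by rewrite lorentzE. Qed.

Lemma reflection_H4 v x : 0 < lorentz v v -> H4 x -> H4 (reflection v *m x).
Proof.
move=> v0 Hx; have [xx x0] := Hx.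
have h : lorentz (reflection v *m x) (reflection v *m x) = -1.
  by rewrite reflection_isometry.
split => //; suff [] : cone (reflection v *m x) by [].
apply: (cone_future (H4_cone Hx)); first by rewrite h oppr_lt0.
rewrite reflectionE !lorentzE xx (lorentzC x v).
rewrite (_ : _ * _ = 2 / lorentz v v * lorentz v x ^+ 2); last by ring.
have : 0 <= 2 / lorentz v v * lorentz v x ^+ 2.
  by rewrite mulr_ge0 ?sqr_ge0 ?divr_ge0 ?ltW.
lra.
Qed.

Lemma reflection_IsomH4 v : 0 < lorentz v v -> IsomH4 (reflection v).
Proof.
by move=> v0; split=> [x y|x]; [exact: reflection_isometry | exact: reflection_H4].
Qed.

Lemma IsomH4_1 : IsomH4 (1%:M : 'M[R]_5).
Proof. by split=> [x y|x]; rewrite !mul1mx. Qed.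

Lemma IsomH4_mul A B : IsomH4 A -> IsomH4 B -> IsomH4 (A *m B).
Proof.
move=> [A1 A2] [B1 B2]; split=> [x y|x hx]; rewrite -!mulmxA ?A1//.
exact/A2/B2.
Qed.

(* With [J] the Gram matrix, the inverse of a Lorentz matrix [A] is [J A^T J]. *)
Definition ladj A : 'M[R]_5 :=
  \matrix_(i, j) ((-1) ^+ (i == ord0) * (-1) ^+ (j == ord0) * A j i).

Lemma covec_adj A v : covec v *m A = covec (ladj A *m v).
Proof.
apply/rowP => j; rewrite !mxE.
transitivity ((-1) ^+ (j == ord0) * \sum_k ladj A j k * v k 0); last first.
  by case: eqP => //= _; rewrite ?expr1 ?mulN1r ?expr0 ?mul1r.
rewrite mulr_sumr; apply: eq_bigr => k _; rewrite !mxE.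
by case: (j == ord0) (k == ord0) => -[]; rewrite ?expr1 ?expr0; ring.
Qed.

Lemma lorentz_adj A v w : lorentz (ladj A *m v) w = lorentz v (A *m w).
Proof. by rewrite -!covecE -covec_adj mulmxA. Qed.

Lemma adjK A : IsomH4 A -> ladj A *m A = 1%:M.
Proof.
move=> [A1 _]; apply: eq_mulmx => x; apply: lorentz_inj => y.
by rewrite -mulmxA lorentz_adj A1 mul1mx.
Qed.

Lemma adjKr A : IsomH4 A -> A *m ladj A = 1%:M.
Proof. by move=> /adjK /mulmx1C. Qed.

Lemma IsomH4_adj A : IsomH4 A -> IsomH4 (ladj A).
Proof.
move=> hA; have [A1 A2] := hA; have K y : A *m (ladj A *m y) = y.
  by rewrite mulmxA adjKr// mul1mx.
have i1 : forall v w, lorentz (ladj A *m v) (ladj A *m w) = lorentz v w.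
  by move=> v w; rewrite -A1 !K.
split => // x Hx; have [xx x0] := Hx.
split; first by rewrite i1.
have n1 : lorentz (ladj A *m x) (ladj A *m x) < 0 by rewrite i1 xx oppr_lt0.
case: (ltgtP ((ladj A *m x) ord0 0) 0) => [y0|//|/eqP]; last first.
  by rewrite (negPf (norm1_neq0 n1)).
have /A2[_] : H4 (- (ladj A *m x)).
  by split; rewrite ?lorentzE ?opprK ?i1// mxE oppr_gt0.
by rewrite mulmxN K mxE oppr_gt0 ltNge (ltW x0).
Qed.

Lemma IsomH3_1 : IsomH3 (1%:M : 'M[R]_5).
Proof. by split; [exact: IsomH4_1|split=> [x|v]; rewrite mul1mx]. Qed.

Lemma IsomH3_mul A B : IsomH3 A -> IsomH3 B -> IsomH3 (A *m B).
Proof.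
move=> [A0 [A1 A2]] [B0 [B1 B2]]; split; first exact: IsomH4_mul.
by split=> [x hx|v]; rewrite -mulmxA ?A2//; exact/A1/B1.
Qed.

Lemma IsomH3_adj A : IsomH3 A -> IsomH3 (ladj A).
Proof.
move=> [A0 [A1 A2]]; have h v : (ladj A *m v) ord_max 0 = v ord_max 0.
  by rewrite -(A2 (ladj A *m v)) mulmxA adjKr// mul1mx.
split; first exact: IsomH4_adj.
by split => // x [hx x4]; split; [exact: (IsomH4_adj A0).2|rewrite /= h].
Qed.

Lemma reflection_IsomH3 v : 0 < lorentz v v -> v ord_max 0 = 0 ->
  IsomH3 (reflection v).
Proof.
move=> v0 v4; have h x : (reflection v *m x) ord_max 0 = x ord_max 0.
  by rewrite reflectionE !mxE v4 mulr0 subr0.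
split; first exact: reflection_IsomH4.
split => // x [hx x4]; split; first exact: reflection_H4.
by rewrite /= h.
Qed.

End Lorentz.

(** * Limits of products, reflections and normalizations *)

Section MatrixLimits.
Context {R : realType}.

Lemma cvg_mx {T : Type} (F : set_system T) {FF : Filter F} m n
    (f : T -> 'M[R]_(m, n)) (A : 'M[R]_(m, n)) :
  (forall i j, f x i j @[x --> F] --> A i j) -> f @ F --> A.
Proof.
move=> h B [P nP sPB]; apply: (@filterS _ F _ [set x | forall i j, P i j (f x i j)]).
  by move=> x hx; apply: sPB.
apply: filter_forall => i; apply: filter_forall => j; exact: h.
Qed.

Lemma mx_cvg {T : Type} (F : set_system T) {FF : Filter F} m n
    (f : T -> 'M[R]_(m, n)) (A : 'M[R]_(m, n)) i j :
  f @ F --> A -> f x i j @[x --> F] --> A i j.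
Proof.
move=> h; exact: (cvg_comp _ _ h (@coord_continuous _ _ _ i j A)).
Qed.

Lemma cvg_sumr {T : Type} (F : set_system T) {FF : Filter F} (I : finType)
    (f : I -> T -> R) (a : I -> R) :
  (forall i, f i @ F --> a i) -> (\sum_i f i x) @[x --> F] --> \sum_i a i.
Proof.
move=> h; elim: (index_enum I) => [|i s ih].
  by rewrite big_nil; under eq_fun do rewrite big_nil; exact: cvg_cst.
by rewrite big_cons; under eq_fun do rewrite big_cons; exact: cvgD.
Qed.

Lemma cvg_mulmx {T : Type} (F : set_system T) {FF : Filter F} m n p
    (f : T -> 'M[R]_(m, n)) (g : T -> 'M[R]_(n, p)) (A : 'M[R]_(m, n))
    (B : 'M[R]_(n, p)) :
  f @ F --> A -> g @ F --> B -> (f x *m g x) @[x --> F] --> A *m B.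
Proof.
move=> hf hg; apply: cvg_mx => i j; rewrite mxE; under eq_fun do rewrite mxE.
by apply: cvg_sumr => k; apply: cvgM; exact: mx_cvg.
Qed.

Lemma cvg_lorentz {T : Type} (F : set_system T) {FF : Filter F}
    (f g : T -> 'cV[R]_5) (v w : 'cV[R]_5) :
  f @ F --> v -> g @ F --> w -> lorentz (f x) (g x) @[x --> F] --> lorentz v w.
Proof.
move=> hf hg; apply: cvgD; first by apply: cvgN; apply: cvgM; exact: mx_cvg.
by apply: cvg_sumr => k; apply: cvgM; exact: mx_cvg.
Qed.

Lemma lorentz_continuous (v z : 'cV[R]_5) : lorentz v y @[y --> z] --> lorentz v z.
Proof. exact: (@cvg_lorentz _ (nbhs z) _ (fun=> v) id v z (cvg_cst v) cvg_id). Qed.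

Lemma lorentz2_continuous (z : 'cV[R]_5) : lorentz y y @[y --> z] --> lorentz z z.
Proof. exact: (@cvg_lorentz _ (nbhs z) _ id id z z cvg_id cvg_id). Qed.

Lemma mulmx_continuous (A : 'M[R]_5) (z : 'cV[R]_5) : A *m y @[y --> z] --> A *m z.
Proof. exact: (@cvg_mulmx _ (nbhs z) _ _ _ _ (fun=> A) id A z (cvg_cst A) cvg_id). Qed.

Lemma cvg_reflection {T : Type} (F : set_system T) {FF : Filter F}
    (f : T -> 'cV[R]_5) (v : 'cV[R]_5) : 0 < lorentz v v ->
  f @ F --> v -> reflection (f x) @[x --> F] --> reflection v.
Proof.
move=> v0 hf; apply: cvgB; first exact: cvg_cst.
apply: cvgZ.
  apply: cvgM; first exact: cvg_cst.
  apply: cvgV; [by rewrite gt_eqF|exact: cvg_lorentz].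
apply: cvg_mulmx => //; apply: cvg_mx => i j; rewrite mxE.
under eq_fun do rewrite mxE.
by case: ifP => _; [apply: cvgN|]; exact: mx_cvg.
Qed.

Lemma cvg_nrm {T : Type} (F : set_system T) {FF : Filter F}
    (f : T -> 'cV[R]_5) (v : 'cV[R]_5) : cone v ->
  f @ F --> v -> nrm (f x) @[x --> F] --> nrm v.
Proof.
move=> cv hf; apply: cvgZ => //; apply: cvgV.
  by have := nrm_scale cv; rewrite invr_gt0 => /gt_eqF ->.
apply: (cvg_comp (fun x => - lorentz (f x) (f x)) Num.sqrt (G := nbhs (- lorentz v v))).
  by apply: cvgN; exact: cvg_lorentz.
exact: sqrt_continuous.
Qed.

End MatrixLimits.

(** * Continuation along an interval *)

Section IntervalChain.
Context {R : realType}.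

(** The supremum of the points reachable from [x] is itself reachable and cannot lie before [y].
    Every continuation argument below is an instance: existence, uniqueness and stability of lifts,
    invariance under deformation, and analytic continuation of charts. *)
Lemma interval_chain (Q : R -> R -> Prop) (x y : R) : x <= y ->
  (forall a b c, x <= a -> a <= b -> b <= c -> c <= y -> Q a b -> Q b c -> Q a c) ->
  (forall s, x <= s <= y -> exists2 e, 0 < e & forall a b, x <= a -> a <= s ->
      s <= b -> b <= y -> s - e < a -> b < s + e -> Q a b) ->
  Q x y.
Proof.
move=> xy Qt Ql; pose A := [set s | x <= s <= y /\ Q x s].
have Ax : A x.
  split; first by rewrite lexx.
  have [e e0 h] := Ql x ltac:(by rewrite lexx).
  by apply: h => //; [rewrite ltrBlDr ltrDl|rewrite ltrDl].
have supA : has_sup A by split; [exists x | exists y => s [/andP[]]].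
have xm : x <= sup A by apply: ub_le_sup => //; exact: supA.2.
have my : sup A <= y by apply: ge_sup; [exists x|move=> s [/andP[]]].
have [e e0 h] := Ql (sup A) ltac:(by rewrite xm my).
have [s As ms] := sup_adherent e0 supA.
have [/andP[xs sy] Qs] := As.
have sm : s <= sup A by apply: ub_le_sup => //; exact: supA.2.
(* Half of [e] stays strictly inside the good neighbourhood of the supremum and still passes beyond
   it, unless [y] is reached. *)
pose b := Num.min y (sup A + e / 2).
have mb : sup A <= b by rewrite le_min my lerDl divr_ge0// ltW.
have yb : b <= y by rewrite ge_min lexx.
have be : b < sup A + e.
  rewrite (le_lt_trans (y := sup A + e / 2))// ?ge_min ?lexx ?orbT//.
  by rewrite ltrD2l ltr_pdivrMr// ltr_pMr// ltr1n.
have Ab : A b.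
  split; first by rewrite yb (le_trans xs)// (le_trans sm).
  apply: (Qt x s b) => //; first exact: le_trans mb.
  exact: h.
have bm : b <= sup A by apply: ub_le_sup => //; exact: supA.2.
suff <- : b = y by case: Ab.
apply/eqP; rewrite eq_le yb /= leNgt; apply/negP => lby.
have : b = sup A + e / 2 by rewrite /b minElt; case: ltP => // ?; move: lby; rewrite /b min_l// ?ltxx// ltW.
have : 0 < e / 2 by rewrite divr_gt0.
lra.
Qed.

End IntervalChain.

(** All that words need to know about walls. The type [tint] is that of colours; a cell in [S] is
    determined by one bit per colour, and crossing a wall toggles the bit of its colour only.
    Reflections depend on a [time], while [orth] does not: one word is evaluated at all times, and
    orthogonal letters commute at all of them. *)
Record system (R : realType) (S : Type) := System {
  letter : Type;
  tint : Type;
  time : Type;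
  fl : letter -> S -> S;
  col : letter -> tint;
  bit : tint -> S -> bool;
  rfl : time -> letter -> 'M[R]_5;
  orth : letter -> letter -> Prop;
  bit_fl : forall k w c, bit k (fl w c) = bit k c (+) `[< col w = k >];
  bit_inj : forall c c', (forall k, bit k c = bit k c') -> c = c';
  rflK : forall t w, rfl t w *m rfl t w = 1%:M;
  rflC : forall t w w', orth w w' -> rfl t w *m rfl t w' = rfl t w' *m rfl t w }.

(** * Words of walls and their lifts along paths *)

Section Words.
Context {R : realType} {S : Type} (Y : system R S).
Local Notation L := (letter Y).
Implicit Types (u v : seq L) (w : L) (wl : L -> Prop) (c : S).

Definition mat t u : 'M[R]_5 := foldr (fun w A => rfl t w *m A) 1%:M u.

Definition flw u c : S := foldr (@fl R S Y) c u.

Definition par k u : bool := foldr (fun w b => `[< col w = k >] (+) b) false u.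

Fixpoint words_in wl u : Prop :=
  if u is w :: u' then wl w /\ words_in wl u' else True.

(** Matrices are compared at every time, so that a word found at one parameter may be evaluated at
    another; the parities retain the cell that is reached. *)
Definition equiv u u' := (forall t, mat t u = mat t u') /\
  (forall k, par k u = par k u').

Lemma mat_cat t u v : mat t (u ++ v) = mat t u *m mat t v.
Proof. by elim: u => [|w u ih] /=; rewrite ?mul1mx// ih mulmxA. Qed.

Lemma par_cat k u v : par k (u ++ v) = par k u (+) par k v.
Proof. by elim: u => [|w u ih] //=; rewrite ih addbA. Qed.

Lemma flw_cat u v c : flw (u ++ v) c = flw u (flw v c).
Proof. exact: foldr_cat. Qed.

Lemma bit_flw k u c : bit k (flw u c) = bit k c (+) par k u.
Proof.
by elim: u => [|w u ih] /=; rewrite ?addbF// bit_fl ih -addbA [par _ _ (+) _]addbC.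
Qed.

(** Words act on cells by translation of the bits. The action is free, and the order of the
    crossings is irrelevant. *)
Lemma flw_par u v c : flw u c = flw v c <-> forall k, par k u = par k v.
Proof.
split=> [h k|h]; last by apply: (@bit_inj _ _ Y) => k; rewrite !bit_flw h.
by have /addbI : bit k c (+) par k u = bit k c (+) par k v by rewrite -!bit_flw h.
Qed.

Lemma flw_par0 u c : flw u c = c <-> forall k, par k u = false.
Proof. exact: (flw_par u [::] c). Qed.

Lemma flwC u v c : flw u (flw v c) = flw v (flw u c).
Proof. by rewrite -!flw_cat; apply/flw_par => k; rewrite !par_cat addbC. Qed.

Lemma flwK u c : flw u (flw u c) = c.
Proof. by rewrite -flw_cat; apply/flw_par0 => k; rewrite par_cat addbb. Qed.

Lemma equiv_refl u : equiv u u. Proof. by []. Qed.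

Lemma equiv_sym u v : equiv u v -> equiv v u.
Proof. by case=> h h'; split=> x; rewrite ?h ?h'. Qed.

Lemma equiv_trans v u u' : equiv u v -> equiv v u' -> equiv u u'.
Proof. by move=> [h h'] [k k']; split=> x; rewrite ?h ?h' ?k ?k'. Qed.

Lemma equiv_cat u u' v v' : equiv u u' -> equiv v v' -> equiv (u ++ v) (u' ++ v').
Proof.
by move=> [h h'] [k k']; split=> x; rewrite ?mat_cat ?par_cat ?h ?h' ?k ?k'.
Qed.

Lemma equiv_flw u u' c : equiv u u' -> flw u c = flw u' c.
Proof. by case=> _ h; apply/flw_par. Qed.

Lemma mat_rev t u : mat t u *m mat t (rev u) = 1%:M.
Proof.
elim: u => [|w u ih]; rewrite ?mulmx1//= rev_cons -cats1 mat_cat /= mulmx1.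
by rewrite -mulmxA [mat t u *m _]mulmxA ih mul1mx rflK.
Qed.

Lemma mat_revl t u : mat t (rev u) *m mat t u = 1%:M.
Proof. by rewrite -{2}[u]revK mat_rev. Qed.

Lemma par_rev k u : par k (rev u) = par k u.
Proof. by elim: u => [//|w u ih]; rewrite rev_cons -cats1 par_cat ih /= addbF addbC. Qed.

Lemma equiv_revr u v : equiv (u ++ v ++ rev v) u.
Proof.
split=> x; first by rewrite !mat_cat mat_rev mulmx1.
by rewrite !par_cat par_rev addbb addbF.
Qed.

Lemma words_in_cat wl u v : words_in wl (u ++ v) <-> words_in wl u /\ words_in wl v.
Proof.
elim: u => [|w u ih] /=; first by split=> // -[].
by rewrite ih; split=> [[? []]|[[]]].
Qed.

Lemma words_in_rev wl u : words_in wl u -> words_in wl (rev u).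
Proof.
elim: u => [//|w u ih] [h /ih h']; rewrite rev_cons -cats1.
by apply/words_in_cat; split.
Qed.

Lemma words_inS wl wl' u : (forall w, wl w -> wl' w) -> words_in wl u -> words_in wl' u.
Proof. by move=> h; elim: u => [//|w u ih] [/h ? /ih]. Qed.

(** The combinatorial form of regularity: the reflections in the walls through the point commute,
    and a colour determines at most one of these walls. *)
Definition reg wl := forall w w', wl w -> wl w' ->
  w = w' \/ (col w <> col w' /\ orth w w').

Lemma par_has k u : par k u -> exists a w b, u = a ++ w :: b /\ col w = k.
Proof.
elim: u => [//|w u ih] /=; case: asboolP => /= [h _|_ /ih[a [w' [b [-> h]]]]].
  by exists [::], w, u.
by exists (w :: a), w', b.
Qed.

Lemma equiv_move wl w a b : reg wl -> wl w -> words_in wl a ->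
  equiv (a ++ w :: b) (w :: a ++ b).
Proof.
move=> rw ww; elim: a => [//|w' a ih] [ww' /ih[h h']]; split=> x.
  rewrite /= h /= !mulmxA; congr (_ *m _).
  by case: (rw _ _ ww' ww) => [->//|[_ /rflC]].
rewrite /= h' /= !addbA; congr (_ (+) _); exact: addbC.
Qed.

(** The colour of the first letter occurs again, and by regularity it is the same letter that
    occurs; moved to the front by commutation, it cancels. *)
Lemma words_cancel wl u : reg wl -> words_in wl u -> (forall k, par k u = false) ->
  equiv u [::].
Proof.
move=> rw; move: {2}(size u) (leqnn (size u)) => n.
elim: n u => [|n ih] [|w u]//= un [ww iu] h.
have /par_has[a [w' [b [ue cw']]]] : par (col w) u.
  have := h (col w); case: asboolP => //= _ h'; by rewrite -[par _ _]negbK h'.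
move: iu; rewrite ue => /words_in_cat[ia [ww' ib]].
have w'E : w' = w by case: (rw _ _ ww' ww) => // -[].
subst w'.
have e1 : equiv (w :: a ++ w :: b) (a ++ b).
  have [e e'] := equiv_move b rw ww ia; split=> x.
    by rewrite /= e /= mulmxA rflK mul1mx.
  by rewrite /= e' /= addbA addbb.
apply: (equiv_trans e1); apply: ih => [||k].
- by move: un; rewrite ue !size_cat /= addnS ltnS => /ltnW.
- by apply/words_in_cat.
- by case: e1 => _ e2; rewrite -e2 -ue; exact: h.
Qed.

(** Trivial local holonomy at a regular point: the way in which one passes between two copies around
    it does not affect the matrix. *)
Lemma words_switch wl u v c : reg wl -> words_in wl u -> words_in wl v ->
  flw u c = flw v c -> equiv u v.
Proof.
move=> rw iu iv /flw_par h.
have /(words_cancel rw) [|e e'] : words_in wl (u ++ rev v).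
- by apply/words_in_cat; split => //; exact: words_in_rev.
- by move=> k; rewrite par_cat par_rev h addbb.
split=> // t; rewrite -[RHS]mul1mx.
by have := e t; rewrite mat_cat => /= <-; rewrite -mulmxA mat_revl mulmx1.
Qed.

(** Cancelling repetitions leaves pairwise orthogonal letters, each occurring once. The sign of a
    product with a normal vector can then be followed through the word, as [star_inj] requires. *)
Lemma words_thin wl u : reg wl -> words_in wl u ->
  exists v, [/\ words_in wl v, equiv u v & forall a w b, v = a ++ w :: b ->
    words_in (fun w' => w' <> w) a /\ words_in (fun w' => w' <> w) b].
Proof.
move=> rw; move: {2}(size u) (leqnn (size u)) => n.
elim: n u => [|n ih] u.
  by case: u => // _ _; exists [::]; split=> // -[].
move=> un iu.
have [[a [w [b [d ue]]]]|nd] := pselect (exists a w b d, u = a ++ w :: b ++ w :: d).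
  move: iu un; rewrite ue => /words_in_cat[ia [ww /words_in_cat[ib [_ id]]]] un.
  have [|//|v [iv e nv]] := ih (a ++ b ++ d).
  - by move: un; rewrite !size_cat /= size_cat /= !addnS ltnS => /ltnW.
  - by apply/words_in_cat; split => //; apply/words_in_cat.
  exists v; split => //; apply: equiv_trans e; apply: equiv_cat => //.
  have [e1 e2] := equiv_move d rw ww ib.
  by split=> x; rewrite /= ?e1 ?e2 /= ?mulmxA ?rflK ?mul1mx// addbA addbb.
exists u; split => // a w b ue.
have aux : forall v, (forall x y, v <> x ++ w :: y) -> words_in (fun w' => w' <> w) v.
  elim=> [//|w' v ihv] hv /=; split=> [ww'|].
    by apply: (hv [::] v); rewrite ww'.
  by apply: ihv => x y vE; apply: (hv (w' :: x) y); rewrite vE.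
split; apply: aux => x y vE; apply: nd.
  by exists x, w, y, b; rewrite ue vE -catA.
by exists a, w, x, y; rewrite ue vE.
Qed.

(* A state records the walls through a point of a glued space and one of the
   cells containing it. *)
Definition state := ((L -> Prop) * S)%type.
Implicit Types p : state.

Variable c0 : S.

(** The word [u] leads from the base cell to one of the cells around the point; which one is left
    open. *)
Definition inc p u := exists v, words_in p.1 v /\ flw u c0 = flw v p.2.

(** Here [p'] lies in the open star of [p], and [u'] continues [u] by walls through the centre [p]
    only. The relation is directed, since nearby points lie on fewer walls. *)
Definition adj p u p' u' := (forall w, p'.1 w -> p.1 w) /\
  exists v, words_in p.1 v /\ equiv u' (u ++ v).

(** The part of adjacency that depends on states alone; it holds for all points close to a given
    one. *)
Definition nearst p p' := (forall w, p'.1 w -> p.1 w) /\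
  exists v, words_in p.1 v /\ p'.2 = flw v p.2.

Definition sim p u u' := exists v, words_in p.1 v /\ equiv u' (u ++ v).

Lemma nearst_inc p p' u : nearst p p' -> inc p' u -> inc p u.
Proof.
move=> [s [v [iv vE]]] [v' [iv' h]]; exists (v' ++ v); split.
  by apply/words_in_cat; split => //; exact: words_inS iv'.
by rewrite h vE flw_cat.
Qed.

Lemma nearst_adj p p' u : nearst p p' -> adj p u p' u.
Proof. by move=> [s _]; split => //; exists [::]; rewrite cats0. Qed.

Lemma nearst_next p p' u : nearst p p' -> inc p u ->
  exists u', inc p' u' /\ adj p u p' u'.
Proof.
move=> [s [v [iv vE]]] [v' [iv' h]]; exists (u ++ (v' ++ v)); split.
  exists [::]; split => //=; rewrite flw_cat flwC h vE -flw_cat.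
  by apply/flw_par => k; rewrite !par_cat addbAC addbb.
split => //; exists (v' ++ v); split => //; exact/words_in_cat.
Qed.

Lemma adj_trans p' u' p u p'' u'' : adj p u p' u' -> adj p' u' p'' u'' ->
  adj p u p'' u''.
Proof.
move=> [s [v [iv e]]] [s' [v' [iv' e']]]; split; first by move=> w /s' /s.
exists (v ++ v'); split; first by apply/words_in_cat; split=> //; exact: words_inS iv'.
by apply: (equiv_trans e'); rewrite catA; exact: equiv_cat.
Qed.

Lemma adj_simr p u p' u' u'' : adj p u p' u' -> sim p' u' u'' -> adj p u p' u''.
Proof.
move=> [s [v [iv e]]] [v' [iv' e']]; split => //; exists (v ++ v'); split.
  by apply/words_in_cat; split=> //; exact: words_inS iv'.
by apply: (equiv_trans e'); rewrite catA; exact: equiv_cat.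
Qed.

Lemma adj_siml p u0 u p' u' : sim p u0 u -> adj p u p' u' -> adj p u0 p' u'.
Proof.
move=> [v [iv e]] [s [v' [iv' e']]]; split => //; exists (v ++ v'); split.
  by apply/words_in_cat.
by apply: (equiv_trans e'); rewrite catA; exact: equiv_cat.
Qed.

(** Local uniqueness of lifts: both continuations end in cells around [p'], so by [words_switch] in
    the larger star of [p] they differ only by the walls that connect these cells. *)
Lemma adj_inj p u p' u1 u2 : reg p.1 -> inc p' u1 -> inc p' u2 ->
  adj p u p' u1 -> adj p u p' u2 -> sim p' u1 u2.
Proof.
move=> rp [v1 [i1 h1]] [v2 [i2 h2]] [s [x [ix ex]]] [_ [y [iy ey]]].
exists (v1 ++ v2); split; first exact/words_in_cat.
have e : equiv y (x ++ v1 ++ v2).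
  apply: (words_switch (c := flw u c0) rp) => //.
    apply/words_in_cat; split => //; apply/words_in_cat.
    by split; [exact: words_inS i1|exact: words_inS i2].
  apply/flw_par => k; rewrite !par_cat.
  have : flw (v1 ++ u1) c0 = flw (v2 ++ u2) c0 by rewrite !flw_cat h1 h2 !flwK.
  move=> /flw_par /(_ k); rewrite !par_cat ex.2 ey.2 !par_cat.
  by case: (par k u) (par k v1) (par k v2) (par k x) (par k y) => -[] [] [] [].
apply: (equiv_trans ey); apply: (equiv_trans (equiv_cat (equiv_refl u) e)).
by rewrite catA; apply: equiv_cat => //; exact: equiv_sym.
Qed.

End Words.

(** * Lifts of paths of states to words *)

Section Lifts.
Context {R : realType} {S : Type} (Y : system R S) (c0 : S).
Local Notation state := (state Y).
Local Notation word := (seq (letter Y)).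
Implicit Types (p : state) (q : R -> state).

(** Two points are compared through a common centre [p]: some word at [p''] continues [u'], and by
    regularity at [p] it agrees with [u''] modulo the walls through [p'']. *)
Lemma adj_near p u p' u' p'' u'' : reg p.1 -> nearst p' p'' ->
  inc c0 p' u' -> inc c0 p'' u'' ->
  adj p u p' u' -> adj p u p'' u'' -> adj p' u' p'' u''.
Proof.
move=> rp n' i' i'' a' a''; have [w [iw aw]] := nearst_next n' i'.
exact: adj_simr aw (adj_inj rp iw i'' (adj_trans a' aw) a'').
Qed.

Definition starcont q a b := forall s, a <= s <= b -> exists2 e, 0 < e &
  forall s', a <= s' <= b -> `|s' - s| < e -> nearst (q s) (q s').

Definition is_lift q a b (u : R -> word) := (forall s, a <= s <= b -> inc c0 (q s) (u s)) /\
  forall s, a <= s <= b -> exists2 e, 0 < e &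
  forall s', a <= s' <= b -> `|s' - s| < e -> adj (q s) (u s) (q s') (u s').

Lemma starcontS q a b a' b' : a <= a' -> b' <= b -> starcont q a b -> starcont q a' b'.
Proof.
move=> aa bb h s /andP[s1 s2]; have [|e e0 he] := h s.
  by rewrite (le_trans aa s1) (le_trans s2 bb).
exists e => // s' /andP[s1' s2']; apply: he.
by rewrite (le_trans aa s1') (le_trans s2' bb).
Qed.

(** Inside the star of [p] the words may be chosen independently at each parameter, as continuations
    of [u0]; [adj_near] makes them compatible. Prescribing [ua] at the left end allows pieces to be
    joined. *)
Lemma local_lift p u0 q a b ua : reg p.1 -> starcont q a b -> a <= b ->
  (forall s, a <= s <= b -> nearst p (q s)) -> inc c0 p u0 ->
  inc c0 (q a) ua -> adj p u0 (q a) ua ->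
  exists u, [/\ is_lift q a b u, u a = ua &
    forall s, a <= s <= b -> adj p u0 (q s) (u s)].
Proof.
move=> rp sc ab ne i0 ia aa.
have /choice[u hu] : forall s, exists w, (a <= s <= b ->
    inc c0 (q s) w /\ adj p u0 (q s) w) /\ (s = a -> w = ua).
  move=> s; have [->|sa] := pselect (s = a); first by exists ua.
  have [sab|nsab] := boolP (a <= s <= b); last by exists ua.
  by have [w hw] := nearst_next (ne s sab) i0; exists w.
exists u; split; last 2 first.
- by apply: (hu a).2.
- by move=> s /(hu s).1[].
split=> [s /(hu s).1[]//|s sab].
have [e e0 he] := sc s sab; exists e => // s' sab' se.
have [is1 as1] := (hu s).1 sab; have [is2 as2] := (hu s').1 sab'.
by apply: (adj_near rp) as1 as2 => //; exact: he.
Qed.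

Lemma lift_cat q a b c u u' : a <= b -> b <= c -> is_lift q a b u -> is_lift q b c u' ->
  u b = u' b -> is_lift q a c (fun s => if s <= b then u s else u' s).
Proof.
move=> ab bc [i1 l1] [i2 l2] ub; split=> s /andP[as_ sc].
  case: leP => [sb|/ltW bs]; first by apply: i1; rewrite as_.
  by apply: i2; rewrite bs.
case: (ltgtP s b) => [sb|bs|sb].
- have [|e e0 he] := l1 s; first by rewrite as_ ltW.
  exists (Num.min e (b - s)); first by rewrite lt_min e0 subr_gt0.
  move=> s' /andP[as' _]; rewrite lt_min => /andP[se sbs].
  have s'b : s' <= b by move: sbs; rewrite ltr_norml; lra.
  by rewrite s'b; apply: he => //; rewrite as'.
- have [|e e0 he] := l2 s; first by rewrite ltW.
  exists (Num.min e (s - b)); first by rewrite lt_min e0 subr_gt0.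
  move=> s' /andP[_ sc']; rewrite lt_min => /andP[se sbs].
  have s'b : b < s' by move: sbs; rewrite ltr_norml; lra.
  by rewrite leNgt s'b /=; apply: he => //; rewrite sc' ltW.
subst s; have [|e e0 he] := l1 b; first by rewrite ab lexx.
have [|e' e0' he'] := l2 b; first by rewrite bc lexx.
exists (Num.min e e'); first by rewrite lt_min e0.
move=> s' /andP[as' sc']; rewrite lt_min => /andP[se se'].
case: leP => [sb|/ltW bs]; first by apply: he => //; rewrite as'.
by rewrite ub; apply: he' => //; rewrite bs.
Qed.

Lemma lift_trans q a b c ua (P : word -> Prop) : a <= b -> b <= c ->
  (exists u, [/\ is_lift q a b u, u a = ua &
      exists u', [/\ is_lift q b c u', u' b = u b & P (u' c)]]) ->
  exists u, [/\ is_lift q a c u, u a = ua & P (u c)].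
Proof.
move=> ab bc [u [l1 u1 [u' [l2 u2 pu]]]].
exists (fun s => if s <= b then u s else u' s); split.
- exact: lift_cat.
- by rewrite ab.
- case: leP => // cb; have cE : c = b by apply/eqP; rewrite eq_le cb.
  by move: pu; rewrite cE u2.
Qed.

Lemma norm_near (s e a b z : R) : s - e < a -> b < s + e -> a <= z <= b ->
  `|z - s| < e.
Proof. by move=> h1 h2 /andP[h3 h4]; rewrite ltr_norml; apply/andP; split; lra. Qed.

Lemma lift_exists q x y ua : x <= y -> starcont q x y ->
  (forall s, x <= s <= y -> reg (q s).1) -> inc c0 (q x) ua ->
  exists u, is_lift q x y u /\ u x = ua.
Proof.
move=> xy sc rq i0.
pose Q a b := forall ua, inc c0 (q a) ua -> exists u, [/\ is_lift q a b u, u a = ua & True].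
suff : Q x y by move=> /(_ ua i0)[u [l e _]]; exists u.
apply: interval_chain => // [a b c xa ab bc cy Q1 Q2 w iw|s xsy].
  have [u [l1 u1 _]] := Q1 w iw; apply: (lift_trans (b := b) (P := fun=> True)) => //.
  exists u; split => //; have [|u' [l2 u2 _]] := Q2 (u b).
    by apply: l1.1; rewrite ab lexx.
  by exists u'.
have [e e0 he] := sc s xsy; exists e => // a b xa as_ sb yb ae be w iw.
have ne s' : a <= s' <= b -> nearst (q s) (q s').
  move=> /andP[h1 h2]; apply: he; first by rewrite (le_trans xa h1) (le_trans h2 yb).
  by apply: (norm_near ae be); rewrite h1.
have na := ne a ltac:(by rewrite lexx (le_trans as_ sb)).
have [|||||||u [l1 u1 _]] := @local_lift (q s) w q a b w => //.
- exact: rq.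
- exact: starcontS sc.
- exact: le_trans sb.
- exact: nearst_inc na iw.
- exact: nearst_adj.
- by exists u.
Qed.

Lemma lift_unique q x y u u' : x <= y -> starcont q x y ->
  (forall s, x <= s <= y -> reg (q s).1) -> is_lift q x y u -> is_lift q x y u' ->
  sim (q x) (u x) (u' x) -> sim (q y) (u y) (u' y).
Proof.
move=> xy sc rq [i1 l1] [i2 l2].
apply: (interval_chain (Q := fun a b => sim (q a) (u a) (u' a) -> sim (q b) (u b) (u' b))) => //.
  by move=> a b c _ _ _ _ h1 h2 /h1 /h2.
move=> s xsy; have [e e0 he] := l1 s xsy; have [e' e0' he'] := l2 s xsy.
exists (Num.min e e'); first by rewrite lt_min e0.
move=> a b xa as_ sb yb ae be.
have ab := le_trans as_ sb.
have axy : x <= a <= y by rewrite xa (le_trans ab yb).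
have bxy : x <= b <= y by rewrite (le_trans xa ab) yb.
have ea : `|a - s| < Num.min e e' by apply: (norm_near ae be); rewrite lexx.
have eb : `|b - s| < Num.min e e' by apply: (norm_near ae be); rewrite lexx ab.
move: ea eb; rewrite !lt_min => /andP[ea ea'] /andP[eb eb'] [v [iv ev]].
have [sub1 [v1 [iv1 ev1]]] := he a axy ea.
have [_ [v2 [iv2 ev2]]] := he' a axy ea'.
have ss : sim (q s) (u s) (u' s).
  exists (v1 ++ (v ++ rev v2)); split.
    apply/words_in_cat; split => //; apply/words_in_cat.
    by split; [exact: words_inS iv|exact: words_in_rev].
  apply: (equiv_trans (equiv_sym (equiv_revr (u' s) v2))); rewrite !catA.
  apply: equiv_cat => //; apply: (equiv_trans (equiv_sym ev2)).
  by apply: (equiv_trans ev); apply: equiv_cat.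
apply: (adj_inj (rq s xsy) (i1 b bxy) (i2 b bxy) (he b bxy eb)).
by apply: (adj_siml ss); exact: he'.
Qed.

Definition starcont2 (q : R -> R -> state) r0 r1 a b := forall r s,
  r0 <= r <= r1 -> a <= s <= b -> exists2 e, 0 < e & forall r' s',
  r0 <= r' <= r1 -> a <= s' <= b -> `|r' - r| < e -> `|s' - s| < e ->
  nearst (q r s) (q r' s').

(** The relation propagated along the path includes the radius [e], so that joining two intervals
    only takes the smaller radius. Inside one star the new lift is built from the word of the old
    one at the centre. *)
Lemma lift_stable (q : R -> R -> state) r0 r1 x y r u : x <= y -> r0 <= r <= r1 ->
  starcont2 q r0 r1 x y ->
  (forall s, x <= s <= y -> reg (q r s).1) -> is_lift (q r) x y u ->
  exists2 e, 0 < e & forall r', r0 <= r' <= r1 -> `|r' - r| < e ->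
  forall ua, inc c0 (q r' x) ua -> adj (q r x) (u x) (q r' x) ua ->
  exists u', [/\ is_lift (q r') x y u', u' x = ua & adj (q r y) (u y) (q r' y) (u' y)].
Proof.
move=> xy rr sc rq [iu lu].
have sc1 r' : r0 <= r' <= r1 -> starcont (q r') x y.
  move=> rr' s sxy; have [e e0 he] := sc r' s rr' sxy; exists e => // s' sxy' se.
  by apply: he => //; rewrite subrr normr0.
pose Q a b := exists2 e, 0 < e & forall r', r0 <= r' <= r1 -> `|r' - r| < e ->
  forall ua, inc c0 (q r' a) ua -> adj (q r a) (u a) (q r' a) ua ->
  exists u', [/\ is_lift (q r') a b u', u' a = ua & adj (q r b) (u b) (q r' b) (u' b)].
apply: (interval_chain (Q := Q)) => // [a b c xa ab bc cy [e e0 he] [e' e0' he']|s sxy].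
  exists (Num.min e e'); first by rewrite lt_min e0.
  move=> r' rr'; rewrite lt_min => /andP[re re'] w iw aw.
  have [v [l1 v1 a1]] := he r' rr' re w iw aw.
  apply: (lift_trans (b := b) (P := adj (q r c) (u c) (q r' c))) => //; exists v; split => //.
  apply: he' => //; apply: l1.1; by rewrite ab lexx.
have [e1 e10 he1] := sc r s rr sxy; have [e2 e20 he2] := lu s sxy.
exists (Num.min e1 e2); first by rewrite lt_min e10.
move=> a b xa as_ sb yb ae be; have ab := le_trans as_ sb.
have axy : x <= a <= y by rewrite xa (le_trans ab yb).
have bxy : x <= b <= y by rewrite (le_trans xa ab) yb.
have [e3 e30 he3] := sc r b rr bxy.
exists (Num.min e1 e3); first by rewrite lt_min e10.
move=> r' rr'; rewrite lt_min => /andP[re1 re3] w iw aw.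
have ns s' : a <= s' <= b -> [/\ x <= s' <= y, `|s' - s| < e1 & `|s' - s| < e2].
  move=> sab; have := norm_near ae be sab; rewrite lt_min => /andP[-> ->].
  by split=> //; case/andP: sab => h1 h2; rewrite (le_trans xa h1) (le_trans h2 yb).
have [_ ea1 ea2] := ns a ltac:(by rewrite lexx ab).
have [_ eb1 eb2] := ns b ltac:(by rewrite lexx ab).
have as1 : adj (q r s) (u s) (q r' a) w by apply: adj_trans aw; exact: he2.
have [|||||||u' [l1 u1 hu]] := @local_lift (q r s) (u s) (q r') a b w => //.
- exact: rq.
- by apply: starcontS (sc1 r' rr').
- by move=> s' /ns[? ? _]; exact: he1.
- exact: iu.
exists u'; split => //.
have bab : a <= b <= b by rewrite ab lexx.
apply: (adj_near (rq s sxy)) => //.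
- by apply: he3 => //; rewrite subrr normr0.
- exact: iu.
- exact: l1.1.
- exact: he2.
- exact: hu.
Qed.

(** No wall passes through the end points, so the ambiguity of the final word disappears and
    adjacency there becomes [equiv]. Stability and uniqueness give the result for nearby parameters,
    and continuation in the parameter does the rest. *)
Lemma lift_const (q : R -> R -> state) r0 r1 u0 u1 : r0 <= r1 ->
  starcont2 q r0 r1 0 1 ->
  (forall r s, r0 <= r <= r1 -> 0 <= s <= 1 -> reg (q r s).1) ->
  (forall r, r0 <= r <= r1 -> [/\ forall w, ~ (q r 0).1 w, forall w, ~ (q r 1).1 w &
     (q r 0).2 = c0]) ->
  is_lift (q r0) 0 1 u0 -> is_lift (q r1) 0 1 u1 -> equiv (u0 0) [::] -> equiv (u1 0) [::] ->
  equiv (u0 1) (u1 1).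
Proof.
move=> r01 sc rq qe.
have rr0 : r0 <= r0 <= r1 by rewrite lexx.
have rr1 : r0 <= r1 <= r1 by rewrite lexx andbT.
pose Q a b := forall u u', is_lift (q a) 0 1 u -> is_lift (q b) 0 1 u' ->
  equiv (u 0) [::] -> equiv (u' 0) [::] -> equiv (u 1) (u' 1).
suff : Q r0 r1 by apply.
have sc1 r' : r0 <= r' <= r1 -> starcont (q r') 0 1.
  move=> rr' s sxy; have [e e0 he] := sc r' s rr' sxy; exists e => // s' sxy' se.
  by apply: he => //; rewrite subrr normr0.
have Qs r u u' : r0 <= r <= r1 -> is_lift (q r) 0 1 u -> is_lift (q r) 0 1 u' ->
    equiv (u 0) [::] -> equiv (u' 0) [::] -> equiv (u 1) (u' 1).
  move=> rr l1 l2 e1 e2; have [_ n1 _] := qe r rr.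
  have [|[|w v] [iv ev]] := lift_unique ler01 (sc1 r rr) (fun s => rq r s rr) l1 l2.
  - exists [::]; split => //; rewrite cats0.
    exact: equiv_trans (equiv_sym e1).
  - by rewrite cats0 in ev; exact: equiv_sym.
  - by case: iv => /n1.
apply: (interval_chain (Q := Q)) => //.
  move=> a b c ra ab bc cr Q1 Q2 u u' l1 l2 e1 e2.
  have rb : r0 <= b <= r1 by rewrite (le_trans ra ab) (le_trans bc cr).
  have [|v [lv v0]] := lift_exists (ua := [::]) ler01 (sc1 b rb) (fun s => rq b s rb).
    by exists [::]; split => //=; have [_ _ ->] := qe b rb.
  have ve : equiv (v 0) [::] by rewrite v0.
  by apply: (equiv_trans (Q1 u v l1 lv e1 ve)); apply: Q2.
move=> r rr.
have [|v [lv v0]] := lift_exists (ua := [::]) ler01 (sc1 r rr) (fun s => rq r s rr).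
  by exists [::]; split => //=; have [_ _ ->] := qe r rr.
have ve : equiv (v 0) [::] by rewrite v0.
have [e e0 he] := lift_stable ler01 rr sc (fun s => rq r s rr) lv.
have key r' u : r0 <= r' <= r1 -> `|r' - r| < e -> is_lift (q r') 0 1 u ->
    equiv (u 0) [::] -> equiv (v 1) (u 1).
  move=> rr' re lu e1.
  have [n0 n1 c0E] := qe r rr; have [n0' n1' c0E'] := qe r' rr'.
  have [| |v' [lv' v0' [_ [[|w z] [iz ez]]]]] := he r' rr' re [::].
  - by exists [::]; rewrite c0E'.
  - by split=> [w /n0'//|]; exists [::]; rewrite v0.
  - rewrite cats0 in ez; apply: (equiv_trans (equiv_sym ez)).
    by apply: (Qs r') => //; rewrite v0'.
  - by case: iz => /n1.
exists e => // a b ra ar rb br ae be u u' l1 l2 e1 e2.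
have ab := le_trans ar rb.
apply: (equiv_trans (v := v 1)).
  apply: equiv_sym; apply: (key a) => //; first by rewrite ra (le_trans ab br).
  by apply: (norm_near ae be); rewrite lexx.
apply: (key b) => //; first by rewrite br (le_trans ra ab).
by apply: (norm_near ae be); rewrite lexx andbT.
Qed.

(** States are read off from chosen representatives: one point seen in [W_t] and in [W_total] may
    give different cells of the same star. *)
Lemma lift_eqst q q' a b u :
  (forall s, a <= s <= b -> nearst (q s) (q' s) /\ nearst (q' s) (q s)) ->
  is_lift q a b u -> is_lift q' a b u.
Proof.
move=> h [i l]; split=> s sab; have [n1 n2] := h s sab.
  exact: nearst_inc n2 (i s sab).
have [e e0 he] := l s sab; exists e => // s' sab' se; have [m1 m2] := h s' sab'.
apply: (adj_trans (nearst_adj (u s) n2)); apply: (adj_trans (he s' sab' se)).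
exact: nearst_adj.
Qed.

Lemma lift_prefix q a b u v : (forall s, a <= s <= b -> inc c0 (q s) (v ++ u s)) ->
  is_lift q a b u -> is_lift q a b (fun s => v ++ u s).
Proof.
move=> h [i l]; split => // s sab; have [e e0 he] := l s sab; exists e => // s' sab' se.
have [s1 [x [ix ex]]] := he s' sab' se; split => //; exists x; split => //.
by rewrite -catA; apply: equiv_cat.
Qed.

End Lifts.

(** * Neighbourhoods in subspaces and gluing data *)

Definition inset {T : Type} {D : set T} (x : T) (h : D x) : D :=
  exist (fun x => x \in D) x (mem_set h).

Lemma near_subtype {X : topologicalType} (D : set X) (x : D) (U : set D) :
  nbhs x U <-> exists2 V, nbhs (val x) V & forall y : D, V (val y) -> U y.
Proof.
split.
  move=> [_ [[/= W oW <-] Wx WU]]; exists W => //.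
  exact: open_nbhs_nbhs.
move=> [V]; rewrite nbhsE => -[W [oW Wx] WV] VU.
exists (set_val @^-1` W); split => /=; [by exists W|exact: Wx|].
by move=> y Wy; apply: VU; apply: WV.
Qed.

Lemma cvg_subtype {X T : topologicalType} (D : set X) (F : set_system T)
    {FF : Filter F} (f : T -> D) (x : D) :
  (fun k => val (f k)) @ F --> val x -> f @ F --> x.
Proof.
move=> h U /near_subtype[V nV VU].
by apply: (@filterS _ F _ _ _ _ (h V nV)) => k; exact: VU.
Qed.

Lemma cvg_val {X : topologicalType} (D : set X) (x : D) :
  (fun y : D => val y) @ x --> val x.
Proof. by move=> V nV; apply/near_subtype; exists V. Qed.

(** Besides describing the identifications by walls, the record contains what makes stars into
    neighbourhoods: the set of walls through a point can only shrink nearby, and the copies are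
    finite in number and discrete. *)
Record gluing (R : realType) (X S : topologicalType) (D : set X)
    (E : X -> S -> S -> Prop) := Gluing {
  sys : system R S;
  on : X -> letter sys -> Prop;
  gluedE : forall x c c', E x c c' <-> exists2 w, on x w & c' = fl w c;
  on_near : forall x, D x -> \forall y \near x, forall w, on y w -> on x w;
  cells : finType;
  enum_cell : cells -> S;
  cell_enumerated : forall c, exists i, enum_cell i = c;
  cell_discrete : forall c : S, \forall c' \near c, c' = c }.

(** * Gluings of chambers and their charts *)

Section GluedTopology.
Context {R : realType} {X S : topologicalType} {D : set X}
  {E : X -> S -> S -> Prop} (G : gluing R D E).
Local Notation M := (glued D E).
Local Notation on := (on (g := G)).
Local Notation Y := (sys G).
Implicit Types (x : D) (p : M) (c : S).

Lemma filter_cells {T} (F : set_system T) {FF : Filter F} (P : S -> T -> Prop) :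
  (forall c, \forall k \near F, P c k) -> \forall k \near F, forall c, P c k.
Proof.
move=> h; apply: (@filterS _ F _ [set k | forall i, P (enum_cell (g := G) i) k]).
  by move=> k hk c; have [i <-] := cell_enumerated G c; exact: hk.
exact: filter_forall.
Qed.

(** Each generating identification crosses one wall through [x], so the generated equivalence
    relation consists of words in these walls, which [flwK] reverses. *)
Lemma cellP c x c' x' : @cell X S D E c x = cell c' x' <->
  x = x' /\ exists2 v, words_in (on (val x)) v & c' = flw v c.
Proof.
split.
  move=> /eqmodP /asboolP.
  pose Q (a b : D * S) := a.1 = b.1 /\ exists2 v, words_in (on (val a.1)) v & b.2 = flw v a.2.
  suff : forall a b, Relation_Operators.clos_refl_sym_trans _ (@glue_step X S D E) a b -> Q a b.
    by move=> h /h[].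
  apply: (@Relation_Operators.clos_refl_sym_trans_ind _ _ Q).
  - move=> [a1 a2] [b1 b2] /= [/= <- /(gluedE G) [w ow ->]]; split=> //=.
    by exists [:: w].
  - by move=> [a1 a2]; split=> //=; exists [::].
  - move=> [a1 a2] [b1 b2] _ [/= -> [v iv ->]]; split=> //=; exists v => //.
    by rewrite flwK.
  - move=> [a1 a2] [b1 b2] [d1 d2] _ [/= e [v iv ->]] _ [/= e' [v' iv' ->]].
    subst b1 d1; split=> //=; exists (v' ++ v); first by apply/words_in_cat; split.
    by rewrite flw_cat.
move=> [<- [v iv ->]]; apply/eqmodP/asboolP.
elim: v iv => [_|w v ih [ow /ih h]] /=; first exact: Relation_Operators.rst_refl.
apply: Relation_Operators.rst_trans h _; apply: Relation_Operators.rst_step.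
by split=> //=; apply/(gluedE G); exists w.
Qed.

Lemma cell_flw c x v : words_in (on (val x)) v -> @cell X S D E (flw v c) x = cell c x.
Proof. by move=> iv; apply/esym/cellP; split => //; exists v. Qed.

(** The point of the polytope is determined by [p]; the copy [ce p] is a choice, unique only up to
    the walls through that point. *)
Definition pt p : D := (repr (p : {eq_quot glue_equiv D E}%qT)).1.
Definition ce p : S := (repr (p : {eq_quot glue_equiv D E}%qT)).2.

Lemma ptce p : cell (ce p) (pt p) = p.
Proof. by rewrite /cell -surjective_pairing; exact: reprK. Qed.

Lemma pt_cell c x : pt (@cell X S D E c x) = x.
Proof. by have /cellP[] := ptce (cell c x). Qed.

Lemma ce_cell c x : exists2 v, words_in (on (val x)) v & ce (@cell X S D E c x) = flw v c.
Proof.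
have /cellP[e [v iv h]] := esym (ptce (cell c x)); exists v => //.
Qed.

Definition walls p : letter Y -> Prop := on (val (pt p)).

Definition st p : state Y := (walls p, ce p).

Lemma walls_cell c x : walls (@cell X S D E c x) = on (val x).
Proof. by rewrite /walls pt_cell. Qed.

Lemma cell_continuous c x : @cell X S D E c x' @[x' --> x] --> cell c x.
Proof.
have h : (fun x' : D => (x', c)) @ x --> (x, c).
  exact: (@cvg_pair D D S (nbhs x) (nbhs x) (nbhs c) _ _ _ id (fun=> c) cvg_id (cvg_cst c)).
exact: (cvg_comp _ _ h (@pi_continuous _ {eq_quot glue_equiv D E}%qT (x, c))).
Qed.

(** Neighbourhoods in the quotient are checked in the copies that meet at the point. The same small
    open set, taken in all these copies, is saturated because its points lie on no walls other than
    those through [x]. *)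
Lemma near_cellP (P : set M) c x : (\forall p \near cell c x, P p) <->
  forall v, words_in (on (val x)) v -> \forall x' \near x, P (cell (flw v c) x').
Proof.
split=> [h v iv|h].
  by rewrite -(cell_flw c iv) in h; exact: (cell_continuous h).
pose star c' := exists2 v, words_in (on (val x)) v & c' = flw v c.
pose B := [set x' : D | (forall w, on (val x') w -> on (val x) w) /\
   forall c', star c' -> P (cell c' x')].
have nB : nbhs x B.
  apply: (@filterI _ (nbhs x)).
    have Dx : D (val x) by exact: (set_valP x).
    exact: (cvg_val (on_near G Dx)).
  apply: (@filter_cells _ (nbhs x) _ (fun c' x' => star c' -> P (cell c' x'))) => c'.
  have [[v iv ->]|ns] := pselect (star c').
    by apply: (@filterS _ (nbhs x) _ _ _ _ (h v iv)).
  by apply: (@nearW _ (nbhs x)) => x' /ns.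
pose U : set M := [set q | exists c' x', [/\ star c', B° x' & q = cell c' x']].
apply: (@filterS _ (nbhs (cell c x : M)) _ U P).
  move=> _ [c' [x' [sc /interior_subset [_ Bx] ->]]]; exact: Bx.
apply: open_nbhs_nbhs; split; last first.
  by exists c, x; split => //; exists [::].
suff : open ((\pi_(quotient_topology {eq_quot glue_equiv D E}))%qT @^-1` U) by [].
rewrite openE => -[x1 c1] /= [c' [x' [[v iv c'E] Bx]]].
move=> /cellP[/= e [v' iv' c1E]]; subst x' c'.
have [s1 _] : B x1 by exact: interior_subset.
have sc : star c1.
  exists (v' ++ v); first by apply/words_in_cat; split => //; exact: words_inS iv'.
  by rewrite flw_cat c1E flwK.
exists (B°, [set c2 | c2 = c1]) => /=.
  split; [|exact: (cell_discrete G c1)].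
  by apply: open_nbhs_nbhs; split => //; exact: open_interior.
move=> [x2 c2] [/= Bx2 ->]; exists c1, x2; split => //.
Qed.

Lemma near_star p : \forall p' \near p, nearst (st p) (st p').
Proof.
suff : \forall p' \near (cell (ce p) (pt p) : M), nearst (st p) (st p') by rewrite ptce.
apply/near_cellP => v iv.
have Dx : D (val (pt p)) by exact: (set_valP (pt p)).
apply: (@filterS _ (nbhs (pt p)) _ _ _ _ (cvg_val (on_near G Dx))) => x' sx; split=> /=.
  by move=> w; rewrite walls_cell => /sx.
have [v' iv' ->] := ce_cell (flw v (ce p)) x'; exists (v' ++ v); split.
  by apply/words_in_cat; split => //; exact: words_inS iv'.
by rewrite flw_cat.
Qed.

Lemma nearst_cell c x : nearst (st (cell c x)) (on (val x), c) /\
  nearst (on (val x), c) (st (cell c x)).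
Proof.
have [v iv e] := ce_cell c x.
split; split; rewrite /= ?walls_cell//; exists v; split => //.
by rewrite e flwK.
Qed.

(** Continuity for paths that change copies: jumps among the copies around the limit point are
    harmless. *)
Lemma cvg_cell {T} (F : set_system T) {FF : Filter F} (f : T -> D) (k : T -> S) x c :
  f @ F --> x -> (\forall z \near F, exists2 v, words_in (on (val x)) v & k z = flw v c) ->
  cell (k z) (f z) @[z --> F] --> (cell c x : M).
Proof.
move=> hf hk P /near_cellP h.
have : \forall z \near F, forall c', (exists2 v, words_in (on (val x)) v & c' = flw v c) ->
    P (cell c' (f z)).
  apply: (@filter_cells _ F _ (fun c' z => (exists2 v, words_in (on (val x)) v &
    c' = flw v c) -> P (cell c' (f z)))) => c'.
  have [[v iv ->]|ns] := pselect (exists2 v, words_in (on (val x)) v & c' = flw v c).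
    by apply: (@filterS _ F _ _ _ _ (hf _ (h v iv))).
  by apply: (@nearW _ F) => z /ns.
move=> h'; apply: (@filterS _ F _ _ _ _ (filterI hk h')) => z [hz h'z].
exact: h'z hz.
Qed.

End GluedTopology.

(** The common geometry of [P_t] in [H4] and [P_0] in [H3]. The set [flat] is the linear subspace
    that cuts out the space, [now] is the time at which the abstract reflections are the geometric
    ones, [facet] provides a direction in the relative interior of each facet, and the origin is
    interior to the polytope. *)
Record chamber (R : realType) (S : topologicalType) (X : set 'cV[R]_5)
    (I : set 'M[R]_5) (D : set 'cV[R]_5) (E : 'cV[R]_5 -> S -> S -> Prop)
    (G : gluing R D E) := Chamber {
  flat : set 'cV[R]_5;
  flatD : forall x y, flat x -> flat y -> flat (x + y);
  flatZ : forall a x, flat x -> flat (a *: x);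
  spaceE : forall x, X x <-> H4 x /\ flat x;
  isom_sub : forall A, I A -> IsomH4 A;
  isom_space : forall A x, I A -> X x -> X (A *m x);
  isom_one : I 1%:M;
  isom_mul : forall A B, I A -> I B -> I (A *m B);
  isom_adj : forall A, I A -> I (ladj A);
  isom_flat : forall A, I A -> (forall x, flat x -> A *m x = x) -> A = 1%:M;
  now : time (sys G);
  vec : letter (sys G) -> 'cV[R]_5;
  vec_gt0 : forall w, 0 < lorentz (vec w) (vec w);
  vec_flat : forall w, flat (vec w);
  vec_isom : forall w, I (reflection (vec w));
  chamberE : forall x, D x <-> X x /\ forall w, lorentz (vec w) x <= 0;
  onE : forall x w, on (g := G) x w <-> lorentz (vec w) x = 0;
  rflE : forall w, rfl now w = reflection (vec w);
  facet : forall w, exists f, [/\ cone f, flat f, lorentz (vec w) f = 0 &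
    forall w', w' <> w -> lorentz (vec w') f < 0];
  orth_vec : forall w w', col w <> col w' -> lorentz (vec w) (vec w') = 0 -> orth w w';
  vec_orth : forall w w', orth w w' -> lorentz (vec w) (vec w') = 0;
  faces : finType;
  enum_face : faces -> letter (sys G);
  face_enumerated : forall w, exists i, enum_face i = w;
  chamber_origin : D (@origin R);
  vec_origin : forall w, lorentz (vec w) (@origin R) < 0 }.

(** * Interior points, facets and rigidity of isometries *)

Section Chambers.
Context {R : realType} {S : topologicalType} {X : set 'cV[R]_5} {I : set 'M[R]_5}
  {D : set 'cV[R]_5} {E : 'cV[R]_5 -> S -> S -> Prop} {G : gluing R D E}
  (H : chamber X I G).
Local Notation M := (glued D E).
Local Notation on := (on (g := G)).
Local Notation Y := (sys G).
Local Notation vec := (vec H).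
Implicit Types (x : D) (p q : M) (c : S) (w : letter Y) (v : seq (letter Y)).

Lemma filter_faces {T} (F : set_system T) {FF : Filter F} (P : letter Y -> T -> Prop) :
  (forall w, \forall k \near F, P w k) -> \forall k \near F, forall w, P w k.
Proof.
move=> h; apply: (@filterS _ F _ [set k | forall i, P (enum_face (c := H) i) k]).
  by move=> k hk c; have [i <-] := face_enumerated H c; exact: hk.
exact: filter_forall.
Qed.

Lemma space_H4 z : X z -> H4 z. Proof. by move=> /(spaceE H)[]. Qed.
Lemma space_flat z : X z -> flat H z. Proof. by move=> /(spaceE H)[]. Qed.
Lemma chamber_X x : X (val x).
Proof. by have := set_valP x; rewrite /= => /(chamberE H)[]. Qed.
Lemma chamber_le0 x w : lorentz (vec w) (val x) <= 0.
Proof. by have := set_valP x; rewrite /= => /(chamberE H)[_]. Qed.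

Lemma near_cone (z : 'cV[R]_5) : cone z -> \forall y \near z, cone y.
Proof.
move=> [zz z0]; have h1 := @cvgr_lt _ _ _ (nbhs_filter z) _ _ (@lorentz2_continuous _ z) _ zz.
have h2 := @cvgr_gt _ _ _ (nbhs_filter z) _ _ (@coord_continuous _ _ _ ord0 0 z) _ z0.
by apply: (@filterS _ (nbhs z) _ _ _ _ (@filterI _ (nbhs z) _ _ _ h1 h2)) => y [].
Qed.

Lemma near_ray (z y : 'cV[R]_5) (N : set 'cV[R]_5) : H4 z -> nbhs z N ->
  \forall d \near (0 : R), cone (z + d *: y) /\ N (nrm (z + d *: y)).
Proof.
move=> hz nN; have cz := H4_cone hz.
have c0 : (z + d *: y) @[d --> (0 : R)] --> z.
  rewrite -[X in _ --> X]addr0 -(scale0r y); apply: cvgD; first exact: cvg_cst.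
  by apply: cvgZ; [exact: cvg_id|exact: cvg_cst].
have h1 := c0 _ (near_cone cz).
have h2 : nrm (z + d *: y) @[d --> (0 : R)] --> nrm z by exact: cvg_nrm.
rewrite nrm_id// in h2.
by apply: (@filterS _ (nbhs (0 : R)) _ _ _ _
  (@filterI _ (nbhs (0 : R)) _ _ _ h1 (h2 _ nN))) => d [].
Qed.

Lemma near_ray_gt0 (z y : 'cV[R]_5) (N : set 'cV[R]_5) : H4 z -> nbhs z N ->
  exists2 d : R, 0 < d & cone (z + d *: y) /\ N (nrm (z + d *: y)).
Proof.
move=> hz nN; have := near_ray y hz nN => /nbhs_ballP[e /= e0 h].
exists (e / 2); first by rewrite divr_gt0.
by apply: h; rewrite /ball /= sub0r normrN gtr0_norm ?divr_gt0// ltr_pdivrMr// ltr_pMr// ltr1n.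
Qed.

Lemma near_lt0 (z v0 : 'cV[R]_5) : lorentz v0 z < 0 -> \forall y \near z, lorentz v0 y < 0.
Proof.
by move=> h; exact: (@cvgr_lt _ _ _ (nbhs_filter z) _ _ (@lorentz_continuous _ v0 z) _ h).
Qed.

Lemma ray_space (z y : 'cV[R]_5) d : X z -> flat H y -> cone (z + d *: y) ->
  X (nrm (z + d *: y)).
Proof.
move=> /(spaceE H)[_ fz] fy c; apply/(spaceE H); split; first exact: nrm_H4.
by apply: flatZ; apply: flatD => //; exact: flatZ.
Qed.

(** The point is moved slightly towards the origin, where all the inequalities are strict. *)
Lemma interior_near x (N : set 'cV[R]_5) : nbhs (val x) N ->
  exists x' : D, N (val x') /\ forall w, lorentz (vec w) (val x') < 0.
Proof.
move=> nN; have Xx := chamber_X x.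
have [d d0 [cd Nd]] := near_ray_gt0 (@origin R) (space_H4 Xx) nN.
have h w : lorentz (vec w) (nrm (val x + d *: @origin R)) < 0.
  rewrite lorentz_nrm pmulr_rlt0 ?nrm_scale// !lorentzE.
  by have := chamber_le0 x w; have := vec_origin H w; nra.
have fo : flat H (@origin R).
  by apply: space_flat; have /(chamberE H)[] := chamber_origin H.
have Dz : D (nrm (val x + d *: @origin R)).
  by apply/(chamberE H); split=> [|w]; [exact: ray_space|exact/ltW].
by exists (inset Dz).
Qed.

(** The point is moved slightly towards the interior point of the facet, where only the inequality
    of [w] is an equality. *)
Lemma facet_near x w (N : set 'cV[R]_5) : on (val x) w -> nbhs (val x) N ->
  exists x' : D, [/\ N (val x'), lorentz (vec w) (val x') = 0 &
    forall w', w' <> w -> lorentz (vec w') (val x') < 0].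
Proof.
move=> /(onE H) ow nN; have Xx := chamber_X x; have [f [cf ff f0 flt]] := facet H w.
have [d d0 [cd Nd]] := near_ray_gt0 f (space_H4 Xx) nN.
have h w' : w' <> w -> lorentz (vec w') (nrm (val x + d *: f)) < 0.
  move=> /flt h; rewrite lorentz_nrm pmulr_rlt0 ?nrm_scale// !lorentzE.
  by have := chamber_le0 x w'; nra.
have e : lorentz (vec w) (nrm (val x + d *: f)) = 0.
  by rewrite lorentz_nrm !lorentzE ow f0 mulr0 addr0 mulr0.
have Dz : D (nrm (val x + d *: f)).
  apply/(chamberE H); split=> [|w']; first exact: ray_space.
  by have [->|/h/ltW//] := pselect (w' = w); rewrite e.
by exists (inset Dz).
Qed.

(** A short displacement of [z] along [y] remains in the neighbourhood after normalization; by
    linearity, fixing both [z] and the displaced point means fixing [y]. *)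
Lemma fix_linear (A : 'M[R]_5) (z : 'cV[R]_5) (L : set 'cV[R]_5) :
  (forall y y', L y -> L y' -> L (y + y')) -> (forall a y, L y -> L (a *: y)) ->
  (forall y, L y -> flat H y) -> X z -> L z ->
  (\forall y \near z, X y -> L y -> A *m y = y) -> forall y, L y -> A *m y = y.
Proof.
move=> LD LZ Lf Xz Lz nA y Ly; have hz := space_H4 Xz.
have Az : A *m z = z by exact: (nbhs_singleton nA).
have [d d0 [cd Nd]] := near_ray_gt0 y hz nA.
have Lzd : L (z + d *: y) by apply: LD => //; exact: LZ.
have := Nd (ray_space Xz (Lf y Ly) cd) (LZ _ _ Lzd).
rewrite /nrm -scalemxAr => /(scalerI _) h.
have {h} := h (lt0r_neq0 (nrm_scale cd)).
rewrite mulmxDr Az -scalemxAr => /addrI /(scalerI _) h.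
by apply: h; rewrite gt_eqF.
Qed.

Lemma isom_rigid (A B : 'M[R]_5) (z : 'cV[R]_5) : I A -> I B -> X z ->
  (\forall y \near z, X y -> A *m y = B *m y) -> A = B.
Proof.
move=> IA IB Xz nA.
have e : ladj B *m A = 1%:M.
  apply: (isom_flat (c := H)).
    by apply: (isom_mul H) => //; exact: (isom_adj H).
  apply: (fix_linear (z := z)) => //.
  - exact: flatD.
  - exact: flatZ.
  - exact: space_flat.
  apply: (@filterS _ (nbhs z) _ _ _ _ nA) => y h Xy _.
  by rewrite -mulmxA h// mulmxA adjK ?mul1mx//; exact: (isom_sub H).
by rewrite -[A]mul1mx -(adjKr (isom_sub H IB)) -mulmxA e mulmx1.
Qed.

(** The quotient [C] of the two isometries fixes the hyperplane orthogonal to [v], hence sends [v]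
    to a multiple of itself; preservation of the norm leaves the factors 1 and -1. *)
Lemma isom_facet (A B : 'M[R]_5) (z v : 'cV[R]_5) : I A -> I B -> X z ->
  flat H v -> 0 < lorentz v v -> I (reflection v) -> lorentz v z = 0 ->
  (\forall y \near z, X y -> lorentz v y = 0 -> A *m y = B *m y) ->
  B = A \/ B = A *m reflection v.
Proof.
move=> IA IB Xz fv v0 Iv vz nA.
pose C := ladj A *m B.
have IC : I C by apply: (isom_mul H) => //; exact: (isom_adj H).
have fixC y : flat H y -> lorentz v y = 0 -> C *m y = y.
  move=> fy vy; apply: (fix_linear (A := C) (z := z)
    (L := [set y | flat H y /\ lorentz v y = 0])) => //.
  - move=> x1 y1 [f1 v1] [f2 v2]; split; first exact: flatD.
    by rewrite !lorentzE v1 v2 addr0.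
  - by move=> a x1 [f1 v1]; split; [exact: flatZ|rewrite !lorentzE v1 mulr0].
  - by move=> x1 [].
  - by split=> //; exact: space_flat.
  apply: (@filterS _ (nbhs z) _ _ _ _ nA) => y1 h Xy [_ vy1].
  by rewrite -mulmxA -h// mulmxA adjK ?mul1mx//; exact: (isom_sub H).
have BE : B = A *m C by rewrite /C mulmxA adjKr ?mul1mx//; exact: (isom_sub H).
have dec y : y = (y - (lorentz v y / lorentz v v) *: v) + (lorentz v y / lorentz v v) *: v.
  by rewrite subrK.
have perp y : lorentz v (y - (lorentz v y / lorentz v v) *: v) = 0.
  by rewrite !lorentzE; field; rewrite gt_eqF.
have fperp y : flat H y -> flat H (y - (lorentz v y / lorentz v v) *: v).
  by move=> fy; apply: flatD => //; rewrite -scaleNr; exact: flatZ.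
have C4 := isom_sub H IC.
pose u := C *m v.
(* The group is only known to preserve the space, not its span. The image of [v] is recovered as a
   combination of the images of two points of the space, [z] and a point on the ray from [z] along
   [v]. *)
have fu : flat H u.
  have fXz := space_flat (isom_space H IC Xz).
  have [d d0 [cd _]] := near_ray_gt0 v (space_H4 Xz) (@filterT _ (nbhs z) _).
  have /(isom_space H IC)/space_flat := ray_space Xz fv cd.
  rewrite /nrm -scalemxAr => /(flatZ (Num.sqrt (- lorentz (z + d *: v) (z + d *: v)))).
  rewrite scalerA divff ?scale1r; last by rewrite -invr_eq0 gt_eqF// nrm_scale.
  rewrite mulmxDr -scalemxAr => /(flatD (flatZ (-1) fXz)).
  rewrite scaleN1r addKr => /(flatZ d^-1); rewrite scalerA mulVf ?scale1r// gt_eqF//.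
have uperp y : flat H y -> lorentz v y = 0 -> lorentz u y = 0.
  by move=> fy vy; rewrite -(fixC y fy vy) C4.1.
(* The component of [u] orthogonal to [v]. Since [u] is orthogonal to the fixed hyperplane, this
   component is orthogonal both to itself and to the time-like [z], so it vanishes. *)
pose r := u - (lorentz v u / lorentz v v) *: v.
have vr : lorentz v r = 0 by rewrite /r !lorentzE; field; rewrite gt_eqF.
have r0 : r = 0.
  apply: (cone_orth (H4_cone (space_H4 Xz))).
    by rewrite /r !lorentzE vz uperp// ?mulr0 ?subr0//; exact: space_flat.
  have fr : flat H r by apply: flatD => //; rewrite -scaleNr; exact: flatZ.
  by rewrite {1}/r lorentzDl lorentzNl lorentzZl vr (uperp r fr vr) mulr0 subr0.
have uE : u = (lorentz v u / lorentz v v) *: v.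
  by apply/eqP; rewrite -subr_eq0 -/r r0.
set l := lorentz v u / lorentz v v in uE.
have l2 : l ^+ 2 = 1.
  have := C4.1 v v; rewrite -/u uE !lorentzE mulrA -expr2 => h.
  by apply: (mulIf (lt0r_neq0 v0)); rewrite mul1r.
have spl y : flat H y -> exists2 a, lorentz v (y + a *: v) = 0 & flat H (y + a *: v).
  move=> fy; exists (- (lorentz v y / lorentz v v)).
    by rewrite !lorentzE; field; rewrite gt_eqF.
  by apply: flatD => //; exact: flatZ.
have /eqP : (l - 1) * (l + 1) = 0 by rewrite -subr_sqr l2 expr1n subrr.
rewrite mulf_eq0 subr_eq0 addr_eq0 => /orP[] /eqP lE.
- left; rewrite BE (_ : C = 1%:M) ?mulmx1//; apply: (isom_flat (c := H) IC) => y fy.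
  have [a va fa] := spl y fy; have := fixC _ fa va.
  by rewrite mulmxDr -scalemxAr -/u uE lE scale1r => /addIr.
right; rewrite BE; congr (_ *m _).
suff e : C *m reflection v = 1%:M.
  by rewrite -[LHS]mulmx1 -(reflectionK v0) mulmxA e mul1mx.
apply: (isom_flat (c := H)); first exact: (isom_mul H).
move=> y fy; have [a va fa] := spl y fy; have := fixC _ fa va.
rewrite -{1}(reflection_id va) mulmxA => h.
have h2 : C *m reflection v *m (a *: v) = a *: v.
  rewrite -scalemxAr -[_ *m _ *m v]mulmxA reflection_self//.
  by rewrite mulmxN -/u uE lE scaleN1r opprK.
by rewrite mulmxDr h2 in h; exact: addIr h.
Qed.

End Chambers.

(** * Charts and regular points *)

Section Charts.
Context {R : realType} {S : topologicalType} {X : set 'cV[R]_5} {I : set 'M[R]_5}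
  {D : set 'cV[R]_5} {E : 'cV[R]_5 -> S -> S -> Prop} {G : gluing R D E}
  (H : chamber X I G).
Local Notation M := (glued D E).
Local Notation on := (on (g := G)).
Local Notation Y := (sys G).
Local Notation vec := (vec H).
Local Notation mt := (mat (Y := Y) (now H)).
Implicit Types (x : D) (p q : M) (c : S) (w : letter Y) (v : seq (letter Y)).

Lemma mat_isom v : I (mt v).
Proof.
elim: v => [|w v ih] /=; first exact: (isom_one H).
apply: (isom_mul H) => //.
by rewrite (rflE H); exact: vec_isom.
Qed.

Lemma mat_lorentz v (y z : 'cV[R]_5) : lorentz (mt v *m y) (mt v *m z) = lorentz y z.
Proof.
elim: v => [|w v ih] /=; first by rewrite !mul1mx.
by rewrite -!mulmxA (rflE H) reflection_isometry// vec_gt0.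
Qed.

Lemma mat_space v (z : 'cV[R]_5) : X z -> X (mt v *m z).
Proof.
move=> Xz; elim: v => [|w v ih] /=; first by rewrite mul1mx.
by rewrite -mulmxA (rflE H); apply: (isom_space H) => //; exact: vec_isom.
Qed.

Lemma mat_fix v (z : 'cV[R]_5) : words_in (on z) v -> mt v *m z = z.
Proof.
elim: v => [|w v ih] /=; first by rewrite mul1mx.
by move=> [/(onE H) ow /ih h]; rewrite -mulmxA h (rflE H) reflection_id.
Qed.

Lemma rfl_fix w (z : 'cV[R]_5) : on z w -> reflection (vec w) *m z = z.
Proof. by move=> /(onE H) ow; exact: reflection_id. Qed.

Definition germ (psi : M -> 'cV[R]_5) c x (A : 'M[R]_5) : Prop :=
  I A /\ \forall x' \near x, psi (cell c x') = A *m val x'.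

Lemma chart_germ p psi c x : chart_at X I p psi -> p = cell c x ->
  exists A, germ psi c x A.
Proof.
move=> [U [[oU Up] _ _ _ /(_ c)[A IA hA]]] pE; exists A; split => //.
have : \forall x' \near x, U (cell c x').
  by apply: (cell_continuous (c := c) (x := x)); rewrite -pE; exact: open_nbhs_nbhs.
by move=> h; apply: (@filterS _ (nbhs x) _ _ _ _ h) => x'; exact: hA.
Qed.

(* The germs of a chart on either side of a wall differ by the reflection in that
   wall: they agree on it, and coincide nowhere else because charts are injective. *)
Lemma chart_cross p psi c x w A B : chart_at X I p psi -> p = cell c x ->
  on (val x) w -> germ psi c x A -> germ psi (fl w c) x B ->
  B = A *m reflection (vec w).
Proof.
move=> [U [[oU Up] injU _ _ _]] pE ow [IA hA] [IB hB].
have fE : cell (fl w c) x = p.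
  by rewrite pE -(cell_flw (G := G) (v := [:: w]) c).
have hU c' : cell c' x = p -> \forall x' \near x, U (cell c' x').
  move=> e; apply: (cell_continuous (c := c') (x := x)); rewrite e.
  exact: open_nbhs_nbhs.
have nA := @filterI _ _ (nbhs_filter x) _ _ hA hB.
have nU := @filterI _ _ (nbhs_filter x) _ _ (hU c (esym pE)) (hU _ fE).
have /near_subtype[N /nbhs_interior nN hN] := @filterI _ _ (nbhs_filter x) _ _ nA nU.
have [x' [nN'0 ox' ltx']] := facet_near H ow nN.
have Xx' := chamber_X H x'.
have : B = A \/ B = A *m reflection (vec w).
  apply: (isom_facet (H := H) IA IB Xx' _ (vec_gt0 H w) (vec_isom H w) ox').
    exact: vec_flat.
  have nlt : \forall y \near val x', forall w', w' <> w -> lorentz (vec w') y < 0.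
    apply: (@filter_faces _ _ _ _ _ _ _ H _ _ (nbhs_filter (val x'))
      (fun w' y => w' <> w -> lorentz (vec w') y < 0)) => w'.
    have [->|/ltx' h] := pselect (w' = w); first by apply: nearW => y /(_ erefl).
    by apply: (@filterS _ (nbhs (val x')) _ _ _ _ (near_lt0 h)).
  have nN' : \forall y \near val x', N y by exact: nN'0.
  apply: (@filterS _ (nbhs (val x')) _ _ _ _ (@filterI _ (nbhs (val x')) _ _ _ nlt nN')).
  move=> y [ylt Ny] Xy yw.
  have Dy : D y.
    apply/(chamberE H); split => // w'.
    by have [->|/ylt/ltW//] := pselect (w' = w); rewrite yw.
  have [[<- <-] _] := hN (inset Dy) Ny.
  congr psi; rewrite -(cell_flw (G := G) (v := [:: w]) c)//=; split => //.
  exact/(onE H).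
case=> [BA|->//]; have [x2 [Nx2 ltx2]] := interior_near H nN.
have [[h1 h2] [h3 h4]] := hN x2 (nbhs_singleton Nx2).
have /(cellP G)[_ [[|w' v] iv iv']] : @cell _ _ D E c x2 = cell (fl w c) x2.
  by apply: injU; rewrite ?inE// h1 h2 BA.
- move: iv' => /= /(congr1 (bit (col w))); rewrite bit_fl asboolT// addbT.
  by case: bit.
- by move: iv => /= [/(onE H) h _]; have := ltx2 w'; rewrite h ltxx.
Qed.

Lemma reflection_eq (v w : 'cV[R]_5) : 0 < lorentz w w ->
  reflection v = reflection w -> exists a, w = a *: v.
Proof.
move=> w0 e; exists (lorentz v w / lorentz v v).
have := reflection_self w0; rewrite -e reflectionE => /matrixP h.
by apply/matrixP => i j; have := h i j; rewrite !mxE; lra.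
Qed.

Lemma reflection_comm_orth (v w : 'cV[R]_5) : 0 < lorentz v v -> 0 < lorentz w w ->
  reflection v *m reflection w = reflection w *m reflection v ->
  (forall a, v <> a *: w) -> lorentz v w = 0.
Proof.
move=> v0 w0 /(congr1 (mulmx^~ w)) /= h nvw.
pose k := 2 * lorentz v w / lorentz v v; pose k' := 2 * lorentz w v / lorentz w w.
move: h; rewrite -!mulmxA reflection_self// mulmxN [reflection v *m w]reflectionE.
rewrite -/k mulmxBr reflection_self// -scalemxAr reflectionE -/k' => /matrixP h.
have [k0|k0] := eqVneq k 0.
  move/eqP: k0; rewrite /k !mulf_eq0 invr_eq0 (gt_eqF v0) orbF pnatr_eq0 /=.
  by move/eqP.
exfalso; apply: (nvw (k' / 2)); apply/matrixP => i j.
by have := h i j; rewrite !mxE => hij; apply: (mulfI k0); lra.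
Qed.

Lemma facet_indep w w' (a : R) : w <> w' -> vec w <> a *: vec w'.
Proof.
move=> ww' e; have [f [_ _ f0 flt]] := facet H w'.
by have := flt w ww'; rewrite e lorentzZl f0 mulr0 ltxx.
Qed.

(** Two walls of the same colour lead to the same copy, so their reflections would coincide although
    the facets differ. Two walls of different colours, crossed in either order, lead to the same
    copy, so their reflections commute, which for independent normals means orthogonality. *)
Lemma reg_of_chart p psi c x : chart_at X I p psi -> p = cell c x -> reg (on (val x)).
Proof.
move=> cp pE w w' ow ow'; have [->|ww'] := pselect (w = w'); [by left|right].
have pE1 a (oa : on (val x) a) c' : p = cell c' x -> p = cell (fl a c') x.
  by move=> e; rewrite e -(cell_flw (G := G) (v := [:: a]) c').
have pw := pE1 w ow c pE; have pw' := pE1 w' ow' c pE.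
have [A gA] := chart_germ cp pE; have [B gB] := chart_germ cp pw.
have [B' gB'] := chart_germ cp pw'.
have BA := chart_cross cp pE ow gA gB; have BA' := chart_cross cp pE ow' gA gB'.
have IA := isom_sub H gA.1.
have cancel (U V : 'M[R]_5) : A *m U = A *m V -> U = V.
  by move=> e; rewrite -[U]mul1mx -[V]mul1mx -(adjK IA) -!mulmxA e.
have v0 := vec_gt0 H w; have v0' := vec_gt0 H w'.
have cww' : col w <> col w'.
  move=> cc; have fE : fl w c = fl w' c.
    by apply: ((flw_par [:: w] [:: w'] c).2 _) => k; rewrite /= cc.
  rewrite fE in gB; have := chart_cross cp pE ow' gA gB; rewrite BA => /cancel.
  by move=> /(reflection_eq v0')[a e]; apply: (@facet_indep w' w a) => // /esym.
split => //; apply: (orth_vec (c := H)) => //.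
have pww' := pE1 w' ow' _ pw; have [C gC] := chart_germ cp pww'.
have h1 := chart_cross cp pw ow' gB gC.
have fE : fl w' (fl w c) = fl w (fl w' c) by exact: (flwC [:: w'] [:: w] c).
rewrite fE in gC; have := chart_cross cp pw' ow gB' gC.
rewrite h1 BA BA' -!mulmxA => /cancel h.
by apply: reflection_comm_orth => // a; exact: facet_indep.
Qed.

(** A point on the wrong side of a wall through [x] is reflected in it. As these walls are
    orthogonal, a reflection does not disturb the inequalities already obtained, so one pass through
    the list of faces suffices. The neighbourhood is shrunk so that its reflection is also good. *)
Lemma fold_near x (s : seq (faces H)) (N : set 'cV[R]_5) : reg (on (val x)) -> nbhs (val x) N ->
  \forall z \near val x, X z -> exists v y, [/\ words_in (on (val x)) v, X y, N y,
    z = mt v *m y & forall i, i \in s -> on (val x) (enum_face (c := H) i) ->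
      lorentz (vec (enum_face i)) y <= 0].
Proof.
move=> rx; elim: s N => [|i s ih] N nN.
  apply: (@filterS _ _ (nbhs_filter (val x)) _ _ _ nN) => z Nz Xz.
  by exists [::], z; rewrite mul1mx.
pose w := enum_face (c := H) i.
have [ow|nw] := pselect (on (val x) w); last first.
  apply: (@filterS _ _ (nbhs_filter (val x)) _ _ _ (ih N nN)) => z h /h.
  move=> [v [y [iv Xy Ny zE hy]]]; exists v, y; split => // j.
  by rewrite inE => /orP[/eqP -> /nw|/hy].
have nN' : nbhs (val x) [set y | N (reflection (vec w) *m y)].
  have := @mulmx_continuous _ (reflection (vec w)) (val x).
  by rewrite rfl_fix//; apply.
have nN2 := @filterI _ _ (nbhs_filter (val x)) _ _ nN nN'.
apply: (@filterS _ _ (nbhs_filter (val x)) _ _ _ (ih _ nN2)) => z h /h.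
move=> [v [y [iv Xy [Ny Ny'] zE hy]]].
have [wy|wy] := leP (lorentz (vec w) y) 0.
  exists v, y; split => // j; rewrite inE => /orP[/eqP ->//|/hy]; exact.
exists (v ++ [:: w]), (reflection (vec w) *m y); split => //.
- by apply/words_in_cat.
- by apply: (isom_space H) => //; exact: vec_isom.
- rewrite mat_cat /= mulmx1 (rflE H) -mulmxA [reflection _ *m _]mulmxA.
  by rewrite reflectionK ?mul1mx// vec_gt0.
have v0 := vec_gt0 H w.
have ww : lorentz (vec w) (reflection (vec w) *m y) <= 0.
  by rewrite -lorentz_reflection// reflection_self// lorentzNl oppr_le0 ltW.
move=> j; rewrite inE => /orP[/eqP ->//|js oj].
have [->//|ne] := pselect (enum_face (c := H) j = w).
rewrite -lorentz_reflection// reflection_id; first exact: hy.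
apply: (vec_orth H).
by have [e|[]//] := rx w _ ow oj; case: ne.
Qed.

Lemma star_cover x c (P : set M) : reg (on (val x)) -> nbhs (cell c x) P ->
  \forall z \near val x, X z -> exists v (y : D), [/\ words_in (on (val x)) v,
    z = mt v *m val y & P (cell (flw v c) y)].
Proof.
move=> rx /(near_cellP G) nP.
pose Q c' := exists2 v, words_in (on (val x)) v & c' = flw v c.
have : \forall y \near x, forall c', Q c' -> P (cell c' y).
  apply: (@filter_cells _ _ _ _ _ G _ _ (nbhs_filter x) (fun c' y => Q c' -> P (cell c' y))) => c'.
  have [[v iv ->]|nQ] := pselect (Q c'); last by apply: nearW => y /nQ.
  by apply: (@filterS _ _ (nbhs_filter x) _ _ _ (nP v iv)).
move=> /near_subtype[N nN hN].
have nlt : \forall y \near val x, forall w, ~ on (val x) w -> lorentz (vec w) y < 0.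
  apply: (@filter_faces _ _ _ _ _ _ _ H _ _ (nbhs_filter (val x))
    (fun w y => ~ on (val x) w -> lorentz (vec w) y < 0)) => w.
  have [ow|nw] := pselect (on (val x) w); first exact: nearW.
  have lt0 : lorentz (vec w) (val x) < 0.
    by rewrite lt_neqAle chamber_le0 andbT; apply/eqP => /(onE H).
  by apply: (@filterS _ _ (nbhs_filter (val x)) _ _ _ (near_lt0 lt0)).
have nN2 := @filterI _ _ (nbhs_filter (val x)) _ _ nN nlt.
apply: (@filterS _ _ (nbhs_filter (val x)) _ _ _ (fold_near (enum (faces H)) rx nN2)).
move=> z h /h [v [y [iv Xy [Ny lty] zE hy]]].
have Dy : D y.
  apply/(chamberE H); split => // w; have [ow|/lty/ltW//] := pselect (on (val x) w).
  have [i iE] := face_enumerated H w; rewrite -iE; apply: hy; first by rewrite mem_enum.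
  by rewrite iE.
by exists v, (inset Dy); split => //; apply: (hN (inset Dy) Ny); exists v.
Qed.

(** In the thinned word each letter is orthogonal to all the others, so applying the word only
    changes the sign of the product with its normal vector. That product is nonpositive at both
    points, hence zero, and the letter is a wall through [x]. *)
Lemma star_inj wl v x x' : reg wl -> words_in wl v -> mt v *m val x = val x' ->
  x = x' /\ exists2 v', words_in (on (val x)) v' & equiv v v'.
Proof.
move=> rw iv e; have [v1 [iv1 ev nd]] := words_thin rw iv.
have e1 : mt v1 *m val x = val x' by rewrite -e ev.1.
have orthw a w b : v1 = a ++ w :: b ->
    words_in (fun w' => lorentz (vec w) (vec w') = 0) (a ++ b).
  move=> v1E; have [na nb] := nd a w b v1E; move: iv1; rewrite v1E.
  move=> /words_in_cat[ia [ww ib]].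
  have aux u : words_in wl u -> words_in (fun w' => w' <> w) u ->
      words_in (fun w' => lorentz (vec w) (vec w') = 0) u.
    elim: u => [//|w' u ih] [h1 /ih h2] [h3 /h2 h4]; split => //.
    apply: (vec_orth H); have [h|[]//] := rw w w' ww h1.
    by case: h3.
  by apply/words_in_cat; split; exact: aux.
have inv u w (y : 'cV[R]_5) : words_in (fun w' => lorentz (vec w) (vec w') = 0) u ->
    lorentz (vec w) (mt u *m y) = lorentz (vec w) y.
  elim: u => [|w' u ih] /=; first by rewrite mul1mx.
  move=> [h /ih <-]; rewrite -mulmxA (rflE H) -lorentz_reflection ?vec_gt0//.
  by rewrite reflection_id// lorentzC.
have on1 a w b : v1 = a ++ w :: b -> on (val x) w.
  move=> v1E; have /words_in_cat[ia ib] := orthw a w b v1E.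
  have := chamber_le0 H x' w; rewrite -e1 v1E mat_cat /= -!mulmxA (rflE H) inv//.
  rewrite -lorentz_reflection ?vec_gt0// reflection_self ?vec_gt0// lorentzNl inv//.
  rewrite oppr_le0 => h; apply/(onE H); apply/eqP.
  by rewrite eq_le h chamber_le0.
have on1' : words_in (on (val x)) v1.
  have : forall a b, v1 = a ++ b -> words_in (on (val x)) b.
    move=> a b; elim: b a => [//|w b ih] a v1E; split; first exact: on1 v1E.
    by apply: (ih (rcons a w)); rewrite cat_rcons.
  by move=> /(_ [::] v1 erefl).
split; last by exists v1.
by apply: val_inj; rewrite -e1 (mat_fix on1').
Qed.

(** * The development of a star *)

Section Development.
Variable c0 : S.

Definition pick_word (A : set (seq (letter Y))) : seq (letter Y) :=
  if pselect (exists v, A v) is left h then projT1 (cid h) else [::].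

Lemma pick_wordP (A : set (seq (letter Y))) : (exists v, A v) -> A (pick_word A).
Proof. by rewrite /pick_word; case: pselect => // h _; exact: projT2 (cid h). Qed.

(** The point is developed through some word of the star that leads to a copy containing it. By
    regularity the choice does not matter; outside the star the picked word is the empty default and
    the value is meaningless. *)
Definition dev (wl : letter Y -> Prop) (u : seq (letter Y)) p : 'cV[R]_5 :=
  mt u *m (mt (pick_word [set v | words_in wl v /\
    p = cell (flw (u ++ v) c0) (pt p)]) *m val (pt p)).

Lemma devE wl u v x : reg wl -> words_in wl v -> (forall w, on (val x) w -> wl w) ->
  dev wl u (cell (flw (u ++ v) c0) x) = mt (u ++ v) *m val x.
Proof.
move=> rw iv sx; rewrite /dev (pt_cell G); set A := [set _ | _].
have [iv' /(cellP G)[_ [v2 iv2 e]]] : A (pick_word A) by apply: pick_wordP; exists v.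
set v' := pick_word _ in iv' e *.
have ev : equiv v' (v ++ v2).
  apply: (words_switch (c := flw u c0) rw) => //.
    by apply/words_in_cat; split => //; exact: words_inS iv2.
  apply/flw_par => k; rewrite par_cat; move: e; rewrite -flw_cat => /flw_par /(_ k).
  rewrite !par_cat.
  by case: (par k u) (par k v') (par k v) (par k v2) => -[] [] [].
rewrite ev.1 !mat_cat -!mulmxA (mat_fix iv2) //.
Qed.

Lemma star_chart p u : reg (walls (G := G) p) -> inc c0 (st G p) u ->
  chart_at X I p (dev (walls (G := G) p) u).
Proof.
set wl := walls (G := G) p => rw iu.
(* The open star of [p]: the points of the copies around [p] that avoid every wall not passing
   through [p]. *)
pose U := [set q : M | exists v x, [/\ words_in wl v, (forall w, on (val x) w -> wl w) &
  q = cell (flw (u ++ v) c0) x]].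
have UE c x : U (cell c x) -> exists v, [/\ words_in wl v, c = flw (u ++ v) c0 &
    forall w, on (val x) w -> wl w].
  move=> [v [x' [iv sx' /(cellP G)[e [v' iv' cE]]]]]; subst x'.
  exists (v ++ v'); split => //.
    by apply/words_in_cat; split => //; exact: words_inS iv'.
  rewrite -(flwK v' c) -cE -flw_cat; apply/flw_par => k.
  by rewrite !par_cat addbC addbA.
have oU : open U.
  rewrite openE => _ [v [x [iv sx ->]]]; apply/(near_cellP G) => v' iv'.
  have Dx : D (val x) by exact: (set_valP x).
  apply: (@filterS _ _ (nbhs_filter x) _ _ _ (cvg_val (on_near G Dx))) => x' sx'.
  exists (v' ++ v), x'; split; last first.
  - by rewrite -flw_cat; congr cell; apply/flw_par => k; rewrite !par_cat addbCA.
  - by move=> w /sx' /sx.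
  - by apply/words_in_cat; split => //; exact: words_inS iv'.
exists U; split.
- split => //; have [v [iv e]] := iu; exists v, (pt p); split => //.
  by rewrite -[LHS]ptce; congr cell; rewrite flw_cat flwC e flwK.
- move=> q1 q2; rewrite !inE => -[v1 [x1 [i1 s1 ->]]] [v2 [x2 [i2 s2 ->]]].
  rewrite !devE// !mat_cat -!mulmxA => h.
  have {}h : mt v1 *m val x1 = mt v2 *m val x2.
    by rewrite -[LHS]mul1mx -[RHS]mul1mx -(mat_revl (Y := Y) (now H) u) -!mulmxA h.
  have [||e [v' iv' ev]] := @star_inj wl (rev v2 ++ v1) x1 x2 rw.
  + by apply/words_in_cat; split => //; exact: words_in_rev.
  + by rewrite mat_cat -mulmxA h mulmxA mat_revl mul1mx.
  subst x2; apply/(cellP G); split => //; exists v' => //.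
  rewrite -flw_cat; apply/flw_par => k; rewrite !par_cat -ev.2 par_cat par_rev.
  by case: (par k u) (par k v1) (par k v2) => -[] [].
- apply: continuous_in_subspaceT => q; rewrite inE => -[v [x [iv sx ->]]] N nN.
  apply/(near_cellP G) => v' iv'.
  have Dx : D (val x) by exact: (set_valP x).
  have nx := cvg_val (on_near G Dx).
  rewrite devE// in nN.
  have eA : mt (u ++ v' ++ v) *m val x = mt (u ++ v) *m val x.
    rewrite !mat_cat -!mulmxA; congr (_ *m _); rewrite mulmxA -mat_cat.
    have -> : mt (v' ++ v) = mt (v ++ v').
      apply: (words_switch (c := c0) rw _ _ _).1; try apply/words_in_cat; try (split => //).
      * exact: words_inS iv'.
      * exact: words_inS iv'.
      * by apply/flw_par => k; rewrite !par_cat addbC.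
    by rewrite mat_cat -mulmxA (mat_fix iv').
  rewrite -eA in nN.
  have nN' : nbhs (val x) [set y | N (mt (u ++ v' ++ v) *m y)].
    exact: (@mulmx_continuous _ _ (val x) _ nN).
  have h := @filterI _ _ (nbhs_filter x) _ _ nx (cvg_val nN').
  apply: (@filterS _ _ (nbhs_filter x) _ _ _ h) => x' [sx' Nx'].
  rewrite /= -flw_cat.
  have -> : flw (v' ++ u ++ v) c0 = flw (u ++ v' ++ v) c0.
    by apply/flw_par => k; rewrite !par_cat addbCA.
  rewrite devE//; last by move=> w /sx' /sx.
  by apply/words_in_cat; split => //; exact: words_inS iv'.
(* The image is open in [X] only, and [H3] is not open in the ambient vector space; adding the
   complement of [X] before taking the interior yields an ambient open set with the right trace. *)
- move=> V oV VU; exists (dev wl u @` V `|` ~` X)°; first exact: open_interior.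
  rewrite eqEsubset; split; last first.
    by move=> y [/interior_subset[h|nX] Xy].
  move=> _ [q Vq <-]; have [v [x [iv sx qE]]] := VU q Vq; subst q.
  split; last by rewrite devE//; apply: mat_space; exact: (chamber_X H x).
  rewrite devE//; set y := mt (u ++ v) *m val x.
  have rx : reg (on (val x)) by move=> w w' /sx h /sx; exact: rw.
  have := star_cover (c := flw (u ++ v) c0) rx (open_nbhs_nbhs (conj oV Vq)).
  have yE : mt (rev (u ++ v)) *m y = val x by rewrite /y mulmxA mat_revl mul1mx.
  rewrite -yE => sc.
  apply: (@filterS _ _ (nbhs_filter y) _ _ _ (@mulmx_continuous _ _ y _ sc)) => y' /= hy'.
  have [Xy'|nX] := pselect (X y'); last by right.
  left; have [|v' [x' [iv' y'E Vx']]] := hy'; first exact: mat_space.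
  exists (cell (flw v' (flw (u ++ v) c0)) x') => //.
  have [_ [_ _ sx']] := UE _ _ (VU _ Vx').
  have -> : flw v' (flw (u ++ v) c0) = flw (u ++ v ++ v') c0.
    by rewrite -flw_cat; apply/flw_par => k; rewrite !par_cat addbC addbA.
  rewrite devE//; last first.
    by apply/words_in_cat; split => //; move: iv'; rewrite yE; exact: words_inS.
  by rewrite catA mat_cat -mulmxA -y'E mulmxA mat_rev mul1mx.
move=> c; have [[v [iv cE]]|ns] := pselect (exists v, words_in wl v /\ c = flw (u ++ v) c0).
  exists (mt (u ++ v)); first exact: mat_isom.
  by move=> x /UE[_ [_ _ sx]]; rewrite cE devE.
exists 1%:M; first exact: (isom_one H).
by move=> x /UE[v [iv cE _]]; case: ns; exists v.
Qed.

End Development.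

End Charts.

(** * Continuity of paths and of their states *)

Section PathsOfStates.
Context {R : realType} {X S : topologicalType} {D : set X}
  {E : X -> S -> S -> Prop} (G : gluing R D E).
Local Notation M := (glued D E).

Lemma within_eps {T : topologicalType} (A : set R) (f : R -> T) :
  {within A, continuous f} -> forall s, A s -> forall P, nbhs (f s) P ->
  exists2 e, 0 < e & forall s', A s' -> `|s' - s| < e -> P (f s').
Proof.
move=> /subspace_continuousP fc s As P nP.
have /nbhs_ballP[e /= e0 h] : nbhs s [set s' | A s' -> P (f s')] by exact: fc nP.
by exists e => // s' As' se; apply: h => //=; rewrite /ball /= distrC.
Qed.

Lemma within_eps2 {T : topologicalType} (A B : set R) (f : R * R -> T) :
  {within A `*` B, continuous f} -> forall r s, A r -> B s -> forall P,
  nbhs (f (r, s)) P -> exists2 e, 0 < e & forall r' s', A r' -> B s' ->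
    `|r' - r| < e -> `|s' - s| < e -> P (f (r', s')).
Proof.
move=> /subspace_continuousP fc r s Ar Bs P nP.
have /nbhs_ballP[e /= e0 h] : nbhs (r, s) [set k | (A `*` B) k -> P (f k)].
  by apply: fc nP; split.
exists e => // r' s' Ar' Bs' re se; apply: h => //=.
by split; rewrite /ball /= distrC.
Qed.

Lemma eps_within {T : topologicalType} (A : set R) (f : R -> T) :
  (forall s, A s -> forall P, nbhs (f s) P ->
    exists2 e, 0 < e & forall s', A s' -> `|s' - s| < e -> P (f s')) ->
  {within A, continuous f}.
Proof.
move=> h; apply/subspace_continuousP => s As P nP.
have [e e0 he] := h s As P nP; apply/nbhs_ballP; exists e => // s'.
by rewrite /ball /= distrC => se As'; exact: he.
Qed.

Lemma path_starcont (g : R -> M) : {within `[0, 1], continuous g} ->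
  starcont (fun s => st G (g s)) 0 1.
Proof.
move=> gc s s01; have [|e e0 he] := within_eps gc _ (near_star G (g s)).
  by rewrite /= in_itv.
by exists e => // s' s01'; apply: he; rewrite /= in_itv.
Qed.

Lemma family_starcont (g : R -> R -> M) r0 r1 :
  (forall r s, r0 <= r <= r1 -> 0 <= s <= 1 -> forall P, nbhs (g r s) P ->
     exists2 e, 0 < e & forall r' s', r0 <= r' <= r1 -> 0 <= s' <= 1 ->
    `|r' - r| < e -> `|s' - s| < e -> P (g r' s')) ->
  starcont2 (fun r s => st G (g r s)) r0 r1 0 1.
Proof. by move=> gc r s rr ss; exact: (gc r s rr ss _ (near_star G (g r s))). Qed.

End PathsOfStates.

(** * Holonomy along lifts *)

Section HolonomyOfLifts.
Context {R : realType} {S : topologicalType} {X : set 'cV[R]_5} {I : set 'M[R]_5}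
  {D : set 'cV[R]_5} {E : 'cV[R]_5 -> S -> S -> Prop} {G : gluing R D E}
  (H : chamber X I G).
Local Notation M := (glued D E).
Local Notation on := (on (g := G)).
Local Notation Y := (sys G).
Local Notation mt := (mat (Y := Y) (now H)).
Local Notation wlp p := (walls (G := G) p).
Implicit Types (x : D) (p q : M) (w : letter Y).

Variable c0 : S.
Local Notation dev := (dev H c0).

Lemma near_rep p u : inc c0 (st G p) u -> \forall q \near p, exists v x,
  [/\ words_in (wlp p) v, forall w, on (val x) w -> wlp p w & q = cell (flw (u ++ v) c0) x].
Proof.
move=> [v [iv e]]; apply: (@filterS _ _ (nbhs_filter p) _ _ _ (near_star G p)).
move=> q [sq [v' [iv' e']]]; exists (v ++ v'), (pt q); split => //.
  by apply/words_in_cat.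
rewrite -[LHS]ptce; congr cell; move: e'; rewrite /= => ->.
rewrite -(flwK v (ce p)) -e -!flw_cat; apply/flw_par => k; rewrite !par_cat.
by case: (par k u) (par k v') (par k v) => -[] [].
Qed.

Lemma dev_id p u x : reg (wlp p) -> flw u c0 = c0 ->
  (forall w, on (val x) w -> wlp p w) -> dev (wlp p) u (cell c0 x) = mt u *m val x.
Proof.
move=> rp e sx; have := @devE _ _ _ _ _ _ _ H c0 (wlp p) u [::] x rp Logic.I sx.
by rewrite cats0 e.
Qed.

Lemma dev_adj p u p' u' : reg (wlp p) -> adj (st G p) u (st G p') u' ->
  inc c0 (st G p') u' ->
  \forall q \near p', dev (wlp p') u' q = dev (wlp p) u q.
Proof.
move=> rp [s [v [iv e]]] i'.
have rp' : reg (wlp p') by move=> w w' /s h /s; exact: rp.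
apply: (@filterS _ _ (nbhs_filter p') _ _ _ (near_rep i')).
move=> _ [v' [x [iv' sx ->]]]; rewrite devE//.
have h : equiv (u' ++ v') (u ++ (v ++ v')) by rewrite catA; exact: equiv_cat.
rewrite (equiv_flw c0 h) devE//.
- by rewrite h.1.
- by apply/words_in_cat; split => //; exact: words_inS iv'.
- by move=> w /sx /s.
Qed.

(** Allows the isometry between two charts at [p] to be recognized at any point [p'] of the star;
    this carries an identity of charts from one parameter of a path to the next. *)
Lemma dev_rigid p u p' u' (B : 'M[R]_5) : reg (wlp p) -> inc c0 (st G p') u' ->
  adj (st G p) u (st G p') u' -> I B ->
  (\forall q \near p', B *m dev (wlp p) u q = dev (wlp p) u q) -> B = 1%:M.
Proof.
move=> rp i' a IB hB.
have [v [x [iv sx p'E]]] := nbhs_singleton (near_rep i').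
have rp' : reg (wlp p') by case: a => s _ w w' /s h /s; exact: rp.
have h := @filterI _ _ (nbhs_filter p') _ _ hB (dev_adj rp a i').
rewrite {1}p'E in h; have {h} h := cell_continuous h.
have Dx : D (val x) by exact: (set_valP x).
have /near_subtype[N /nbhs_interior nN hN] := @filterI _ _ (nbhs_filter x) _ _
  (cvg_val (on_near G Dx)) h.
have [x1 [nN1 lt1]] := interior_near H nN.
have Xx1 := chamber_X H x1.
have Imt : I (mt (u' ++ v)) by exact: mat_isom.
have : B *m mt (u' ++ v) = mt (u' ++ v).
  apply: (isom_rigid H _ _ Xx1) => //; first exact: (isom_mul H).
  have nlt : \forall y \near val x1, forall w, lorentz (vec H w) y < 0.
    apply: (@filter_faces _ _ _ _ _ _ _ H _ _ (nbhs_filter (val x1))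
      (fun w y => lorentz (vec H w) y < 0)) => w.
    exact: (near_lt0 (lt1 w)).
  apply: (@filterS _ _ (nbhs_filter (val x1)) _ _ _
    (@filterI _ _ (nbhs_filter (val x1)) _ _ nN1 nlt)).
  move=> y [Ny lty] Xy.
  have Dy : D y by apply/(chamberE H); split => // w; exact/ltW.
  have [sy [e1 e2]] := hN (inset Dy) Ny.
  by move: e1; rewrite -e2 devE//= ?mulmxA// => w /sy /sx.
move=> /(congr1 (mulmx^~ (mt (rev (u' ++ v))))) /=.
by rewrite -mulmxA mat_rev mulmx1.
Qed.

(** By [chart_cross], the germ of a chart on one copy determines its germs on all the copies around
    the point, by the same products of reflections as in the development. *)
Lemma chart_rigid p psi u : chart_at X I p psi -> reg (wlp p) -> inc c0 (st G p) u ->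
  exists B, I B /\ \forall q \near p, psi q = B *m dev (wlp p) u q.
Proof.
move=> cp rp [v1 [iv1 e]]; pose x := pt p; pose c1 := flw u c0.
have pE : p = cell c1 x by rewrite /c1 e (cell_flw (G := G))// ptce.
have [A gA] := chart_germ cp pE.
have gv v : words_in (on (val x)) v -> germ (I := I) psi (flw v c1) x (A *m mt v).
  elim: v => [|w v ih] /=; first by rewrite mulmx1.
  move=> [ow iv]; have {ih} gA' := ih iv.
  have pE' : p = cell (flw v c1) x by rewrite (cell_flw (G := G)).
  have pE2 : p = cell (fl w (flw v c1)) x.
    by rewrite pE' -(cell_flw (G := G) (v := [:: w]) (flw v c1)).
  have [B gB] := chart_germ cp pE2.
  suff -> : A *m (rfl (now H) w *m mt v) = B by [].
  rewrite (chart_cross H cp pE' ow gA' gB) -mulmxA; congr (_ *m _).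
  rewrite -(rflE H); have /(words_switch (c := c0) rp) : words_in (wlp p) (w :: v) by [].
  move=> /(_ (v ++ [:: w])) [||h _].
  - by apply/words_in_cat.
  - by rewrite -cat1s; apply/flw_par => k; rewrite !par_cat addbC.
  by have := h (now H); rewrite mat_cat /= mulmx1.
exists (A *m mt (rev u)); split.
  by apply: (isom_mul H); [exact: gA.1|exact: mat_isom].
suff : \forall q \near (cell c1 x : M), psi q = A *m mt (rev u) *m dev (wlp p) u q.
  by rewrite -pE.
apply/(near_cellP G) => v iv; have [_ hv] := gv v iv.
have Dx : D (val x) by exact: (set_valP x).
apply: (@filterS _ _ (nbhs_filter x) _ _ _ (@filterI _ _ (nbhs_filter x) _ _
  (cvg_val (on_near G Dx)) hv)) => x' [sx' ->].
have -> : flw v c1 = flw (u ++ v) c0 by rewrite flw_cat flwC.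
rewrite devE// mat_cat -!mulmxA; congr (_ *m _).
by rewrite mulmxA mat_revl mul1mx.
Qed.

Variable x0 : D.
Hypothesis x0E : val x0 = @origin R.

Lemma walls_base w : ~ wlp (cell c0 x0) w.
Proof.
rewrite walls_cell => /(onE H); rewrite x0E => h.
by have := vec_origin H w; rewrite h ltxx.
Qed.

Lemma ce_base : ce (@cell _ _ D E c0 x0) = c0.
Proof.
have [[|w v] iv ->//] := ce_cell G c0 x0.
by have := @walls_base w; rewrite walls_cell; case: iv.
Qed.

Lemma inc_base u : inc c0 (st G (cell c0 x0)) u -> flw u c0 = c0.
Proof.
by case=> -[|w v] [/= iv ->]; [exact: ce_base|case: iv => /walls_base].
Qed.

Lemma lift_end (g : R -> M) u : g 1 = cell c0 x0 ->
  is_lift c0 (fun s => st G (g s)) 0 1 u -> flw (u 1) c0 = c0.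
Proof.
by move=> g1 [lu _]; apply: inc_base; rewrite -g1; apply: lu; rewrite ler01 lexx.
Qed.

Lemma lift_develops (g : R -> M) u : {within `[0, 1], continuous g} ->
  g 0 = cell c0 x0 -> g 1 = cell c0 x0 ->
  (forall s, 0 <= s <= 1 -> reg (wlp (g s))) ->
  is_lift c0 (fun s => st G (g s)) 0 1 u -> u 0 = [::] ->
  develops X I c0 g (mt (u 1)).
Proof.
move=> gc g0 g1 rg lu u0; exists (fun s => dev (wlp (g s)) (u s)).
have z01 : 0 <= (0 : R) <= 1 by rewrite lexx ler01.
have o01 : 0 <= (1 : R) <= 1 by rewrite lexx ler01.
have sub p : \forall q \near p, forall w, wlp q w -> wlp p w.
  by apply: (@filterS _ _ (nbhs_filter p) _ _ _ (near_star G p)) => q [].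
split.
- by move=> s; rewrite in_itv /= => s01; apply: star_chart; [exact: rg|exact: lu.1].
- move=> s; rewrite in_itv /= => s01; have [e e0 he] := lu.2 s s01.
  apply/nbhs_ballP; exists e => //= s'; rewrite /ball /= distrC => se.
  rewrite in_itv /= => s01'; apply: dev_adj; [exact: rg|exact: he|exact: lu.1].
- apply: (@filterS _ _ (nbhs_filter (g 0)) _ _ _ (sub (g 0))) => p sp x pE.
  rewrite u0 pE dev_id//= ?mul1mx//; first exact: rg.
  by move: sp; rewrite pE walls_cell.
apply: (@filterS _ _ (nbhs_filter (g 1)) _ _ _ (sub (g 1))) => p sp x pE.
rewrite pE dev_id//; [exact: rg|exact: lift_end lu|].
by move: sp; rewrite pE walls_cell.
Qed.

Lemma develops_unique (g : R -> M) u A : {within `[0, 1], continuous g} ->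
  g 0 = cell c0 x0 -> g 1 = cell c0 x0 ->
  (forall s, 0 <= s <= 1 -> reg (wlp (g s))) ->
  is_lift c0 (fun s => st G (g s)) 0 1 u -> u 0 = [::] -> I A ->
  develops X I c0 g A -> A = mt (u 1).
Proof.
move=> gc g0 g1 rg lu u0 IA [phi [ch near_phi init fin]].
have z01 : 0 <= (0 : R) <= 1 by rewrite lexx ler01.
have o01 : 0 <= (1 : R) <= 1 by rewrite lexx ler01.
(* Agreement of the given continuation with the development along the lift. Around each parameter
   the two differ by a fixed isometry [B], so agreement at one nearby parameter gives [B = 1] and
   thereby agreement at all of them. *)
pose cl s := \forall q \near g s, phi s q = dev (wlp (g s)) (u s) q.
have sx0 (x : D) : (forall w, on (val x) w -> on (val x0) w) -> forall w, on (val x) w -> False.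
  by move=> h w /h; have := @walls_base w; rewrite walls_cell.
have Dx0 : D (val x0) by exact: (set_valP x0).
have nx0 := cvg_val (on_near G Dx0).
have cl0 : cl 0.
  rewrite /cl g0; apply/(near_cellP G) => -[_|w v [/= ow _]]; last first.
    by have := @walls_base w; rewrite walls_cell.
  rewrite g0 in init; have h := cell_continuous init.
  apply: (@filterS _ _ (nbhs_filter x0) _ _ _ (@filterI _ _ (nbhs_filter x0) _ _ nx0 h)).
  move=> x [sx /(_ x erefl) ->]; rewrite u0.
  have rg0 := rg 0 z01; rewrite g0 in rg0.
  by rewrite dev_id//= ?mul1mx// => w /(sx0 x sx).
have cl1 : cl 1.
  have : (cl 0 -> cl 1); last by apply.
  apply: (interval_chain (Q := fun a b => cl a -> cl b)) => //.
    by move=> a b c _ _ _ _ h1 h2 /h1.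
  move=> s s01; have s01i : s \in `[0, 1]%R by rewrite in_itv.
  have [B [IB hB]] := chart_rigid (ch s s01i) (rg s s01) (lu.1 s s01).
  have /nbhs_ballP[e1 /= e10 he1] := near_phi s s01i.
  have [e2 e20 he2] := lu.2 s s01.
  have [|e3 e30 he3] := within_eps gc _ (nbhs_interior hB); first by rewrite /= in_itv.
  have key s' : 0 <= s' <= 1 -> `|s' - s| < Num.min e1 (Num.min e2 e3) -> cl s' <-> B = 1%:M.
    move=> s01'; rewrite !lt_min => /andP[se1 /andP[se2 se3]].
    have a := he2 s' s01' se2.
    have n1 : \forall q \near g s', phi s' q = phi s q.
      have bs : ball s e1 s' by rewrite /ball /= distrC.
      by apply: (he1 s' bs); rewrite in_itv.
    have n2 := dev_adj (rg s s01) a (lu.1 s' s01').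
    have n3 : \forall q \near g s', phi s q = B *m dev (wlp (g s)) (u s) q.
      by apply: he3 => //=; rewrite in_itv.
    have n := @filterI _ _ (nbhs_filter (g s')) _ _ n1
      (@filterI _ _ (nbhs_filter (g s')) _ _ n2 n3).
    split=> [cls|B1].
      apply: (dev_rigid (rg s s01) (lu.1 s' s01') a IB).
      apply: (@filterS _ _ (nbhs_filter (g s')) _ _ _
        (@filterI _ _ (nbhs_filter (g s')) _ _ n cls)) => q [[h1 [h2 h3]] h4].
      by rewrite -h3 -h1 h4.
    apply: (@filterS _ _ (nbhs_filter (g s')) _ _ _ n) => q [h1 [h2 h3]].
    by rewrite h1 h3 B1 mul1mx.
  exists (Num.min e1 (Num.min e2 e3)); first by rewrite !lt_min e10 e20.
  move=> a b a0 as_ sb b1 ae be.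
  have ab := le_trans as_ sb.
  have a01 : 0 <= a <= 1 by rewrite a0 (le_trans ab).
  have b01 : 0 <= b <= 1 by rewrite b1 (le_trans a0).
  have ea : `|a - s| < Num.min e1 (Num.min e2 e3).
    by apply: (norm_near ae be); rewrite lexx.
  have eb : `|b - s| < Num.min e1 (Num.min e2 e3).
    by apply: (norm_near ae be); rewrite lexx ab.
  by move=> /(key a a01 ea) B1; apply/(key b b01 eb).
have h := @filterI _ _ (nbhs_filter (g 1)) _ _ cl1 fin.
rewrite {1}g1 in h; have {h} h := cell_continuous h.
have /near_subtype[N /nbhs_interior nN hN] := @filterI _ _ (nbhs_filter x0) _ _ nx0 h.
have Xx0 := chamber_X H x0.
apply: (isom_rigid H (z := val x0)) => //; first exact: mat_isom.
have nlt : \forall y \near val x0, forall w, lorentz (vec H w) y < 0.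
  apply: (@filter_faces _ _ _ _ _ _ _ H _ _ (nbhs_filter (val x0))
    (fun w y => lorentz (vec H w) y < 0)) => w.
  by apply: near_lt0; rewrite x0E; exact: vec_origin.
apply: (@filterS _ _ (nbhs_filter (val x0)) _ _ _
  (@filterI _ _ (nbhs_filter (val x0)) _ _ nN nlt)) => y [nNy lty] Xy.
have Dy : D y by apply/(chamberE H); split => // w; exact/ltW.
have [sy [e1 /(_ (inset Dy) erefl) e2]] := hN (inset Dy) (nbhs_singleton nNy).
rewrite -[LHS]e2 e1 dev_id//; [exact: rg|exact: lift_end lu|].
by move=> w /(sx0 _ sy).
Qed.

(** Existence and uniqueness of the continuation pin down the matrix selected by [xget], so its
    default value is not met. *)
Lemma holonomy_lift (g : R -> M) u : {within `[0, 1], continuous g} ->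
  g 0 = cell c0 x0 -> g 1 = cell c0 x0 ->
  (forall s, 0 <= s <= 1 -> reg (wlp (g s))) ->
  is_lift c0 (fun s => st G (g s)) 0 1 u -> u 0 = [::] ->
  holonomy X I c0 g = mt (u 1).
Proof.
move=> gc g0 g1 rg lu u0; apply: xget_unique.
  by split; [exact: mat_isom|exact: lift_develops].
by move=> A [IA dA]; exact: develops_unique dA.
Qed.

Lemma loop_lift (g : R -> M) : {within `[0, 1], continuous g} ->
  g 0 = cell c0 x0 -> (forall s, 0 <= s <= 1 -> reg (wlp (g s))) ->
  exists u, is_lift c0 (fun s => st G (g s)) 0 1 u /\ u 0 = [::].
Proof.
move=> gc g0 rg; apply: lift_exists => //; first exact: path_starcont.
by exists [::]; split => //=; rewrite g0 ce_base.
Qed.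

Lemma holonomy_homotopic (g h : R -> M) (K : R * R -> M) :
  g 0 = cell c0 x0 -> g 1 = cell c0 x0 ->
  {within `[0 : R, 1] `*` `[0 : R, 1], continuous K} ->
  (forall s, s \in `[0, 1] -> K (s, 0) = g s /\ K (s, 1) = h s) ->
  (forall r, r \in `[0, 1] -> K (0, r) = g 0 /\ K (1, r) = g 1) ->
  (forall s r, 0 <= s <= 1 -> 0 <= r <= 1 -> reg (wlp (K (s, r)))) ->
  {within `[0, 1], continuous g} -> {within `[0, 1], continuous h} ->
  holonomy X I c0 g = holonomy X I c0 h.
Proof.
move=> g0 g1 Kc Kgh Kr rK gc hc.
have z01 : 0 <= (0 : R) <= 1 by rewrite lexx ler01.
have o01 : 0 <= (1 : R) <= 1 by rewrite lexx ler01.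
have gE s : 0 <= s <= 1 -> K (s, 0) = g s by move=> s01; have [] := Kgh s; rewrite ?in_itv.
have hE s : 0 <= s <= 1 -> K (s, 1) = h s by move=> s01; have [] := Kgh s; rewrite ?in_itv.
have h0 : h 0 = cell c0 x0.
  by rewrite -hE// -g0; have [] := Kr 1; rewrite ?in_itv.
have h1 : h 1 = cell c0 x0.
  by rewrite -hE// -g1; have [] := Kr 1; rewrite ?in_itv.
have rg s : 0 <= s <= 1 -> reg (wlp (g s)) by move=> s01; rewrite -gE//; exact: rK.
have rh s : 0 <= s <= 1 -> reg (wlp (h s)) by move=> s01; rewrite -hE//; exact: rK.
have [u [lu u0]] := loop_lift gc g0 rg; have [v [lv v0]] := loop_lift hc h0 rh.
rewrite (holonomy_lift gc g0 g1 rg lu u0) (holonomy_lift hc h0 h1 rh lv v0).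
suff [eqm _] : equiv (u 1) (v 1) by exact: eqm.
pose q r s := st G (K (s, r)).
apply: (@lift_const _ _ _ c0 q 0 1) => //; rewrite ?u0 ?v0//.
- apply: family_starcont => r s rr ss P nP.
  have [||e e0 he] := within_eps2 Kc _ _ nP; rewrite /= ?in_itv//.
  by exists e => // r' s' rr' ss' re se; apply: he; rewrite /= ?in_itv.
- by move=> r s rr ss; exact: rK.
- move=> r r01; have [K0 K1] : K (0, r) = g 0 /\ K (1, r) = g 1 by apply: Kr; rewrite in_itv.
  rewrite /q /= K0 K1 g0 g1; split; [exact: walls_base|exact: walls_base|exact: ce_base].
- apply: lift_eqst lu => s s01; rewrite /q gE//.
  by split; split=> //; exists [::].
- apply: lift_eqst lv => s s01; rewrite /q hE//.
  by split; split=> //; exists [::].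
Qed.

Lemma loop_mul_continuous (g h : R -> M) : g 1 = h 0 ->
  {within `[0, 1], continuous g} -> {within `[0, 1], continuous h} ->
  {within `[0, 1], continuous (loop_mul g h)}.
Proof.
move=> gh gc hc; apply: eps_within => s; rewrite /= in_itv /= => /andP[s0 s1] P nP.
have left_half : s <= 2^-1 -> exists2 e, 0 < e & forall s', 0 <= s' -> s' <= 2^-1 ->
    `|s' - s| < e -> P (g (2 * s')).
  move=> s2; rewrite /loop_mul s2 in nP.
  have [|e e0 he] := within_eps gc _ nP; first by rewrite /= in_itv /=; lra.
  exists (e / 2) => [|s' s0' s2' se]; first by rewrite divr_gt0.
  by apply: he; [rewrite /= in_itv /=|move: se; rewrite !ltr_norml]; lra.
have right_half : 2^-1 <= s -> exists2 e, 0 < e & forall s', 2^-1 <= s' -> s' <= 1 ->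
    `|s' - s| < e -> P (h (2 * s' - 1)).
  move=> s2; have {}nP : nbhs (h (2 * s - 1)) P.
    move: nP; rewrite /loop_mul; case: leP => // s2'.
    have -> : 2 * s = 1 by lra.
    by rewrite subrr gh.
  have [|e e0 he] := within_eps hc _ nP; first by rewrite /= in_itv /=; lra.
  exists (e / 2) => [|s' s0' s2' se]; first by rewrite divr_gt0.
  by apply: he; [rewrite /= in_itv /=|move: se; rewrite !ltr_norml]; lra.
case: (ltgtP s 2^-1) => [s2|s2|s2].
- have [e e0 he] := left_half (ltW s2); exists (Num.min e (2^-1 - s)).
    by rewrite lt_min e0 subr_gt0.
  move=> s'; rewrite in_itv /= lt_min => /andP[s0' s1'] /andP[se ss].
  have s2' : s' <= 2^-1 by move: ss; rewrite ltr_norml; lra.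
  by rewrite /loop_mul s2'; exact: he.
- have [e e0 he] := right_half (ltW s2); exists (Num.min e (s - 2^-1)).
    by rewrite lt_min e0 subr_gt0.
  move=> s'; rewrite in_itv /= lt_min => /andP[s0' s1'] /andP[se ss].
  have s2' : 2^-1 < s' by move: ss; rewrite ltr_norml; lra.
  by rewrite /loop_mul leNgt s2' /=; apply: he => //; exact: ltW.
have [|e e0 he] := left_half; first by rewrite s2.
have [|e' e0' he'] := right_half; first by rewrite s2.
exists (Num.min e e'); first by rewrite lt_min e0.
move=> s'; rewrite in_itv /= lt_min => /andP[s0' s1'] /andP[se ss].
by rewrite /loop_mul; case: leP => [|/ltW] s2'; [exact: he|exact: he'].
Qed.

Lemma lift_scale (q : R -> state Y) u d : is_lift c0 q 0 1 u ->
  is_lift c0 (fun s => q (2 * s - d)) (d / 2) ((1 + d) / 2) (fun s => u (2 * s - d)).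
Proof.
move=> [iu lu]; split=> s sd; first by apply: iu; lra.
have [|e e0 he] := lu (2 * s - d); first by lra.
exists (e / 2) => [|s' sd' se]; first by rewrite divr_gt0.
by apply: he; [|move: se; rewrite !ltr_norml]; lra.
Qed.

(** The lift of the second loop is prefixed by [u 1]. As this word fixes the base cell, the cells
    met by [h] are unchanged. *)
Lemma lift_mul (g h : R -> M) u v : g 0 = cell c0 x0 -> g 1 = cell c0 x0 -> h 0 = cell c0 x0 ->
  is_lift c0 (fun s => st G (g s)) 0 1 u -> is_lift c0 (fun s => st G (h s)) 0 1 v ->
  v 0 = [::] ->
  is_lift c0 (fun s => st G (loop_mul g h s)) 0 1
    (fun s => if s <= 2^-1 then u (2 * s) else u 1 ++ v (2 * s - 1)).
Proof.
move=> g0 g1 h0 lu lv v0.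
have nn (p p' : M) : p = p' -> nearst (st G p) (st G p') /\ nearst (st G p') (st G p).
  by move=> ->; split; split=> //; exists [::].
have l1 := lift_scale 0 lu; have l2 := lift_scale 1 lv.
apply: (lift_cat (a := 0) (b := 2^-1) (c := 1)
  (u := fun s => u (2 * s)) (u' := fun s => u 1 ++ v (2 * s - 1))).
- by rewrite invr_ge0.
- by rewrite invf_le1// ler1n.
- have -> : (fun s : R => u (2 * s)) = (fun s => u (2 * s - 0)).
    by apply: funext => s; rewrite subr0.
  rewrite mul0r addr0 div1r in l1; apply: lift_eqst l1 => s /andP[_ s2].
  by apply: nn; rewrite /loop_mul s2 subr0.
- rewrite div1r (_ : (1 + 1) / 2 = 1) in l2; last by rewrite divff.
  have {}l2 : is_lift c0 (fun s => st G (loop_mul g h s)) 2^-1 1 (fun s => v (2 * s - 1)).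
    apply: lift_eqst l2 => s /andP[s2 s1]; apply: nn; rewrite /loop_mul.
    case: leP => // s2'; have -> : 2 * s = 1 by lra.
    by rewrite subrr h0 g1.
  apply: lift_prefix (l2) => s s2; have [v1 [iv1 e]] := l2.1 s s2.
  by exists v1; split => //; rewrite flw_cat flwC (lift_end g1 lu).
have -> : (2 : R) * 2^-1 = 1 by rewrite divff.
by rewrite subrr v0 cats0.
Qed.

Lemma holonomy_mul (g h : R -> M) :
  g 0 = cell c0 x0 -> g 1 = cell c0 x0 -> h 0 = cell c0 x0 -> h 1 = cell c0 x0 ->
  (forall s, 0 <= s <= 1 -> reg (wlp (g s))) ->
  (forall s, 0 <= s <= 1 -> reg (wlp (h s))) ->
  {within `[0, 1], continuous g} -> {within `[0, 1], continuous h} ->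
  holonomy X I c0 (loop_mul g h) = holonomy X I c0 g *m holonomy X I c0 h.
Proof.
move=> g0 g1 h0 h1 rg rh gc hc.
have [u [lu u0]] := loop_lift gc g0 rg; have [v [lv v0]] := loop_lift hc h0 rh.
have half : (2 : R) * 2^-1 = 1 by rewrite divff// pnatr_eq0.
have half1 : ((1 : R) <= 2^-1) = false.
  by apply/negbTE; rewrite -ltNge invf_lt1// ltr1n.
rewrite (holonomy_lift gc g0 g1 rg lu u0) (holonomy_lift hc h0 h1 rh lv v0).
rewrite (holonomy_lift _ _ _ _ (lift_mul g0 g1 h0 lu lv v0)).
- by rewrite half1 mulr1 (_ : 2 - 1 = 1 :> R) ?mat_cat//; ring.
- by apply: loop_mul_continuous; rewrite ?g1.
- by rewrite /loop_mul mulr0 invr_ge0 ler0n.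
- by rewrite /loop_mul half1 mulr1 (_ : 2 - 1 = 1 :> R)//; ring.
- move=> s /andP[s0 s1]; rewrite /loop_mul; case: leP => s2; [apply: rg|apply: rh]; lra.
- by rewrite mulr0 invr_ge0 ler0n.
Qed.

End HolonomyOfLifts.

(** * Products of the normal vectors *)

Section WallProducts.
Context {R : realType}.
Implicit Types (t : R) (i j : 'I_8) (w : wall).

Lemma lorentz_vec5 (a b c d e a' b' c' d' e' : R) :
  lorentz (vec5 a b c d e) (vec5 a' b' c' d' e') =
  - (a * a') + b * b' + c * c' + d * d' + e * e'.
Proof. by rewrite /lorentz !big_ord_recl big_ord0 !mxE /=; ring. Qed.

Lemma vec5_0 (a b c d e : R) : vec5 a b c d e ord0 0 = a.
Proof. by rewrite mxE. Qed.

Lemma vec5_max (a b c d e : R) : vec5 a b c d e ord_max 0 = e.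
Proof. by rewrite mxE. Qed.

Definition eps_dot i j : R :=
  let: (a, b, c) := eps i in let: (a', b', c') := eps j in
  a * a' + b * b' + c * c'.

Definition eps_sgn i : R := (-1) ^+ i.

Lemma eps_sgn2 i : eps_sgn i * eps_sgn i = 1.
Proof. by rewrite -expr2 sqrr_sign. Qed.

Lemma eps_dot_self i : eps_dot i i = 3.
Proof.
case: i => -[|[|[|[|[|[|[|[|//]]]]]]]] lti; rewrite /eps_dot /eps /=; ring.
Qed.

(** The vectors [eps i] are the vertices of a cube, and the sign of [i] is a proper two-colouring of
    its graph; the product is 1, -1 or -3 according to whether the distance is one, two or three. *)
Lemma eps_dotP i j : i != j ->
  (eps_sgn i * eps_sgn j = 1 /\ eps_dot i j = -1) \/
  (eps_sgn i * eps_sgn j = -1 /\ (eps_dot i j = 1 \/ eps_dot i j = -3)).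
Proof.
rewrite -val_eqE /eps_sgn /eps_dot /eps.
case: i => -[|[|[|[|[|[|[|[|//]]]]]]]] lti; case: j => -[|[|[|[|[|[|[|[|//]]]]]]]] ltj //= _;
  rewrite ?expr0 ?expr1 ?exprS ?expr0;
  (left; split; lra) || (right; split; [lra|by left; lra]) || (right; split; [lra|by right; lra]).
Qed.

Definition axis_sgn (k : 'I_3) i : R :=
  let: (a, b, c) := eps i in nth 0 [:: a; b; c] k.

Lemma axis_sgnP k i : axis_sgn k i = 1 \/ axis_sgn k i = -1.
Proof.
rewrite /axis_sgn /eps.
case: i => -[|[|[|[|[|[|[|[|//]]]]]]]] lti; case: k => -[|[|[|//]]] ltk /=;
  (by left) || (by right).
Qed.

Lemma sqrt2_gt0 : 0 < Num.sqrt (2 : R). Proof. by rewrite sqrtr_gt0. Qed.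

Lemma sqrt2_sq : Num.sqrt (2 : R) * Num.sqrt 2 = 2.
Proof. by rewrite -expr2 sqr_sqrtr. Qed.

(** The scale of the first four coordinates is separate from the last one, so that the rescaled
    positive vectors still make sense when that scale is 0. *)
Definition eps_vec2 i (a b : R) : 'cV[R]_5 :=
  let: (e1, e2, e3) := eps i in vec5 (a * Num.sqrt 2) (a * e1) (a * e2) (a * e3) b.

Lemma eps_vec2_1 i b : eps_vec2 i 1 b = eps_vec i b.
Proof. by rewrite /eps_vec2 /eps_vec; case: (eps i) => [[? ?] ?]; rewrite !mul1r. Qed.

Lemma eps_vec2Z i a b k : k *: eps_vec2 i a b = eps_vec2 i (k * a) (k * b).
Proof.
rewrite /eps_vec2; case: (eps i) => [[? ?] ?]; apply/matrixP => r s; rewrite !mxE.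
by case: r => -[|[|[|[|[|//]]]]] ltr /=; ring.
Qed.

Lemma lorentz_eps_vec2 i j a b a' b' :
  lorentz (eps_vec2 i a b) (eps_vec2 j a' b') = a * a' * (eps_dot i j - 2) + b * b'.
Proof.
rewrite /eps_vec2 /eps_dot; case: (eps i) (eps j) => [[e1 e2] e3] [[f1 f2] f3].
rewrite lorentz_vec5.
have -> : a * Num.sqrt 2 * (a' * Num.sqrt 2) = a * a' * 2.
  by rewrite -[X in _ = _ * X]sqrt2_sq; ring.
by ring.
Qed.

Lemma lorentz_eps_letter i a b k s :
  lorentz (eps_vec2 i a b) (letter_vec k s) =
  a * Num.sqrt 2 * ((-1) ^+ s * axis_sgn k i - 1).
Proof.
rewrite /eps_vec2 /letter_vec /axis_sgn; case: (eps i) => [[e1 e2] e3].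
rewrite lorentz_vec5; case: k => -[|[|[|//]]] ltk /=; rewrite ?mulr0n ?mulr1n. all: ring.
Qed.

Lemma sign2 (s : bool) : ((-1) ^+ s : R) = 1 \/ ((-1) ^+ s : R) = -1.
Proof. by case: s; [right|left]; rewrite ?expr1 ?expr0. Qed.

Lemma lorentz_letter_self (k : 'I_3) s : lorentz (letter_vec k s) (letter_vec k s) = 1 :> R.
Proof.
have h := sqrt2_sq; rewrite /letter_vec lorentz_vec5.
by case: k => -[|[|[|//]]] ltk /=; rewrite ?mulr0n ?mulr1n;
  case: (sign2 s) => ->; lra.
Qed.

Lemma lorentz_letter (k k' : 'I_3) s s' : (k, s) <> (k', s') ->
  lorentz (letter_vec k s) (letter_vec k' s') <= -1 :> R.
Proof.
have h := sqrt2_sq; rewrite /letter_vec lorentz_vec5.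
have E1 (l l' : 'I_3) (r r' : bool) : val l = val l' -> r = r' -> (l, r) = (l', r').
  by move=> /val_inj -> ->.
have := E1 k k' s s'.
case: k => -[|[|[|//]]] ltk /=; case: k' => -[|[|[|//]]] ltk' /= e ne;
  rewrite ?mulr0n ?mulr1n;
  move: e ne; case: s; case: s' => /= e ne; rewrite ?expr1 ?expr0;
  try (by case: ne; apply: e); lra.
Qed.

Lemma letter_vec0 (k : 'I_3) s : letter_vec k s ord0 0 = 1 :> R.
Proof. by rewrite /letter_vec vec5_0. Qed.

Lemma eps_vec20 i a b : eps_vec2 i a b ord0 0 = a * Num.sqrt 2.
Proof. by rewrite /eps_vec2; case: (eps i) => [[? ?] ?]; rewrite vec5_0. Qed.

(* The projection of the origin to the hyperplane of the facet. *)
Definition centre (v : 'cV[R]_5) : 'cV[R]_5 :=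
  origin + (v ord0 0 / lorentz v v) *: v.

Lemma lorentz_centre (v w : 'cV[R]_5) :
  lorentz w (centre v) = - w ord0 0 + v ord0 0 / lorentz v v * lorentz w v.
Proof. by rewrite !lorentzE lorentz_originr. Qed.

Lemma centre_cone (v : 'cV[R]_5) : 0 < lorentz v v -> cone (centre v).
Proof.
move=> v0; apply: (cone_future cone_origin).
  rewrite /centre !lorentzE (lorentzC origin v) !lorentz_originr vec5_0.
  rewrite [ltLHS](_ : _ = - (1 + (v ord0 0) ^+ 2 / lorentz v v)); last first.
    by field; rewrite gt_eqF.
  by rewrite oppr_lt0 ltr_pwDl// divr_ge0 ?sqr_ge0// ltW.
rewrite lorentz_centre vec5_0 (lorentzC origin v) lorentz_originr mulrN.
have : 0 <= v ord0 0 / lorentz v v * v ord0 0.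
  by rewrite mulrAC -expr2 divr_ge0 ?sqr_ge0// ltW.
lra.
Qed.

Lemma centre_orth (v : 'cV[R]_5) : 0 < lorentz v v -> lorentz v (centre v) = 0.
Proof. by move=> v0; rewrite lorentz_centre divfK ?gt_eqF// addNr. Qed.

Lemma centre_lt0 (v w : 'cV[R]_5) : 0 < lorentz v v ->
  v ord0 0 * lorentz w v < w ord0 0 * lorentz v v -> lorentz w (centre v) < 0.
Proof.
by move=> v0 h; rewrite lorentz_centre addrC subr_lt0 mulrAC ltr_pdivrMr.
Qed.

Lemma centre_lt0_npos (v w : 'cV[R]_5) : 0 < lorentz v v -> 0 < v ord0 0 ->
  0 < w ord0 0 -> lorentz w v <= 0 -> lorentz w (centre v) < 0.
Proof.
move=> v0 v0' w0 h; apply: centre_lt0 => //; apply: (@le_lt_trans _ _ 0).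
  by rewrite mulr_ge0_le0// ltW.
exact: mulr_gt0.
Qed.

End WallProducts.

(** * The walls of [P_t] and the faces of [P_0] *)

Section Walls.
Context {R : realType}.
Implicit Types (t : R) (w : wall).

(* [wall_vec], with the positive vectors rescaled by [t] so as to extend to
   [t = 0]. *)
Definition svec t w : 'cV[R]_5 :=
  match w with
  | Pos i => eps_vec2 i t (eps_sgn i)
  | Neg i => eps_vec2 i 1 (- (eps_sgn i * t))
  | Letter k s => letter_vec k s
  end.

Lemma svecE t w : 0 < t -> exists2 a, 0 < a & svec t w = a *: wall_vec t w.
Proof.
move=> t0; case: w => [i|i|k s] /=.
- exists t => //; rewrite -eps_vec2_1 eps_vec2Z mulr1.
  by rewrite mulrC divfK// gt_eqF.
- by exists 1 => //; rewrite scale1r eps_vec2_1.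
- by exists 1 => //; rewrite scale1r.
Qed.

Lemma svec_gt0 t w : 0 < lorentz (svec t w) (svec t w).
Proof.
case: w => [i|i|k s] /=; last by rewrite lorentz_letter_self.
- by rewrite lorentz_eps_vec2 eps_dot_self eps_sgn2; nra.
- have h := eps_sgn2 i (R := R); rewrite lorentz_eps_vec2 eps_dot_self.
  have -> : - (eps_sgn i * t) * - (eps_sgn i * t) = eps_sgn i * eps_sgn i * t ^+ 2 :> R.
    by ring.
  by rewrite h; nra.
Qed.

Lemma svec_time t w : 0 < t -> 0 < svec t w ord0 0.
Proof.
move=> t0; have h := @sqrt2_gt0 R.
by case: w => [i|i|k s] /=; rewrite ?letter_vec0 ?eps_vec20 ?mul1r// mulr_gt0.
Qed.

Lemma axis_le0 (k : 'I_3) (i : 'I_8) (s : bool) : (-1) ^+ s * axis_sgn k i - 1 <= 0 :> R.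
Proof. by case: (sign2 (R := R) s) (axis_sgnP (R := R) k i) => -> [] ->; lra. Qed.

Lemma colour_neq_letter t i k s :
  lorentz (svec t (Pos i)) (svec t (Letter k s)) =
    t * (Num.sqrt 2 * ((-1) ^+ s * axis_sgn k i - 1)).
Proof. by rewrite /= lorentz_eps_letter mulrA. Qed.

Lemma svec_pn t i j : lorentz (svec t (Pos i)) (svec t (Neg j)) =
  t * (eps_dot i j - 2 - eps_sgn i * eps_sgn j).
Proof. by rewrite /= lorentz_eps_vec2; ring. Qed.

(** Between walls of different colours the product is a constant, possibly times [t]: it vanishes at
    one positive time exactly when the constant does. *)
Lemma svec_orth t w w' : 0 < t -> wall_colour w <> wall_colour w' ->
  lorentz (svec t w) (svec t w') = 0 -> forall t', lorentz (svec t' w) (svec t' w') = 0.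
Proof.
move=> t0; have tn : (t == 0) = false by rewrite gt_eqF.
wlog : w w' / match w, w' with Pos _, _ => True | Neg _, Letter _ _ => True | _, _ => False end.
  move=> h; case: w w' => [i|i|k s] [j|j|l r] // cw e t'; try (by apply: (h _ _ _ cw e));
    rewrite lorentzC; apply: (h _ _ _ (nesym cw)) => //; by rewrite lorentzC.
case: w w' => [i|i|k s] [j|j|l r] // _ cw; try (by case: cw).
- by rewrite svec_pn => /eqP; rewrite mulf_eq0 tn /= => /eqP h t'; rewrite svec_pn h mulr0.
- rewrite colour_neq_letter => /eqP; rewrite mulf_eq0 tn /= => /eqP h t'.
  by rewrite colour_neq_letter h mulr0.
- by rewrite /= !lorentz_eps_letter => h t'; rewrite lorentz_eps_letter.
Qed.

(** Nonpositive products suffice for all pairs except two positive walls, whose product may be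
    positive. Those have the same height, and the comparison reduces to the product being smaller
    than the norm. For two negative walls, [t * t < 2^-1] bounds the contribution of the last
    coordinate. *)
Lemma svec_centre t w w' : 0 < t < t2 -> w' <> w -> lorentz (svec t w') (centre (svec t w)) < 0.
Proof.
move=> /andP[t0 tt] ne; have v0 := svec_gt0 t w; have w0 := svec_time w t0.
have w0' := svec_time w' t0.
have t12 : t * t < 2^-1.
  have : t2 * t2 = 2^-1 :> R by rewrite /t2 -expr2 sqr_sqrtr// invr_ge0.
  have : 0 < t2 :> R by rewrite (lt_trans t0).
  nra.
have np : lorentz (svec t w') (svec t w) <= 0 -> lorentz (svec t w') (centre (svec t w)) < 0.
  exact: centre_lt0_npos.
have h2 := @sqrt2_gt0 R.
have pn i j : lorentz (svec t (Pos i)) (svec t (Neg j)) <= 0.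
  rewrite svec_pn; apply: mulr_ge0_le0; first exact: ltW.
  have [->|/(@eps_dotP R)] := eqVneq i j; first by rewrite eps_dot_self eps_sgn2; lra.
  by case=> [[-> ->]|[-> [] ->]]; lra.
have nl i k s : lorentz (svec t (Neg i)) (svec t (Letter k s)) <= 0.
  rewrite /= lorentz_eps_letter mul1r; apply: mulr_ge0_le0; first exact: ltW.
  exact: axis_le0.
have pl i k s : lorentz (svec t (Pos i)) (svec t (Letter k s)) <= 0.
  rewrite colour_neq_letter; apply: mulr_ge0_le0; first exact: ltW.
  apply: mulr_ge0_le0; [exact: ltW|exact: axis_le0].
case: w w' ne v0 w0 w0' np => [i|i|k s] [j|j|l r] ne v0 w0 w0' np;
  try (by apply: np; rewrite ?(pn, nl, pl)//; rewrite lorentzC ?(pn, nl, pl)).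
- have ij : j != i by apply/eqP => e; apply: ne; rewrite e.
  apply: centre_lt0 => //; move: v0; rewrite /= !lorentz_eps_vec2 !eps_vec20 eps_dot_self eps_sgn2 => v0.
  rewrite ltr_pM2l; last by rewrite mulr_gt0.
  have := @eps_dotP R _ _ ij; case=> [[-> ->]|[-> [] ->]]; nra.
- have ij : j != i by apply/eqP => e; apply: ne; rewrite e.
  apply: np; rewrite /= lorentz_eps_vec2.
  have -> : - (eps_sgn j * t) * - (eps_sgn i * t) = eps_sgn j * eps_sgn i * (t * t) by ring.
  by have := @eps_dotP R _ _ ij; case=> [[-> ->]|[-> [] ->]]; nra.
- apply: np; rewrite /= ; apply: (@le_trans _ _ (-1)); last by rewrite lerN10.
  by apply: lorentz_letter => -[e1 e2]; apply: ne; rewrite e1 e2.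
Qed.

End Walls.

(** * The gluings of [W_t], of the whole family and of [C] *)

Lemma discrete_pair {S T : topologicalType} (a : S) (b : T) :
  (\forall x \near a, x = a) -> (\forall y \near b, y = b) ->
  \forall z \near (a, b), z = (a, b).
Proof.
move=> ha hb; exists ([set x | x = a], [set y | y = b]); first by split.
by move=> [x y] [/= -> ->].
Qed.

Lemma discrete_bool (b : bool) : \forall x \near b, x = b.
Proof. by []. Qed.

Section Instances.
Context {R : realType}.
Implicit Types (t : R) (w : wall).

Definition wall_faces : finType := ('I_8 + 'I_8 + 'I_3 * bool)%type.

Definition wall_face (f : wall_faces) : wall :=
  match f with
  | inl (inl i) => Pos i
  | inl (inr i) => Neg i
  | inr (k, s) => Letter k s
  end.

Lemma wall_face_surj w : exists f, wall_face f = w.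
Proof.
case: w => [i|i|k s]; [by exists (inl (inl i))|by exists (inl (inr i))|].
by exists (inr (k, s)).
Qed.

Definition colour_bit (k : colour) (c : bool * bool * bool) : bool :=
  match k with Defs.colP => c.1.1 | colL => c.1.2 | colN => c.2 end.

Lemma colour_bit_flip k w c :
  colour_bit k (flip (wall_colour w) c) = colour_bit k c (+) `[< wall_colour w = k >].
Proof.
case: c => [[a b] d]; case: (wall_colour w); case: k => /=;
  by [rewrite asboolT// addbT | rewrite asboolF// addbF].
Qed.

Lemma colour_bit_inj c c' : (forall k, colour_bit k c = colour_bit k c') -> c = c'.
Proof.
case: c c' => [[a b] d] [[a' b'] d'] h.
by have := h Defs.colP; have := h colL; have := h colN => /= -> -> ->.
Qed.

(** Time ranges over all real numbers, so that words may be evaluated at [t = 0]. The system is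
    shared by every [W_t] and by [W_total], and orthogonality is accordingly demanded at all
    times. *)
Definition W_system : system R (bool * bool * bool) :=
  @System R _ wall colour R (fun w => flip (wall_colour w)) wall_colour colour_bit
    (fun t w => reflection (svec t w))
    (fun w w' => forall t, lorentz (svec t w) (svec t w') = 0)
    colour_bit_flip colour_bit_inj
    (fun t w => reflectionK (svec_gt0 t w))
    (fun t w w' h => reflection_comm (svec_gt0 t w) (svec_gt0 t w') (h t)).

Lemma svec_eq0 t w (x : 'cV[R]_5) : 0 < t ->
  lorentz (wall_vec t w) x = 0 <-> lorentz (svec t w) x = 0.
Proof.
move=> t0; have [a a0 ->] := svecE w t0; rewrite lorentzZl.
by split=> [->|/eqP]; rewrite ?mulr0// mulf_eq0 gt_eqF//= => /eqP.
Qed.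

Lemma svec_le0 t w (x : 'cV[R]_5) : 0 < t ->
  (lorentz (svec t w) x <= 0) = (lorentz (wall_vec t w) x <= 0).
Proof. by move=> t0; have [a a0 ->] := svecE w t0; rewrite lorentzZl pmulr_rle0. Qed.

Lemma cvg_svec w t : svec t' w @[t' --> t] --> svec t w.
Proof.
have h i a b (f g : R -> R) : f t' @[t' --> t] --> a -> g t' @[t' --> t] --> b ->
    eps_vec2 i (f t') (g t') @[t' --> t] --> eps_vec2 i a b.
  move=> hf hg; apply: (@cvg_mx _ _ _ (nbhs_filter t)) => r s; rewrite /eps_vec2.
  case: (eps i) => [[e1 e2] e3]; rewrite mxE; under eq_fun do rewrite mxE.
  by case: r => -[|[|[|[|[|//]]]]] ltr //=; try exact: hg; apply: cvgM => //; exact: cvg_cst.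
case: w => [i|i|k s] /=.
- by apply: h; [exact: cvg_id|exact: cvg_cst].
- by apply: h; [exact: cvg_cst|apply: cvgN; apply: cvgM; [exact: cvg_cst|exact: cvg_id]].
- exact: cvg_cst.
Qed.

(** For each wall, being off it is an open condition, and there are finitely many walls. *)
Lemma walls_usc {T : topologicalType} {F : finType} {L : Type} (e : F -> L)
    (f : T -> L -> R) (k : T) : (forall l, exists i, e i = l) ->
  (forall l, f z l @[z --> k] --> f k l) ->
  \forall z \near k, forall l, f z l = 0 -> f k l = 0.
Proof.
move=> eS fc; apply: (@filterS _ _ (nbhs_filter k)
  [set z | forall i, f z (e i) = 0 -> f k (e i) = 0]).
  by move=> z h l; have [i <-] := eS l; exact: h.
apply: filter_forall => i.
have [->|n0] := eqVneq (f k (e i)) 0; first exact: (@nearW _ _ _ (nbhs_filter k)).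
apply: (@filterS _ _ (nbhs_filter k) _ _ _ (fc (e i) _ (open_nbhs_nbhs (conj (@open_neq _ 0) n0)))).
by move=> z /= /eqP.
Qed.

Lemma on_total_near (q : R * 'cV[R]_5) : 0 < q.1 -> \forall r \near q,
  forall w, lorentz (wall_vec r.1 w) r.2 = 0 -> lorentz (wall_vec q.1 w) q.2 = 0.
Proof.
move=> q0; have n1 : \forall r \near q, 0 < r.1.
  exact: (@cvgr_gt _ _ _ (nbhs_filter q) _ _ (@cvg_fst _ _ (nbhs q.1) (nbhs q.2) _) _ q0).
have n2 : \forall r \near q, forall w, lorentz (svec r.1 w) r.2 = 0 ->
    lorentz (svec q.1 w) q.2 = 0.
  apply: (walls_usc (f := fun r w => lorentz (svec r.1 w) r.2) wall_face_surj) => w.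
  apply: (@cvg_lorentz _ _ _ (nbhs_filter q)); last exact: cvg_snd.
  exact: (cvg_comp _ _ (@cvg_fst _ _ (nbhs q.1) (nbhs q.2) _) (@cvg_svec w q.1)).
apply: (@filterS _ _ (nbhs_filter q) _ _ _ (@filterI _ _ (nbhs_filter q) _ _ n1 n2)).
by move=> r [r0 h] w /(svec_eq0 w r.2 r0)/h/(svec_eq0 w q.2 q0).
Qed.

Lemma cells_discrete (c : bool * bool * bool) : \forall c' \near c, c' = c.
Proof.
case: c => [[a b] c]; apply: discrete_pair; last exact: discrete_bool.
by apply: discrete_pair; exact: discrete_bool.
Qed.

Lemma enum_id {T : Type} (c : T) : exists i, id i = c. Proof. by exists c. Qed.

Lemma on_wall_near t (x : 'cV[R]_5) : 0 < t -> \forall y \near x,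
  forall w, lorentz (wall_vec t w) y = 0 -> lorentz (wall_vec t w) x = 0.
Proof.
move=> t0; have n2 : \forall y \near x, forall w, lorentz (svec t w) y = 0 ->
    lorentz (svec t w) x = 0.
  apply: (walls_usc (f := fun y w => lorentz (svec t w) y) wall_face_surj) => w.
  exact: lorentz_continuous.
apply: (@filterS _ _ (nbhs_filter x) _ _ _ n2) => y h w.
by move=> /(svec_eq0 w y t0)/h/(svec_eq0 w x t0).
Qed.

Definition W_gluing t (t0 : 0 < t) : gluing R (P t) (glued_along t) :=
  @Gluing R _ _ (P t) (glued_along t) W_system
    (fun x w => lorentz (wall_vec t w) x = 0) (fun x c c' => iff_refl _)
    (fun x _ => on_wall_near x t0) (bool * bool * bool)%type id (@enum_id _)
    cells_discrete.

Definition W_total_gluing : gluing R (@P_total R) (fun q => glued_along q.1 q.2) :=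
  @Gluing R _ _ (@P_total R) (fun q => glued_along q.1 q.2) W_system
    (fun q w => lorentz (wall_vec q.1 w) q.2 = 0) (fun x c c' => iff_refl _)
    (fun q h => on_total_near (proj1 (andP (proj1 h)))) (bool * bool * bool)%type id
    (@enum_id _) cells_discrete.

Lemma svec_facet t w : 0 < t < t2 -> exists f : 'cV[R]_5,
  [/\ cone f, True, lorentz (svec t w) f = 0 &
   forall w', w' <> w -> lorentz (svec t w') f < 0].
Proof.
move=> tt; have v0 := svec_gt0 t w; exists (centre (svec t w)); split=> //.
- exact: centre_cone.
- exact: centre_orth.
- by move=> w'; exact: svec_centre.
Qed.

Definition W_chamber t (tt : 0 < t < t2) :
  chamber H4 (@IsomH4 R) (W_gluing (proj1 (andP tt))).
Proof.
pose t0 : 0 < t := proj1 (andP tt).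
apply: (@Chamber R _ _ _ _ _ (W_gluing (proj1 (andP tt))) setT _ _ _ _ _ _ _ _ _
  t (svec t) _ _ _ _ _ _ _ _ _ wall_faces wall_face).
- by [].
- by [].
- by move=> x; split=> [|[]].
- by [].
- by move=> A x [_]; exact.
- exact: IsomH4_1.
- exact: IsomH4_mul.
- exact: IsomH4_adj.
- by move=> A _ h; apply: eq_mulmx => x; rewrite h// mul1mx.
- exact: svec_gt0.
- by [].
- by move=> w; apply: reflection_IsomH4; exact: svec_gt0.
- move=> x; split=> -[hx h]; split=> // w; first by rewrite svec_le0//; exact: h.
  by rewrite /= -svec_le0//; exact: h.
- by move=> x w; exact: svec_eq0.
- by [].
- by move=> w; exact: svec_facet.
- by move=> w w' cw h; exact: (svec_orth t0).
- by move=> w w'; exact.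
- exact: wall_face_surj.
- exact: (set_mem (P_origin t)).
- by move=> w; rewrite lorentz_originr oppr_lt0 svec_time.
Defined.

(** The colours of [W_t] are kept for [C], with a constant bit for the positive one, so that
    parities of words can be compared between the two systems. *)
Definition face0_bit (k : colour) (c : bool * bool) : bool :=
  match k with Defs.colP => false | colL => c.2 | colN => c.1 end.

Definition face0_colour (f : face0) : colour :=
  match f with Triangle _ => colN | Quadrilateral _ _ => colL end.

Lemma face0_bit_flip k f c :
  face0_bit k (flip0 f c) = face0_bit k c (+) `[< face0_colour f = k >].
Proof.
case: c => [a b]; case: f => [i|i s]; case: k => /=;
  by [rewrite asboolT// addbT | rewrite asboolF// addbF].
Qed.

Lemma face0_bit_inj c c' : (forall k, face0_bit k c = face0_bit k c') -> c = c'.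
Proof.
by case: c c' => [a b] [a' b'] h; have := h colL; have := h colN => /= -> ->.
Qed.

Definition face0_wall (f : face0) : wall :=
  match f with Triangle i => Neg i | Quadrilateral k s => Letter k s end.

Lemma face0_vecE f : face0_vec f = svec 0 (face0_wall f) :> 'cV[R]_5.
Proof. by case: f => [i|k s] //=; rewrite eps_vec2_1 mulr0 oppr0. Qed.

Lemma face0_vec_gt0 f : 0 < lorentz (face0_vec f) (face0_vec f) :> R.
Proof. by rewrite face0_vecE svec_gt0. Qed.

Definition C_system : system R (bool * bool) :=
  @System R _ face0 colour unit flip0 face0_colour face0_bit
    (fun _ f => reflection (face0_vec f))
    (fun f f' => lorentz (face0_vec f) (face0_vec f') = 0 :> R)
    face0_bit_flip face0_bit_inj
    (fun _ f => reflectionK (face0_vec_gt0 f))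
    (fun _ f f' h => reflection_comm (face0_vec_gt0 f) (face0_vec_gt0 f') h).

Definition face0_faces : finType := ('I_8 + 'I_3 * bool)%type.

Definition face0_face (f : face0_faces) : face0 :=
  match f with inl i => Triangle i | inr (k, s) => Quadrilateral k s end.

Lemma face0_face_surj f : exists i, face0_face i = f.
Proof. by case: f => [i|k s]; [exists (inl i)|exists (inr (k, s))]. Qed.

Lemma on_face_near (x : 'cV[R]_5) : \forall y \near x,
  forall f, lorentz (face0_vec f) y = 0 -> lorentz (face0_vec f) x = 0.
Proof.
apply: (walls_usc (f := fun y f => lorentz (face0_vec f) y) face0_face_surj) => f.
exact: lorentz_continuous.
Qed.

Lemma cells0_discrete (c : bool * bool) : \forall c' \near c, c' = c.
Proof. by case: c => [a b]; apply: discrete_pair; exact: discrete_bool. Qed.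

Definition C_gluing : gluing R (@P0 R) (@glued_along0 R) :=
  @Gluing R _ _ (@P0 R) (@glued_along0 R) C_system
    (fun x f => lorentz (face0_vec f) x = 0) (fun x c c' => iff_refl _)
    (fun x _ => on_face_near x) (bool * bool)%type id (@enum_id _)
    cells0_discrete.

Lemma face0_time f : 0 < face0_vec f ord0 0 :> R.
Proof.
case: f => [i|k s] /=; rewrite ?letter_vec0// -eps_vec2_1 eps_vec20 mul1r.
exact: sqrt2_gt0.
Qed.

(** The right-angled Coxeter condition: for unit normals, a product at most -1 means that the two
    planes do not meet in hyperbolic space. *)
Lemma face0_product f f' : f <> f' ->
  (lorentz (face0_vec f) (face0_vec f') = 0 :> R /\ face0_colour f <> face0_colour f') \/
  lorentz (face0_vec f) (face0_vec f') <= -1 :> R.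
Proof.
have h2 := @sqrt2_gt0 R; have h22 := @sqrt2_sq R.
have tl i k s : lorentz (face0_vec (Triangle i)) (face0_vec (Quadrilateral k s)) = 0 :> R \/
    lorentz (face0_vec (Triangle i)) (face0_vec (Quadrilateral k s)) <= -1 :> R.
  rewrite /= -eps_vec2_1 lorentz_eps_letter mul1r.
  case: (sign2 (R := R) s) (axis_sgnP (R := R) k i) => -> [] ->; try (by left; ring);
    right; nra.
case: f f' => [i|k s] [j|k' s'] ne.
- right; rewrite /= -!eps_vec2_1 lorentz_eps_vec2.
  have ij : i != j by apply/eqP => e; apply: ne; rewrite e.
  by have := @eps_dotP R _ _ ij; case=> [[_ ->]|[_ [] ->]]; lra.
- by have [h|h] := tl i k' s'; [left|right].
- by rewrite lorentzC; have [h|h] := tl j k s; [left|right].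
- right; apply: lorentz_letter => -[e1 e2]; apply: ne; by rewrite e1 e2.
Qed.

Lemma face0_vec_self f : lorentz (face0_vec f) (face0_vec f) = 1 :> R.
Proof.
case: f => [i|k s] /=; rewrite ?lorentz_letter_self// -eps_vec2_1 lorentz_eps_vec2.
by rewrite eps_dot_self; ring.
Qed.

Lemma face0_vec_flat f : face0_vec f ord_max 0 = 0 :> R.
Proof.
case: f => [i|k s] /=; last by rewrite /letter_vec vec5_max.
by rewrite /eps_vec; case: (eps i) => [[? ?] ?]; rewrite vec5_max.
Qed.

(** It remains to fix the unit normal [e4] of the hyperplane: its image is orthogonal to that
    hyperplane, and preservation of the last coordinate excludes the opposite vector. *)
Lemma IsomH3_flat (A : 'M[R]_5) : IsomH3 A ->
  (forall x : 'cV[R]_5, x ord_max 0 = 0 -> A *m x = x) -> A = 1%:M.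
Proof.
move=> [A0 [_ A2]] h; pose e4 : 'cV[R]_5 := vec5 0 0 0 0 1.
have dec (x : 'cV[R]_5) : (x - x ord_max 0 *: e4) ord_max 0 = 0.
  by rewrite !mxE /= mulr1 subrr.
have le4 (x : 'cV[R]_5) : lorentz e4 x = x ord_max 0.
  have -> : x = vec5 (x 0 0) (x 1 0) (x (inord 2) 0) (x (inord 3) 0) (x ord_max 0).
    apply/matrixP => i j; rewrite ord1 mxE.
    case: i => -[|[|[|[|[|//]]]]] lti /=; congr (x _ 0); apply: val_inj;
      by rewrite /= ?inordK.
  by rewrite lorentz_vec5 vec5_max; ring.
have Ae4 : A *m e4 = e4.
  apply: lorentz_inj => y.
  have e1 : lorentz (A *m e4) (y - y ord_max 0 *: e4) = 0.
    by rewrite -[X in lorentz _ X](h _ (dec y)) A0.1 le4 dec.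
  rewrite -{1}[y](subrK (y ord_max 0 *: e4)) lorentzDr e1 add0r lorentzZr.
  by rewrite lorentzC !le4 A2 vec5_max mulr1.
apply: eq_mulmx => x; rewrite mul1mx -{1}[x](subrK (x ord_max 0 *: e4)).
by rewrite mulmxDr -scalemxAr Ae4 (h _ (dec x)) subrK.
Qed.

Definition C_chamber : chamber H3 (@IsomH3 R) C_gluing.
Proof.
apply: (@Chamber R _ _ _ _ _ C_gluing [set x | x ord_max 0 = 0] _ _ _ _ _ _ _ _ _
  tt (@face0_vec R) _ _ _ _ _ _ _ _ _ face0_faces face0_face).
- by move=> x y /= hx hy; rewrite mxE hx hy addr0.
- by move=> a x /= hx; rewrite mxE hx mulr0.
- by move=> x; split.
- by move=> A [].
- by move=> A x [_ [h _]]; exact: h.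
- exact: IsomH3_1.
- exact: IsomH3_mul.
- exact: IsomH3_adj.
- exact: IsomH3_flat.
- exact: face0_vec_gt0.
- exact: face0_vec_flat.
- by move=> f; apply: reflection_IsomH3; [exact: face0_vec_gt0|exact: face0_vec_flat].
- by move=> x; split.
- by [].
- by [].
- move=> f; exists (centre (face0_vec f)); split.
  + exact/centre_cone/face0_vec_gt0.
  + rewrite /= !mxE face0_vec_flat mulr0 addr0.
    by [].
  + exact/centre_orth/face0_vec_gt0.
  + move=> f' ne; apply: centre_lt0_npos; rewrite ?face0_vec_gt0 ?face0_time//.
    by have [[-> _]|] := face0_product ne => //; move/le_trans; apply; rewrite lerN10.
- by [].
- by [].
- exact: face0_face_surj.
- exact: (set_mem P0_origin).
- by move=> f; rewrite lorentz_originr oppr_lt0 face0_time.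
Defined.

(* Two faces through a common point are orthogonal: otherwise the sum of their
   normal vectors would be orthogonal to that time-like point without being
   space-like. *)
Lemma C_regular (x : 'cV[R]_5) : H4 x -> reg (on (g := C_gluing) x).
Proof.
move=> hx f f' /= of1 of2; have [->|ne] := pselect (f = f'); [by left|right].
have [[h cf]//|h] := face0_product ne.
have /(cone_orth (H4_cone hx)) : lorentz (face0_vec f + face0_vec f') x = 0.
  by rewrite lorentzDl of1 of2 addr0.
rewrite !lorentzE !face0_vec_self (lorentzC (face0_vec f')) => e.
have /matrixP /(_ ord0 0) : face0_vec f + face0_vec f' = 0 :> 'cV[R]_5 by apply: e; lra.
by rewrite !mxE => /eqP; rewrite gt_eqF// addr_gt0// face0_time.
Qed.

End Instances.

(** * Realizing words by loops *)

Section WordPaths.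
Context {R : realType} {L : Type}.
Implicit Types (f : L -> 'cV[R]_5) (u : seq L) (x : R).

(* The path attached to a word goes, during the [i]-th unit of time, from the
   origin to the centre of the [i]-th facet and back; [prefix_at] is the word of
   the walls crossed so far. *)
Definition tent x : R := Num.max 0 (1 - `|2 * x - 1|).

Fixpoint word_sum f u x : 'cV[R]_5 :=
  if u is w :: u' then tent x *: (f w - origin) + word_sum f u' (x - 1) else origin.

Fixpoint prefix_at u x : seq L :=
  if u is w :: u' then if x <= 2^-1 then [::] else w :: prefix_at u' (x - 1) else [::].

Lemma tent_out x : x <= 0 \/ 1 <= x -> tent x = 0.
Proof.
move=> h; rewrite /tent max_l//; case: h => h.
  by rewrite ler0_norm; lra.
by rewrite ger0_norm; lra.
Qed.

Lemma tent_ge0 x : 0 <= tent x.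
Proof. by rewrite /tent le_max lexx. Qed.

Lemma tent_half : tent 2^-1 = 1.
Proof. by rewrite /tent divff// subrr normr0 subr0 max_r. Qed.

Lemma tent_lt1 x : x != 2^-1 -> tent x < 1.
Proof.
move=> h; rewrite /tent gt_max ltr01 /= gtrBl normr_gt0 subr_eq0.
by apply: contraNneq h => h; apply/eqP; lra.
Qed.

Lemma tent_continuous : continuous tent.
Proof.
have -> : tent = (fun x => (0 + (1 - `|2 * x - 1|) + `|0 - (1 - `|2 * x - 1|)|) / 2).
  by apply: funext => x; rewrite /tent maxr_absE.
move=> x; have h : (1 - `|2 * y - 1|) @[y --> x] --> 1 - `|2 * x - 1|.
  apply: cvgB; first exact: cvg_cst.
  apply: cvg_norm; apply: cvgB; last exact: cvg_cst.
  by apply: cvgM; [exact: cvg_cst|exact: cvg_id].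
apply: cvgM; last exact: cvg_cst.
apply: cvgD; first by apply: cvgD => //; exact: cvg_cst.
by apply: cvg_norm; apply: cvgB => //; exact: cvg_cst.
Qed.

Lemma word_sum_le0 f u x : x <= 0 -> word_sum f u x = origin.
Proof.
elim: u x => [//|w u ih] x x0 /=; rewrite tent_out; last by left.
by rewrite scale0r add0r ih//; lra.
Qed.

Lemma word_sum_le1 f w u x : x <= 1 ->
  word_sum f (w :: u) x = (1 - tent x) *: origin + tent x *: f w.
Proof.
move=> x1; rewrite /= word_sum_le0; last by lra.
by rewrite scalerBr scalerBl scale1r addrC addrA addrAC.
Qed.

Lemma word_sum_ge1 f w u x : 1 <= x -> word_sum f (w :: u) x = word_sum f u (x - 1).
Proof. by move=> x1; rewrite /= tent_out ?scale0r ?add0r//; right. Qed.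

Lemma prefix_le u x : x <= 2^-1 -> prefix_at u x = [::].
Proof. by case: u => //= w u ->. Qed.

Lemma word_sum_end f u : word_sum f u (size u)%:R = origin.
Proof.
elim: u => [//|w u ih]; rewrite word_sum_ge1 ?ler1n// -[RHS]ih; congr word_sum.
by rewrite /= -natr1 addrK.
Qed.

Lemma prefix_end u : prefix_at u (size u)%:R = u.
Proof.
elim: u => [//|w u ih] /=; rewrite leNgt (_ : 2^-1 < _) /=; last first.
  by apply: (@lt_le_trans _ _ 1); rewrite ?invf_lt1 ?ltr1n ?ler1n.
by rewrite -natr1 addrK ih.
Qed.

(** The facet points converge together with the position on the path, since in the family of loops
    they move with [t]. *)
Lemma word_sum_cvg {K : Type} (F : set_system K) {FF : Filter F} (f : K -> L -> 'cV[R]_5)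
    (x : K -> R) f0 x0 u :
  (forall w, f k w @[k --> F] --> f0 w) -> x @ F --> x0 ->
  word_sum (f k) u (x k) @[k --> F] --> word_sum f0 u x0.
Proof.
move=> hf; elim: u x x0 => [|w u ih] x x0 hx /=; first exact: cvg_cst.
apply: cvgD.
  apply: cvgZ; first exact: (cvg_comp _ _ hx (@tent_continuous x0)).
  by apply: cvgB; [exact: hf|exact: cvg_cst].
by apply: ih; apply: cvgB => //; exact: cvg_cst.
Qed.

(** The position lies on a segment from the origin with its far end removed, hence in the interior
    once the values of [f] lie on facets. Quantifying over [f] makes this a property of the word and
    the time only. *)
Definition on_segment u x := forall f, exists a, [/\ 0 <= a, a < 1 &
  exists y, (y = origin \/ exists w, y = f w) /\
  word_sum f u x = (1 - a) *: origin + a *: y].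

(** The prefix jumps only at the top of a tent, when the path is at the facet point, and it gains
    just the letter of that facet. *)
Lemma word_local u x :
  (on_segment u x /\ \forall y \near x, prefix_at u y = prefix_at u x) \/
  exists2 w, forall f, word_sum f u x = f w &
    \forall y \near x, prefix_at u y = prefix_at u x \/
      prefix_at u y = prefix_at u x ++ [:: w].
Proof.
elim: u x => [|w u ih] x.
  left; split; last exact: (@nearW _ _ _ (nbhs_filter x)).
  move=> f; exists 0; split => //; exists origin; split; first by left.
  by rewrite subr0 scale1r scale0r addr0.
have seg : x <= 1 -> x != 2^-1 -> on_segment (w :: u) x.
  move=> x1 xh f; exists (tent x); split; [exact: tent_ge0|exact: tent_lt1|].
  by exists (f w); split; [right; exists w|exact: word_sum_le1].
case: (ltgtP x 2^-1) => [xh|xh|xh].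
- left; split.
    apply: seg; last by rewrite lt_eqF.
    by rewrite (le_trans (ltW xh))// invf_le1// ler1n.
  have h := @lt_nbhsl _ _ _ xh.
  apply: (@filterS _ _ (nbhs_filter x) _ _ _ h) => y /= yh.
  by rewrite !ifT// ltW.
- have n1 : \forall y \near x, 2^-1 < y by
    exact: (@cvgr_gt _ _ _ (nbhs_filter x) _ _ (@cvg_id _ (nbhs x)) _ xh).
  have [x1|x1] := leP x 1.
    left; split; first by apply: seg => //; rewrite gt_eqF.
    have n2 : \forall y \near x, y - 1 < 2^-1.
      have h : x < 1 + 2^-1 by apply: (le_lt_trans x1); rewrite ltrDl invr_gt0.
      apply: (@filterS _ _ (nbhs_filter x) _ _ _ (@lt_nbhsl _ _ _ h)) => y /=; lra.
    apply: (@filterS _ _ (nbhs_filter x) _ _ _ (@filterI _ _ (nbhs_filter x) _ _ n1 n2)).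
    move=> y [y1 y2] /=; rewrite !ifF; try by rewrite leNgt ?y1 ?xh.
    by rewrite !prefix_le ?ltW//; lra.
  have sE f : word_sum f (w :: u) x = word_sum f u (x - 1) by rewrite word_sum_ge1// ltW.
  have c1 : (y - 1) @[y --> x] --> x - 1 by apply: cvgB; [exact: cvg_id|exact: cvg_cst].
  have pE y : 2^-1 < y -> prefix_at (w :: u) y = w :: prefix_at u (y - 1).
    by move=> h; rewrite /= leNgt h.
  have [[sg np]|[w' sw np]] := ih (x - 1).
    left; split; first by move=> f; have [a [a0 a1 [y [yE e]]]] := sg f;
      exists a; split=> //; exists y; rewrite sE.
    apply: (@filterS _ _ (nbhs_filter x) _ _ _ (@filterI _ _ (nbhs_filter x) _ _ n1 (c1 _ np))).
    by move=> y [y1 y2]; rewrite !pE//; move: y2 => /= ->.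
  right; exists w'; first by move=> f; rewrite sE.
  apply: (@filterS _ _ (nbhs_filter x) _ _ _ (@filterI _ _ (nbhs_filter x) _ _ n1 (c1 _ np))).
  by move=> y [y1 y2]; rewrite !pE//; case: y2 => /= ->; [left|right].
right; exists w; first by move=> f;
  rewrite word_sum_le1 xh ?tent_half ?subrr ?scale0r ?add0r ?scale1r// invf_le1// ler1n.
have n2 : \forall y \near x, y - 1 < 2^-1.
  have h : x < 1 + 2^-1 by rewrite xh ltrDr.
  apply: (@filterS _ _ (nbhs_filter x) _ _ _ (@lt_nbhsl _ _ _ h)) => y /=; lra.
apply: (@filterS _ _ (nbhs_filter x) _ _ _ n2) => y y1 /=.
rewrite xh lexx; case: leP => _; first by left.
by right; rewrite prefix_le// ltW.
Qed.

End WordPaths.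

(** * The loop of a word in a glued space *)

Section ChamberWordPaths.
Context {R : realType} {S : topologicalType} {X : set 'cV[R]_5} {I : set 'M[R]_5}
  {D : set 'cV[R]_5} {E : 'cV[R]_5 -> S -> S -> Prop} {G : gluing R D E}
  (H : chamber X I G).
Local Notation M := (glued D E).
Local Notation on := (on (g := G)).
Local Notation Y := (sys G).
Local Notation vec := (vec H).
Local Notation mt := (mat (Y := Y) (now H)).
Local Notation wlp p := (walls (G := G) p).

Variables (f : letter Y -> 'cV[R]_5) (c0 : S) (x0 : D).
Hypothesis x0E : val x0 = @origin R.
Hypothesis f_facet : forall w, [/\ cone (f w), flat H (f w), lorentz (vec w) (f w) = 0 &
  forall w', w' <> w -> lorentz (vec w') (f w) < 0].
Implicit Types (u : seq (letter Y)) (w : letter Y).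

Lemma flat_origin : flat H (@origin R).
Proof. by apply: space_flat; have /(chamberE H)[] := chamber_origin H. Qed.

Lemma f_le0 w w' : lorentz (vec w') (f w) <= 0.
Proof.
by have [_ _ f0 flt] := f_facet w; have [->|/flt/ltW//] := pselect (w' = w); rewrite f0.
Qed.

Lemma word_sum_spec u x : [/\ cone (word_sum f u x), flat H (word_sum f u x),
    (forall w, lorentz (vec w) (word_sum f u x) <= 0) &
    (on_segment u x -> forall w, lorentz (vec w) (word_sum f u x) < 0)].
Proof.
have seg : on_segment u x -> [/\ cone (word_sum f u x), flat H (word_sum f u x) &
    forall w, lorentz (vec w) (word_sum f u x) < 0].
  move=> /(_ f)[a [a0 a1 [y [yE ->]]]].
  have [cy fy y0] : [/\ cone y, flat H y & forall w, lorentz (vec w) y <= 0].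
    case: yE => [->|[w ->]].
      split; [exact: cone_origin|exact: flat_origin|].
      by move=> w; rewrite ltW// vec_origin.
    by have [? ? _ _] := f_facet w; split => // w'; exact: f_le0.
  have ca : cone ((1 - a) *: @origin R).
    by apply: coneZ; [rewrite subr_gt0|exact: cone_origin].
  split.
  - have [->|an] := eqVneq a 0; first by rewrite subr0 scale1r scale0r addr0; exact: cone_origin.
    by apply: coneD => //; apply: coneZ => //; rewrite lt0r an.
  - by apply: flatD; apply: flatZ => //; exact: flat_origin.
  - move=> w; rewrite !lorentzE; have := vec_origin H w; have := y0 w; nra.
have [[sg _]|[w sw _]] := word_local u x.
  by have [h1 h2 h3] := seg sg; split => // w; exact: ltW.
have [h1 h2 _ _] := f_facet w; rewrite sw; split => //; first exact: f_le0.
by move=> /seg[_ _]; rewrite sw.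
Qed.

Lemma word_pos_in u x : D (nrm (word_sum f u x)).
Proof.
have [h1 h2 h3 _] := word_sum_spec u x; apply/(chamberE H); split.
  by apply/(spaceE H); split; [exact: nrm_H4|exact: flatZ].
by move=> w; rewrite lorentz_nrm pmulr_rle0// nrm_scale.
Qed.

Lemma word_pos_on u x w : on (nrm (word_sum f u x)) w ->
  (forall g, word_sum g u x = g w) /\ ~ on_segment u x.
Proof.
have [h1 _ _ h4] := word_sum_spec u x => /(onE H); rewrite lorentz_nrm => /eqP.
rewrite mulf_eq0 (gt_eqF (nrm_scale h1)) /= => /eqP h.
have nseg : ~ on_segment u x by move=> /h4/(_ w); rewrite h ltxx.
have [[/nseg//]|[w' sw _]] := word_local u x.
suff -> : w = w' by [].
rewrite sw in h; apply: contrapT => ne.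
by have [_ _ _ /(_ w ne)] := f_facet w'; rewrite h ltxx.
Qed.

Definition word_path u (s : R) : M :=
  cell (flw (prefix_at u ((size u)%:R * s)) c0) (inset (word_pos_in u ((size u)%:R * s))).

Lemma word_path_time u (s : R) : (size u)%:R * s' @[s' --> s] --> (size u)%:R * s.
Proof. by apply: cvgM; [exact: cvg_cst|exact: cvg_id]. Qed.

Lemma word_path_near u (s : R) : \forall s' \near s, exists2 v,
  words_in (on (nrm (word_sum f u ((size u)%:R * s)))) v &
  prefix_at u ((size u)%:R * s') = prefix_at u ((size u)%:R * s) ++ v.
Proof.
have ct := @word_path_time u s.
have [[sg np]|[w sw np]] := word_local u ((size u)%:R * s).
  have h : \forall s' \near s, prefix_at u ((size u)%:R * s') = prefix_at u ((size u)%:R * s).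
    exact: ct np.
  apply: (@filterS _ _ (nbhs_filter s) _ _ _ h) => s' ->.
  by exists [::]; rewrite ?cats0.
have h : \forall s' \near s, prefix_at u ((size u)%:R * s') = prefix_at u ((size u)%:R * s) \/
    prefix_at u ((size u)%:R * s') = prefix_at u ((size u)%:R * s) ++ [:: w].
  exact: ct np.
apply: (@filterS _ _ (nbhs_filter s) _ _ _ h) => s' [] ->.
  by exists [::]; rewrite ?cats0.
exists [:: w] => //=; split => //; apply/(onE H).
by have [_ _ f0 _] := f_facet w; rewrite lorentz_nrm sw f0 mulr0.
Qed.

Lemma word_path_continuous u : continuous (word_path u).
Proof.
move=> s; apply: (@cvg_cell _ _ _ _ _ G _ _ (nbhs_filter s)
  (fun s' => inset (word_pos_in u ((size u)%:R * s')))
  (fun s' => flw (prefix_at u ((size u)%:R * s')) c0)).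
  apply: (@cvg_subtype _ _ _ _ (nbhs_filter s)) => /=.
  have [h1 _ _ _] := word_sum_spec u ((size u)%:R * s).
  apply: (@cvg_nrm _ _ _ (nbhs_filter s)) => //.
  apply: (@word_sum_cvg _ _ _ _ (nbhs_filter s)); last exact: word_path_time.
  by move=> w; exact: cvg_cst.
apply: (@filterS _ _ (nbhs_filter s) _ _ _ (word_path_near u s)) => s' [v iv ->].
by exists v => //; rewrite flw_cat flwC.
Qed.

Lemma word_path_reg u s : reg (wlp (word_path u s)).
Proof.
move=> w w'; rewrite !walls_cell /= => ow ow'; left; apply: contrapT => ne.
have [h _] := word_pos_on ow; have [h' _] := word_pos_on ow'.
(* A test assignment separating [w] from [w']: at a time when the path is on both walls, the sum
   would equal the value of every assignment at either letter. *)
pose g (z : letter Y) : 'cV[R]_5 := if pselect (z = w) then origin else 0.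
have : g w = g w' by rewrite -h -h'.
have -> : g w = origin by rewrite /g; case: (pselect (w = w)).
have -> : g w' = 0 by rewrite /g; case: (pselect (w' = w)) => // e; case: (ne (esym e)).
by move=> /matrixP /(_ ord0 0); rewrite !mxE /= => /eqP; rewrite oner_eq0.
Qed.

Lemma word_path_lift u :
  is_lift c0 (fun s => st G (word_path u s)) 0 1 (fun s => prefix_at u ((size u)%:R * s)).
Proof.
split=> s s01.
  pose c := flw (prefix_at u ((size u)%:R * s)) c0.
  have [v iv e] := ce_cell G c (inset (word_pos_in u ((size u)%:R * s))).
  by exists v; split; rewrite /= ?walls_cell//= -/c e flwK.
have sub : \forall s' \near s, forall w, wlp (word_path u s') w -> wlp (word_path u s) w.
  apply: (@filterS _ _ (nbhs_filter s) _ _ _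
    (@word_path_continuous u s _ (near_star G (word_path u s)))).
  by move=> s' [].
have /nbhs_ballP[e /= e0 he] := @filterI _ _ (nbhs_filter s) _ _ sub (word_path_near u s).
exists e => // s' _ se; have [|h [v iv vE]] := he s'; first by rewrite /ball /= distrC.
split=> //; exists v; split; first by rewrite /= walls_cell.
by rewrite vE.
Qed.

Lemma word_path0 u : word_path u 0 = cell c0 x0.
Proof.
rewrite /word_path mulr0 prefix_le ?invr_ge0//=; congr cell; apply: val_inj => /=.
by rewrite word_sum_le0// nrm_id ?x0E//; exact: H4_origin.
Qed.

Lemma word_path1 u : flw u c0 = c0 -> word_path u 1 = cell c0 x0.
Proof.
move=> e; rewrite /word_path mulr1 prefix_end e; congr cell; apply: val_inj => /=.
by rewrite word_sum_end nrm_id ?x0E//; exact: H4_origin.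
Qed.

Lemma word_path_within u : {within `[0, 1], continuous (word_path u)}.
Proof. by apply: continuous_in_subspaceT => s _; exact: word_path_continuous. Qed.

Lemma word_path_holonomy u : flw u c0 = c0 -> holonomy X I c0 (word_path u) = mt u.
Proof.
move=> e; rewrite (holonomy_lift H x0E _ _ _ _ (word_path_lift u)).
- by rewrite mulr1 prefix_end.
- exact: word_path_within.
- exact: word_path0.
- exact: word_path1.
- by move=> s _; exact: word_path_reg.
- by rewrite mulr0 prefix_le// invr_ge0.
Qed.

End ChamberWordPaths.

(** * The holonomy of [W_t] *)

Section WHolonomy.
Context {R : realType}.
Local Notation base := base_copy.
Local Notation WS := (@W_system R).
Local Notation word := (seq (letter WS)).
Implicit Types (t s : R).

Definition tpos t (tt : 0 < t < t2) : 0 < t := proj1 (andP tt).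

Definition W_origin t : P t := exist (fun x => x \in P t) origin (P_origin t).

Lemma Sigma_reg t (tt : 0 < t < t2) (p : W t) : (~` @Sigma R t) p ->
  reg (walls (G := W_gluing (tpos tt)) p).
Proof.
rewrite /Sigma /singular_set setCK => -[phi ch].
exact: (reg_of_chart (W_chamber tt) ch (esym (ptce p))).
Qed.

Lemma reg_Sigma t (tt : 0 < t < t2) (p : W t) :
  reg (walls (G := W_gluing (tpos tt)) p) -> (~` @Sigma R t) p.
Proof.
move=> rp; rewrite /Sigma /singular_set setCK.
pose G := W_gluing (tpos tt).
exists (dev (W_chamber tt) (ce p) (walls (G := G) p) [::]).
by apply: star_chart => //; exists [::].
Qed.

Lemma W_loop_reg t (tt : 0 < t < t2) g : loops (~` @Sigma R t) (W_base t) g ->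
  forall s, 0 <= s <= 1 -> reg (walls (G := W_gluing (tpos tt)) (g s)).
Proof. by move=> [_ _ _ h] s s01; apply: Sigma_reg; apply: h; rewrite in_itv. Qed.

Lemma W_mul_holonomy t g h : 0 < t < t2 ->
  loops (~` @Sigma R t) (W_base t) g -> loops (~` @Sigma R t) (W_base t) h ->
  rho_t (loop_mul g h) = rho_t g *m rho_t h.
Proof.
move=> tt lg lh; have rg := W_loop_reg (tt := tt) lg; have rh := W_loop_reg (tt := tt) lh.
case: lg lh => [gc g0 g1 _] [hc h0 h1 _].
exact: (holonomy_mul (W_chamber tt) (x0 := W_origin t) erefl g0 g1 h0 h1 rg rh gc hc).
Qed.

Lemma W_homotopic_holonomy t g h : 0 < t < t2 ->
  loops (~` @Sigma R t) (W_base t) g -> loops (~` @Sigma R t) (W_base t) h ->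
  homotopic (~` @Sigma R t) g h -> rho_t g = rho_t h.
Proof.
move=> tt [gc g0 g1 _] [hc _ _ _] [K [Kc KS Kgh Kr]].
apply: (holonomy_homotopic (W_chamber tt) (x0 := W_origin t) erefl g0 g1 Kc Kgh Kr) => //.
by move=> s r s01 r01; apply: Sigma_reg; apply: KS; rewrite in_itv.
Qed.

Lemma half_t2 : 0 < (t2 / 2 : R) < t2.
Proof.
have t20 : 0 < t2 :> R by rewrite sqrtr_gt0 invr_gt0.
by rewrite divr_gt0// ltr_pdivrMr// ltr_pMr// ltr1n.
Qed.

Lemma W_family_word (g : forall t, R -> W t) : W_loops g -> exists2 u : word,
  flw u base = base & forall t, 0 < t < t2 -> rho_t (g t) = mat (Y := WS) t u.
Proof.
move=> [lg [Gam [Gc Gg]]].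
have gl t (tt : 0 < t < t2) : exists u : R -> word,
    is_lift base (fun s => st (W_gluing (tpos tt)) (g t s)) 0 1 u /\ u 0 = [::].
  have [gc g0 _ _] := lg t tt.
  exact: (loop_lift (W_chamber tt) (x0 := W_origin t) erefl gc g0
    (W_loop_reg (tt := tt) (lg t tt))).
have hol t (tt : 0 < t < t2) u : is_lift base (fun s => st (W_gluing (tpos tt)) (g t s)) 0 1 u ->
    u 0 = [::] -> rho_t (g t) = mat (Y := WS) t (u 1).
  move=> lu u0; have [gc g0 g1 _] := lg t tt.
  exact: (holonomy_lift (W_chamber tt) (x0 := W_origin t) erefl gc g0 g1
    (W_loop_reg (tt := tt) (lg t tt)) lu u0).
(* States are read in [W_total], where the family is jointly continuous in [t] and [s]; this makes
   the parameter of [lift_const] available for [t]. *)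
pose q t s : state WS := st (@W_total_gluing R) (Gam (t, s)).
have eqst t (tt : 0 < t < t2) s : 0 <= s <= 1 ->
    nearst (st (W_gluing (tpos tt)) (g t s)) (q t s) /\
    nearst (q t s) (st (W_gluing (tpos tt)) (g t s)).
  move=> s01; have [|x [y [c [yE gE GE]]]] := Gg t s tt; first by rewrite in_itv.
  have [n1 n2] := nearst_cell (W_gluing (tpos tt)) c x.
  have [m1 m2] := nearst_cell (@W_total_gluing R) c y.
  rewrite /q gE GE.
  have onE : on (g := @W_total_gluing R) (val y) = on (g := W_gluing (tpos tt)) (val x).
    by apply: funext => w; rewrite /= yE.
  rewrite onE in m1 m2.
  have nt (p1 p2 p3 : state WS) : nearst p1 p2 -> nearst p2 p3 -> nearst p1 p3.
    move=> [a [v [iv e]]] [b [v' [iv' e']]]; split; first by move=> w /b /a.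
    exists (v' ++ v); split; last by rewrite e' e flw_cat.
    by apply/words_in_cat; split => //; exact: words_inS iv'.
  by split; [exact: nt n1 m2|exact: nt m1 n2].
have walls_eq t (tt : 0 < t < t2) s : 0 <= s <= 1 -> forall w,
    (q t s).1 w <-> walls (G := W_gluing (tpos tt)) (g t s) w.
  by move=> s01 w; have [[a _] [b _]] := eqst t tt s s01; split=> [/a|/b].
have same a b (ta : 0 < a < t2) (tb : 0 < b < t2) u v : a <= b ->
    is_lift base (fun s => st (W_gluing (tpos ta)) (g a s)) 0 1 u -> u 0 = [::] ->
    is_lift base (fun s => st (W_gluing (tpos tb)) (g b s)) 0 1 v -> v 0 = [::] ->
    equiv (u 1) (v 1).
  move=> ab lu u0 lv v0.
  have rr r : a <= r <= b -> 0 < r < t2.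
    move=> /andP[ar rb]; have /andP[a0 _] := ta; have /andP[_ b2] := tb.
    by rewrite (lt_le_trans a0 ar) (le_lt_trans rb b2).
  apply: (@lift_const _ _ WS base q a b) => //; rewrite ?u0 ?v0//.
  - apply: (family_starcont (@W_total_gluing R) (g := fun r s => Gam (r, s))) => r s rab s01 U nU.
    have [||e e0 he] := within_eps2 Gc _ _ nU; rewrite /= ?in_itv ?rr//.
    by exists e => // r' s' rab' s01'; apply: he; rewrite /= in_itv ?rr.
  - move=> r s rab s01 w w' /(walls_eq r (rr r rab) s s01) ow.
    move=> /(walls_eq r (rr r rab) s s01).
    exact: (W_loop_reg (tt := rr r rab) (lg r (rr r rab)) s01).
  - move=> r rab; have tr := rr r rab; have [gc g0 g1 _] := lg r tr.
    have z01 : 0 <= (0 : R) <= 1 by rewrite lexx ler01.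
    have o01 : 0 <= (1 : R) <= 1 by rewrite lexx ler01.
    have nw := walls_base (W_chamber tr) (c0 := base) (x0 := W_origin r) erefl.
    have nw0 w : ~ (q r 0).1 w by move/(walls_eq r tr 0 z01); rewrite g0; exact: nw.
    split=> //; first by move=> w /(walls_eq r tr 1 o01); rewrite g1; exact: nw.
    have [[_ [[|w v'] [iv' ->]]] _] := eqst r tr 0 z01.
      have cb : ce (W_base r) = base.
        exact: (ce_base (W_chamber tr) base (x0 := W_origin r) erefl).
      by change (ce (g r 0) = base); rewrite g0.
    by case: iv' => ow _; have /nw0 := (walls_eq r tr 0 z01 w).2 ow.
  - by apply: lift_eqst lu => s s01; exact: eqst.
  - by apply: lift_eqst lv => s s01; exact: eqst.
(* The word is read off at a reference parameter and compared with the words at all others. *)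
have [u [lu u0]] := gl _ half_t2; exists (u 1).
  have [_ _ g1 _] := lg _ half_t2.
  exact: (lift_end (W_chamber half_t2) (x0 := W_origin (t2 / 2)) erefl g1 lu).
move=> t tt; have [v [lv v0]] := gl t tt; rewrite (hol t tt v lv v0).
have [le|/ltW le] := leP t (t2 / 2).
  by have [e _] := same _ _ tt half_t2 v u le lv v0 lu u0; exact: e.
by have [e _] := same _ _ half_t2 tt u v le lu u0 lv v0; rewrite e.
Qed.

Definition W_centre t (w : letter WS) : 'cV[R]_5 := centre (svec t w).

Lemma W_facet t (tt : 0 < t < t2) : forall w : letter (sys (W_gluing (tpos tt))),
  [/\ cone (W_centre t w), flat (W_chamber tt) (W_centre t w),
    lorentz (vec (W_chamber tt) w) (W_centre t w) = 0 &
    forall w', w' <> w -> lorentz (vec (W_chamber tt) w') (W_centre t w) < 0].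
Proof.
move=> w; have v0 := svec_gt0 t w; split=> //; [exact: centre_cone|exact: centre_orth|].
by move=> w'; exact: svec_centre.
Qed.

Arguments W_facet [t] tt w.

Lemma W_centre_cvg t w : W_centre t' w @[t' --> t] --> W_centre t w.
Proof.
have h := @cvg_svec R w t; apply: (@cvgD _ _ _ _ (nbhs_filter t)); first exact: cvg_cst.
apply: (@cvgZ _ _ _ _ (nbhs_filter t)) => //.
apply: cvgM; first exact: (@mx_cvg _ _ _ (nbhs_filter t)).
apply: cvgV; first by rewrite gt_eqF// svec_gt0.
exact: (@cvg_lorentz _ _ _ (nbhs_filter t)).
Qed.

Section WordFamily.
Variable u : word.
Hypothesis u_even : flw u base = base.

Definition word_family t : R -> W t :=
  match pselect (0 < t < t2) with
  | left ht => word_path base (W_facet ht) u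
  | right _ => fun=> W_base t
  end.

Lemma word_point_in t (tt : 0 < t < t2) x :
  @P_total R (t, nrm (word_sum (W_centre t) u x)).
Proof. by split=> //=; exact: (word_pos_in (W_facet tt)). Qed.

(** Supplies the default value of [family_point] for parameters outside the interval. *)
Lemma origin_in_total : @P_total R (t2 / 2, origin).
Proof. by split; [exact: half_t2|exact: (set_mem (P_origin _))]. Qed.

Definition family_point (k : R * R) : @P_total R :=
  match pselect (0 < k.1 < t2) with
  | left ht => inset (word_point_in ht ((size u)%:R * k.2))
  | right _ => inset origin_in_total
  end.

Definition family_path (k : R * R) : @W_total R :=
  cell (flw (Y := WS) (prefix_at u ((size u)%:R * k.2)) base) (family_point k).

Lemma family_path_continuous (k : R * R) : 0 < k.1 < t2 -> {for k, continuous family_path}.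
Proof.
move=> kk; case: k kk => t s /= kk.
have near_t : \forall r \near (t, s), 0 < r.1 < t2.
  have n1 : \forall r \near (t, s), 0 < r.1.
    exact: (@cvgr_gt _ _ _ (nbhs_filter (t, s)) _ _
      (@cvg_fst _ _ (nbhs t) (nbhs s) _) _ (proj1 (andP kk))).
  have n2 : \forall r \near (t, s), r.1 < t2.
    exact: (@cvgr_lt _ _ _ (nbhs_filter (t, s)) _ _
      (@cvg_fst _ _ (nbhs t) (nbhs s) _) _ (proj2 (andP kk))).
  apply: (@filterS _ _ (nbhs_filter (t, s)) _ _ _ (@filterI _ _ (nbhs_filter (t, s)) _ _ n1 n2)).
  by move=> r [-> ->].
have pE (r : R * R) : 0 < r.1 < t2 -> val (family_point r) =
    (r.1, nrm (word_sum (W_centre r.1) u ((size u)%:R * r.2))).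
  by rewrite /family_point => rr; case: pselect.
apply: (@cvg_cell _ _ _ _ _ (@W_total_gluing R) _ _ (nbhs_filter (t, s)) family_point
  (fun k => flw (Y := WS) (prefix_at u ((size u)%:R * k.2)) base)).
  apply: (@cvg_subtype _ _ (@P_total R) _ (nbhs_filter (t, s)) family_point
    (family_point (t, s))); rewrite pE//.
  pose p (r : R * R) := nrm (word_sum (W_centre r.1) u ((size u)%:R * r.2)).
  have hp : p @ (t, s) --> p (t, s).
    have [cn _ _ _] := word_sum_spec (W_facet kk) u ((size u)%:R * s).
    apply: (@cvg_nrm _ _ _ (nbhs_filter (t, s))) => //.
    apply: (@word_sum_cvg _ _ _ _ (nbhs_filter (t, s))).
      move=> w; exact: (cvg_comp _ _ (@cvg_fst _ _ (nbhs t) (nbhs s) _) (@W_centre_cvg t w)).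
    by apply: cvgM; [exact: cvg_cst|exact: cvg_snd].
  have h : (fun r : R * R => (r.1, p r)) @ (t, s) --> (t, p (t, s)).
    exact: (@cvg_pair _ _ _ (nbhs (t, s)) (nbhs t) (nbhs (p (t, s))) _ _ _ fst p
      (@cvg_fst _ _ (nbhs t) (nbhs s) _) hp).
  move=> U nU; apply: (@filterS _ _ (nbhs_filter (t, s)) _ _ _
    (@filterI _ _ (nbhs_filter (t, s)) _ _ near_t (h _ nU))) => r [rr Ur].
  by rewrite /= pE.
have nv := word_path_near (W_facet kk) u s.
have c2 : snd @ (t, s) --> s by exact: (@cvg_snd _ _ (nbhs t) (nbhs s)).
apply: (@filterS _ _ (nbhs_filter (t, s)) _ _ _ (c2 _ nv)) => r [v iv /= ->].
exists v; last by rewrite flw_cat flwC.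
by rewrite pE//; exact: iv.
Qed.

Lemma word_family_loops : W_loops word_family.
Proof.
split.
  move=> t tt; rewrite /word_family; case: pselect => // tt'; split.
  - exact: word_path_within.
  - exact: (word_path0 base (x0 := W_origin t) erefl).
  - exact: (word_path1 (x0 := W_origin t) erefl).
  - by move=> s _; apply: reg_Sigma; exact: word_path_reg.
exists family_path; split.
  apply: continuous_in_subspaceT => -[t s]; rewrite inE /= => -[tt _].
  by apply: family_path_continuous; rewrite /= in_itv /= in tt.
move=> t s tt s01; rewrite /word_family; case: pselect => // tt'.
exists (inset (word_pos_in (W_facet tt') u ((size u)%:R * s))), (family_point (t, s)).
exists (flw (Y := WS) (prefix_at u ((size u)%:R * s)) base); split => //.
by rewrite /family_point; case: pselect.
Qed.

Lemma word_family_holonomy t : 0 < t < t2 -> rho_t (word_family t) = mat (Y := WS) t u.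
Proof.
move=> tt; rewrite /word_family; case: pselect => // tt'.
exact: (word_path_holonomy (x0 := W_origin t) erefl).
Qed.

End WordFamily.

Lemma mat_cvg0 (u : word) : mat (Y := WS) t u @[t --> 0^'+] --> mat (Y := WS) 0 u.
Proof.
suff h : mat (Y := WS) t u @[t --> (0 : R)] --> mat (Y := WS) 0 u.
  exact: cvg_at_right_filter h.
elim: u => [|w u ih] /=; first exact: cvg_cst.
apply: (@cvg_mulmx _ _ _ (nbhs_filter (0 : R))) => //.
by apply: (@cvg_reflection _ _ _ (nbhs_filter (0 : R))); [exact: svec_gt0|exact: cvg_svec].
Qed.

Lemma near0_t2 : \forall t \near (0 : R)^'+, 0 < t < t2.
Proof.
have t20 : 0 < t2 :> R by rewrite sqrtr_gt0 invr_gt0.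
near=> t; apply/andP; split; near: t; first exact: nbhs_right_gt.
exact: nbhs_right_lt.
Unshelve. all: by end_near. Qed.

Definition limit_holonomy (g : forall t, R -> W t) : 'M[R]_5 := lim (rho_t (g t) @[t --> 0^'+]).

Lemma limit_holonomyP g (u : word) :
  (forall t, 0 < t < t2 -> rho_t (g t) = mat (Y := WS) t u) ->
  rho_t (g t) @[t --> 0^'+] --> mat (Y := WS) 0 u /\
  limit_holonomy g = mat (Y := WS) 0 u.
Proof.
move=> h; have hc : rho_t (g t) @[t --> 0^'+] --> mat (Y := WS) 0 u.
  apply: cvg_trans (@mat_cvg0 u); apply: near_eq_cvg.
  by apply: filterS near0_t2 => t /h.
by split=> //; apply: cvg_lim hc.
Qed.

Lemma mat0_isom (u : word) : IsomH4 (mat (Y := WS) 0 u).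
Proof.
elim: u => [|w u ih] /=; first exact: IsomH4_1.
by apply: IsomH4_mul => //; apply: reflection_IsomH4; exact: svec_gt0.
Qed.

End WHolonomy.

(** * The holonomy of [C] and the limit at [t = 0] *)

Section CHolonomy.
Context {R : realType}.
Local Notation base := base_copy0.
Local Notation CS := (@C_system R).
Local Notation CG := (@C_gluing R).
Local Notation CH := (@C_chamber R).
Local Notation WS := (@W_system R).
Local Notation matC := (mat (Y := CS) tt).
Local Notation word := (seq face0).

Definition C_origin : P0 := exist (fun x => x \in P0) (@origin R) P0_origin.

Lemma C_reg (p : @C R) : reg (walls (G := CG) p).
Proof. by apply: C_regular; exact: (space_H4 CH (chamber_X CH (pt p))). Qed.

Lemma C_loop_word (g : R -> @C R) : C_loops g -> exists u : R -> word,
  [/\ is_lift (Y := CS) base (fun s => st CG (g s)) 0 1 u, u 0 = [::],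
      flw (Y := CS) (u 1) base = base & rho g = matC (u 1)].
Proof.
move=> [gc g0 g1 _]; have rg s (_ : 0 <= s <= 1) := @C_reg (g s).
have [u [lu u0]] := loop_lift CH (x0 := C_origin) erefl gc g0 rg.
exists u; split => //; first exact: (lift_end CH (x0 := C_origin) erefl g1 lu).
exact: (holonomy_lift CH (x0 := C_origin) erefl gc g0 g1 rg lu u0).
Qed.

Lemma matC_isom (u : word) : IsomH3 (matC u).
Proof. exact: (mat_isom CH). Qed.

Lemma C_representation :
  representation C_loops (homotopic setT) loop_mul IsomH3 (@rho R).
Proof.
split=> [g /C_loop_word[u [_ _ _ ->]]|g h lg lh hgh|g h lg lh].
- exact: matC_isom.
- case: lg lh hgh => [gc g0 g1 _] [hc _ _ _] [K [Kc _ Kgh Kr]].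
  apply: (holonomy_homotopic CH (x0 := C_origin) erefl g0 g1 Kc Kgh Kr) => //.
  by move=> s r _ _; exact: C_reg.
case: lg lh => [gc g0 g1 _] [hc h0 h1 _].
have rr (f : R -> @C R) s (_ : 0 <= s <= 1) := @C_reg (f s).
exact: (holonomy_mul CH (x0 := C_origin) erefl g0 g1 h0 h1 (rr g) (rr h) gc hc).
Qed.

Definition face0_centre (f : letter CS) : 'cV[R]_5 := centre (face0_vec f).

Lemma C_facet : forall f : letter (sys CG),
  [/\ cone (face0_centre f), flat CH (face0_centre f),
    lorentz (vec CH f) (face0_centre f) = 0 &
    forall f', f' <> f -> lorentz (vec CH f') (face0_centre f) < 0].
Proof.
move=> f; have v0 := @face0_vec_gt0 R f; split.
- exact: centre_cone.
- by rewrite /= !mxE face0_vec_flat mulr0 addr0.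
- exact: centre_orth.
- move=> f' ne; apply: centre_lt0_npos; rewrite ?face0_time//.
  by have [[-> _]|] := @face0_product R _ _ ne => //; move/le_trans; apply; rewrite lerN10.
Qed.

Lemma C_word_loop (u : word) : flw (Y := CS) u base = base ->
  exists2 g, C_loops g & rho g = matC u.
Proof.
move=> e; exists (word_path base C_facet u).
  split=> //.
  - exact: word_path_within.
  - exact: (word_path0 base (x0 := C_origin) erefl).
  - exact: (word_path1 (x0 := C_origin) erefl).
exact: (word_path_holonomy (x0 := C_origin) erefl).
Qed.

Lemma C_image : rho @` C_loops =
  [set matC u | u in [set u : word | flw (Y := CS) u base = base]].
Proof.
rewrite eqEsubset; split=> [_ [g /C_loop_word[u [_ _ e ->]] <-]|_ [u e <-]].
  by exists (u 1).
by have [g lg <-] := C_word_loop e; exists g.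
Qed.

(* At [t = 0] all positive walls give the same reflection, in [H3]; being central
   and appearing an even number of times, it drops out. *)
Fixpoint strip (u : seq wall) : word :=
  match u with
  | [::] => [::]
  | Pos _ :: u => strip u
  | Neg i :: u => Triangle i :: strip u
  | Letter k s :: u => Quadrilateral k s :: strip u
  end.

Definition flip4 : 'M[R]_5 := reflection (svec 0 (Pos ord0)).

(** At time 0 the positive normals are plus or minus the last basis vector, and a reflection does
    not see the sign. *)
Lemma svec0_pos i : reflection (svec 0 (Pos i)) = flip4 :> 'M[R]_5.
Proof.
rewrite /flip4 /=; have -> : eps_vec2 i 0 (eps_sgn i) =
  eps_sgn i *: eps_vec2 ord0 0 (eps_sgn ord0) :> 'cV[R]_5.
  rewrite eps_vec2Z mulr0 {3}/eps_sgn expr0 mulr1 /eps_vec2.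
  by case: (eps i) (eps ord0) => [[? ?] ?] [[? ?] ?]; rewrite !mul0r.
by rewrite reflectionZ// /eps_sgn signr_eq0.
Qed.

Lemma flip4_comm f : flip4 *m reflection (face0_vec f) = reflection (face0_vec f) *m flip4.
Proof.
apply: reflection_comm; [exact: svec_gt0|exact: face0_vec_gt0|].
case: f => [i|k s] /=; first by rewrite -eps_vec2_1 lorentz_eps_vec2 mulr0 !mul0r add0r.
by rewrite lorentz_eps_letter !mul0r.
Qed.

Lemma mat0_strip (u : seq wall) : mat (Y := WS) 0 u =
  (if par (Y := WS) Defs.colP u then flip4 else 1%:M) *m matC (strip u).
Proof.
elim: u => [|[i|i|k s] u ih]; first by rewrite /= mul1mx.
- have -> : par (Y := WS) Defs.colP (Pos i :: u) = ~~ par (Y := WS) Defs.colP u.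
    by rewrite /= asboolT.
  rewrite /= svec0_pos ih mulmxA; congr (_ *m _).
  by case: ifP => _ /=; rewrite ?mulmx1 ?reflectionK// svec_gt0.
- have -> : par (Y := WS) Defs.colP (Neg i :: u) = par (Y := WS) Defs.colP u.
    by rewrite /= asboolF.
  have -> : mat (Y := WS) 0 (Neg i :: u) = reflection (face0_vec (Triangle i)) *m mat (Y := WS) 0 u.
    by rewrite face0_vecE.
  rewrite ih !mulmxA; case: ifP => _; last by rewrite mulmx1 mul1mx.
  by rewrite -flip4_comm -mulmxA.
have -> : par (Y := WS) Defs.colP (Letter k s :: u) = par (Y := WS) Defs.colP u.
  by rewrite /= asboolF.
have -> : mat (Y := WS) 0 (Letter k s :: u) =
    reflection (face0_vec (Quadrilateral k s)) *m mat (Y := WS) 0 u by [].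
rewrite ih !mulmxA; case: ifP => _; last by rewrite mulmx1 mul1mx.
by rewrite -flip4_comm -mulmxA.
Qed.

Lemma par_strip k (u : seq wall) : k <> Defs.colP ->
  par (Y := CS) k (strip u) = par (Y := WS) k u.
Proof.
move=> kP; elim: u => [//|[i|i|l s] u ih] /=; rewrite ih//.
by rewrite asboolF// => /esym.
Qed.

Lemma par_colP (u : word) : par (Y := CS) Defs.colP u = false.
Proof. by elim: u => [//|[i|k s] u ih] /=; rewrite ih asboolF. Qed.

Lemma par_face0_wall k (u : word) : par (Y := WS) k (map face0_wall u) = par (Y := CS) k u.
Proof. by elim: u => [//|[i|l s] u ih] /=; rewrite ih. Qed.

Lemma mat0_face0_wall (u : word) : mat (Y := WS) 0 (map face0_wall u) = matC u.
Proof. by elim: u => [//|f u ih] /=; rewrite ih -face0_vecE. Qed.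

(** Stripping the positive letters keeps the other two parities, so words returning to the base copy
    go to such words. In the other direction, a word of faces is read as a word of negative and
    letter walls. *)
Lemma limit_image :
  [set mat (Y := WS) 0 u | u in [set u : seq wall | flw (Y := WS) u base_copy = base_copy]] =
  rho @` @C_loops R.
Proof.
rewrite C_image eqEsubset; split=> [_ [u /flw_par0 e <-]|_ [u /flw_par0 e <-]].
  exists (strip u); last by rewrite mat0_strip e mul1mx.
  apply/flw_par0 => k.
  by have [->|kP] := pselect (k = Defs.colP); rewrite ?par_colP// par_strip.
exists (map face0_wall u); last exact: mat0_face0_wall.
by apply/flw_par0 => k; rewrite par_face0_wall.
Qed.

End CHolonomy.

(** * The tessellation of [H^3] *)

Section PingPong.
Context {R : realType}.
Local Notation CS := (@C_system R).
Local Notation CG := (@C_gluing R).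
Local Notation matC := (mat (Y := CS) tt).
Local Notation word := (seq face0).
Local Notation eqv := (equiv (Y := CS)).
Local Notation fv := (@face0_vec R).
Implicit Types (u : word) (s t : face0).

(** Minimality is taken among words with the same matrix and parities, so no presentation of the
    reflection group has to be known. *)
Definition reduced u := forall u', eqv u' u -> (size u <= size u')%N.

Lemma reduced_exists u : exists2 u', eqv u' u & reduced u'.
Proof.
move: {2}(size u) (leqnn (size u)) => n; elim: n u => [|n ih] u un.
  by exists u => // u' _; move: un; rewrite leqn0 => /eqP ->.
have [ru|] := pselect (reduced u); first by exists u.
move=> /existsNP[u' /not_implyP[e /negP]]; rewrite -ltnNge => lt.
have [|v ev rv] := ih u'; first by rewrite -ltnS (leq_trans lt).
by exists v => //; exact: equiv_trans e.
Qed.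

Lemma reduced_equiv u u' : eqv u u' -> size u = size u' -> reduced u -> reduced u'.
Proof. by move=> e s ru v ev; rewrite -s; apply: ru; exact: equiv_trans (equiv_sym e). Qed.

Lemma equiv_cons s u u' : eqv u u' -> eqv (s :: u) (s :: u').
Proof. by move=> e; rewrite -(cat1s s u) -(cat1s s u'); exact: equiv_cat. Qed.

Lemma equiv_consK s u : eqv (s :: s :: u) u.
Proof.
split=> k /=; first by rewrite mulmxA reflectionK ?mul1mx// face0_vec_gt0.
by rewrite addbA addbb.
Qed.

Lemma reduced_behead s u : reduced (s :: u) -> reduced u.
Proof. by move=> ru u' /(equiv_cons s)/ru. Qed.

Lemma size_parity u : odd (size u) = par (Y := CS) colN u (+) par (Y := CS) colL u.
Proof.
elim: u => [//|[i|k s] u ih] /=; rewrite ih.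
  by rewrite asboolT// asboolF//; case: par; case: par.
by rewrite asboolF// asboolT//; case: par; case: par.
Qed.

(** Equivalent words have lengths of the same parity, so a shortening of [s :: u] is by at least two
    letters, and by minimality of [u] by exactly two: up to equivalence [u] begins with [s]. *)
Lemma descent s u : reduced u -> ~ reduced (s :: u) ->
  exists2 u', eqv u (s :: u') & size u = (size u').+1.
Proof.
move=> ru /existsNP[u' /not_implyP[e /negP]]; rewrite -ltnNge /= ltnS => le.
have e' : eqv u (s :: u').
  by apply: equiv_trans (equiv_sym (equiv_consK s u)) _; apply: equiv_cons; exact: equiv_sym.
exists u' => //; have := ru _ (equiv_sym e'); rewrite /= => le'.
have : odd (size u) = odd (size (s :: u')).
  by rewrite !size_parity !e'.2.
rewrite /=; move: le; rewrite leq_eqVlt => /orP[/eqP ->|]; first by case: odd.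
by move=> lt _; apply/eqP; rewrite eqn_leq le' lt.
Qed.

Lemma reflect_coord s t (y : 'cV[R]_5) :
  lorentz (fv s) (reflection (fv t) *m y) = lorentz (fv s) y -
    2 * lorentz (fv s) (fv t) * lorentz (fv t) y.
Proof. by rewrite reflectionE face0_vec_self divr1 lorentzDr lorentzNr lorentzZr; ring. Qed.

Lemma reflect_coord_self s (y : 'cV[R]_5) :
  lorentz (fv s) (reflection (fv s) *m y) = - lorentz (fv s) y.
Proof. by rewrite reflect_coord face0_vec_self; ring. Qed.

Variable x : 'cV[R]_5.
Hypothesis Px : P0 x.

(* For a reduced word [s :: u], the polytope [u P0] lies on the same side of the
   wall [s] as [P0]; for disjoint walls [s] and [t] with [u] starting with [t], it
   lies moreover at least as far from [s] as from [t]. *)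
Lemma ping_pong n u : (size u <= n)%N -> reduced u ->
  (forall s, reduced (s :: u) -> lorentz (fv s) (matC u *m x) <= 0) /\
  (forall s t u1, eqv u (t :: u1) -> size u = (size u1).+1 -> reduced (s :: u) ->
     lorentz (fv s) (fv t) <= -1 ->
     lorentz (fv t) (matC u *m x) <= - lorentz (fv s) (matC u *m x)).
Proof.
elim: n u => [|n ih] u.
  rewrite leqn0 => /eqP/size0nil -> _; split=> [s _|//].
  by rewrite /= mul1mx; case: Px => _; exact.
move=> un ru.
have claim2 s t u1 : eqv u (t :: u1) -> size u = (size u1).+1 -> reduced (s :: u) ->
     lorentz (fv s) (fv t) <= -1 ->
     0 <= lorentz (fv t) (matC u *m x) <= - lorentz (fv s) (matC u *m x).
  move=> e su rsu st.
  have rtu : reduced (t :: u1) by exact: reduced_equiv ru.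
  have ru1 := reduced_behead rtu.
  have u1n : (size u1 <= n)%N by rewrite -ltnS -su.
  have [c1 c2] := ih u1 u1n ru1.
  rewrite e.1 /= -mulmxA reflect_coord_self reflect_coord.
  set b := lorentz (fv t) (matC u1 *m x).
  have b0 : b <= 0 by exact: c1.
  set a := lorentz (fv s) (matC u1 *m x).
  (* The new coordinate along [s] is [a - 2 <s,t> b]. As [<s,t> <= -1] and [b <= 0], it is at most
     [a + 2 b], hence at most [b] once [a <= - b]. *)
  suff : a <= - b by rewrite oppr_ge0 b0 /=; nra.
  have [rs|nrs] := pselect (reduced (s :: u1)).
    by apply: (@le_trans _ _ 0); [exact: c1|rewrite oppr_ge0].
  (* Now [u1] itself begins with [s], and the second induction hypothesis applies with the roles of
     [s] and [t] exchanged. *)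
  have [u2 e2 su2] := descent ru1 nrs.
  by apply: (c2 t s u2) => //; rewrite lorentzC.
split; last by move=> s t u1 e su rsu st; have /andP[] := claim2 s t u1 e su rsu st.
move=> s rsu; case: u un ru rsu claim2 => [|t u1] un ru rsu claim2.
  by rewrite /= mul1mx; case: Px => _; exact.
have [st|st] := pselect (s = t).
  subst s; have := rsu u1 (equiv_sym (equiv_consK t u1)).
  by rewrite /= ltnNge leqnSn.
have [[st0 _]|le] := @face0_product R _ _ st.
  (* Orthogonal faces: the reflections commute, so [s :: u1] is reduced, and reflecting in [t]
     leaves the coordinate along [s] unchanged. *)
  have e : eqv (s :: t :: u1) (t :: s :: u1).
    split=> k /=; last by rewrite !addbA [_ (+) `[< face0_colour t = k >]]addbC.
    rewrite !mulmxA reflection_comm//; exact: face0_vec_gt0.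
  have rs1 : reduced (s :: u1) := reduced_behead (reduced_equiv e erefl rsu).
  have [c1 _] := ih u1 un (reduced_behead ru).
  rewrite /= -mulmxA reflect_coord st0 mulr0 mul0r subr0; exact: c1.
have := claim2 s t u1 (equiv_refl _) erefl rsu le => /andP[h1 h2].
by rewrite -oppr_ge0 (le_trans h1).
Qed.

Lemma fundamental u (x' : 'cV[R]_5) : P0 x' -> matC u *m x = x' ->
  x = x' /\ exists2 v, words_in (on (g := CG) x) v &
    forall k, par (Y := CS) k u = par (Y := CS) k v.
Proof.
have [u' e ru'] := reduced_exists u; rewrite -e.1 => Px' ux.
suff h : x = x' /\ exists2 v, words_in (on (g := CG) x) v &
    forall k, par (Y := CS) k u' = par (Y := CS) k v.
  by have [xx [v iv vE]] := h; split => //; exists v => // k; rewrite -e.2.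
move: ru' ux {e}; elim: u' => [|s u1 ih] ru ux.
  by rewrite /= mul1mx in ux; split => //; exists [::].
have ru1 := reduced_behead ru.
have [c1 _] := ping_pong (leqnn _) ru1.
have h1 := c1 s ru.
have h2 : lorentz (fv s) x' <= 0 by case: Px' => _; exact.
have h3 : lorentz (fv s) x' = - lorentz (fv s) (matC u1 *m x).
  by rewrite -ux /= -mulmxA reflect_coord_self.
have s0 : lorentz (fv s) x' = 0 by lra.
have ux1 : matC u1 *m x = x'.
  rewrite -[LHS]mul1mx -(reflectionK (@face0_vec_gt0 R s)) -mulmxA.
  by have := ux; rewrite /= -mulmxA => ->; rewrite reflection_id.
have [xx [v iv vE]] := ih ru1 ux1; split => //; exists (s :: v).
  by split => //; rewrite /= xx.
by move=> k /=; rewrite vE.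
Qed.

End PingPong.

(** * An invariant lattice, lowest points and discreteness *)

Section Integrality.
Context {R : realType}.
Local Notation CS := (@C_system R).
Local Notation CG := (@C_gluing R).
Local Notation CH := (@C_chamber R).
Local Notation matC := (mat (Y := CS) tt).
Local Notation word := (seq face0).
Local Notation fv := (@face0_vec R).
Implicit Types (u : word) (f : face0) (p y : 'cV[R]_5).

(* The lattice generated by the basis [e_0, e_i / sqrt 2] is preserved by the
   reflections in the faces of the cuboctahedron. *)
Definition lattice p := p ord0 0 \is a Num.int /\
  forall i, i != ord0 -> Num.sqrt 2 * p i 0 \is a Num.int.

Lemma lorentz_lattice (a b : 'cV[R]_5) (c : R) :
  c * (a ord0 0 * b ord0 0) \is a Num.int ->
  (forall i, i != ord0 -> c * (a i 0 * b i 0) \is a Num.int) -> c * lorentz a b \is a Num.int.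
Proof.
move=> h0 h; rewrite /lorentz mulrDr mulrN rpredD ?rpredN// mulr_sumr.
by apply: rpred_sum => i _; apply: h.
Qed.

Lemma eps_int (i : 'I_8) (b : R) (k : 'I_5) : k != ord0 -> b \is a Num.int ->
  eps_vec i b k 0 \is a Num.int.
Proof.
rewrite -val_eqE => k0 bi; have h1 : (1 : R) \is a Num.int by exact: rpred1.
have hN1 : (-1 : R) \is a Num.int by rewrite rpredN.
rewrite /eps_vec /eps; case: i => -[|[|[|[|[|[|[|[|//]]]]]]]] lti /=; rewrite mxE;
  by case: k k0 => -[|[|[|[|[|//]]]]] ltk //= _.
Qed.

Lemma letter_int (k : 'I_3) (s : bool) (i : 'I_5) : i != ord0 ->
  exists2 c : R, c \is a Num.int & letter_vec k s i 0 = Num.sqrt 2 * c.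
Proof.
rewrite -val_eqE => i0; have h1 : ((-1) ^+ s : R) \is a Num.int by rewrite rpredX// rpredN rpred1.
have h0 : (0 : R) \is a Num.int by exact: rpred0.
have z : 0 = Num.sqrt 2 * 0 :> R by rewrite mulr0.
have m : (-1) ^+ s * Num.sqrt 2 = Num.sqrt 2 * (-1) ^+ s :> R by rewrite mulrC.
rewrite /letter_vec mxE.
case: i i0 => -[|[|[|[|[|//]]]]] lti //= _; case: k => -[|[|[|//]]] ltk /=;
  rewrite ?mulr0n ?mulr1n; by [exists 0 | exists ((-1) ^+ s)].
Qed.

Lemma reflection_lattice f p : lattice p -> lattice (reflection (fv f) *m p).
Proof.
move=> [p0 pi]; have h22 := @sqrt2_sq R; have h2 : (2 : R) \is a Num.int by exact: rpred_nat.
have rE k : (reflection (fv f) *m p) k 0 = p k 0 - 2 * lorentz (fv f) p * fv f k 0.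
  by rewrite reflectionE face0_vec_self divr1 !mxE.
case: f rE => [i|l s] rE.
- have eI k : k != ord0 -> fv (Triangle i) k 0 \is a Num.int.
    by move=> k0; apply: eps_int => //; exact: rpred0.
  have e0 : fv (Triangle i) ord0 0 = Num.sqrt 2.
    by rewrite /= -eps_vec2_1 eps_vec20 mul1r.
  have li : Num.sqrt 2 * lorentz (fv (Triangle i)) p \is a Num.int.
    apply: lorentz_lattice; first by rewrite e0 mulrA h22 rpredM.
    move=> k k0; rewrite mulrCA rpredM//; [exact: eI|exact: pi].
  split; first by rewrite rE e0 -mulrA [lorentz _ _ * _]mulrC rpredB// rpredM.
  move=> k k0; rewrite rE mulrBr rpredB//; first exact: pi.
  set L := lorentz _ p in li *; set c := fv _ k 0.
  have -> : Num.sqrt 2 * (2 * L * c) = 2 * (Num.sqrt 2 * L) * c by ring.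
  by apply: rpredM; [exact: rpredM|exact: eI].
have e0 : fv (Quadrilateral l s) ord0 0 = 1 by exact: letter_vec0.
have li : lorentz (fv (Quadrilateral l s)) p \is a Num.int.
  rewrite -[lorentz _ _]mul1r; apply: lorentz_lattice; first by rewrite e0 !mul1r.
  move=> k k0; have [c ci ->] := letter_int l s k0.
  by rewrite mul1r mulrAC mulrC rpredM//; exact: pi.
split; first by rewrite rE e0 mulr1 rpredB// rpredM.
move=> k k0; rewrite rE mulrBr rpredB//; first exact: pi.
have [c ci e] := letter_int l s k0; rewrite [fv _ _ _]e.
set L := lorentz _ p in li *.
have -> : Num.sqrt 2 * (2 * L * (Num.sqrt 2 * c)) = Num.sqrt 2 * Num.sqrt 2 * (2 * L * c) by ring.
by rewrite h22; apply: rpredM => //; apply: rpredM => //; exact: rpredM.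
Qed.

Lemma matC_lattice u p : lattice p -> lattice (matC u *m p).
Proof.
move=> lp; elim: u => [|f u ih] /=; first by rewrite mul1mx.
by rewrite -mulmxA; exact: reflection_lattice.
Qed.

Lemma int_code (N : nat) (r : R) : r \is a Num.int -> `|r| <= N%:R ->
  exists k : 'I_(N + N).+1, r = k%:R - N%:R.
Proof.
move=> ri; rewrite ler_norml => /andP[r1 r2].
have : r + N%:R \is a Num.nat.
  by rewrite natrEint rpredD ?rpred_nat//= -lerBlDr sub0r.
move=> /natrP[m mE].
have mN : (m <= N + N)%N by rewrite -(ler_nat R) -mE natrD lerD2r.
by exists (inord m); rewrite inordK// -mE addrK.
Qed.

Lemma lattice_origin : lattice (@origin R).
Proof.
split; first by rewrite mxE rpred1.
by case=> -[|[|[|[|[|//]]]]] lti; rewrite -val_eqE //= => _; rewrite mxE /= mulr0 rpred0.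
Qed.

(** Transfers the orbit of an arbitrary [y] to the orbit of the origin, which consists of lattice
    points. *)
Lemma height_orbit u y : (matC u *m y) ord0 0 = - lorentz (matC (rev u) *m origin) y.
Proof.
rewrite -[LHS]opprK -lorentz_originr -(mat_lorentz CH (rev u)) mulmxA mat_revl mul1mx.
by rewrite lorentzC.
Qed.

Lemma coord_le p i : lorentz p p = -1 -> (p i 0) ^+ 2 <= (p ord0 0) ^+ 2.
Proof.
rewrite /lorentz => h; case: (unliftP ord0 i) => [k ->|->//].
have : p (lift ord0 k) 0 * p (lift ord0 k) 0 <=
    \sum_(i < 4) p (lift ord0 i) 0 * p (lift ord0 i) 0.
  rewrite (bigD1 k)//= lerDl; apply: sumr_ge0 => l _.
  by rewrite -expr2 sqr_ge0.
rewrite !expr2; lra.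
Qed.

(* The orbit of the origin is contained in a lattice, so that the heights of the
   points of an orbit attain their minimum. *)
Lemma lowest_point y : H3 y ->
  exists u, forall u', (matC u *m y) ord0 0 <= (matC u' *m y) ord0 0.
Proof.
move=> [hy _]; have [yy y0] := hy.
(* Relevant orbit points of the origin have height at most [2 K^2], and their integral coordinates
   involve a factor [sqrt 2 <= 2]; whence the bound [4 K^2]. *)
pose K := y ord0 0; pose N := (Num.bound (4 * K ^+ 2)).
pose vecof (c : {ffun 'I_5 -> 'I_(N + N).+1}) : 'cV[R]_5 :=
  \col_i (if i == ord0 then (c i)%:R - N%:R else ((c i)%:R - N%:R) / Num.sqrt 2).
pose F c := - lorentz (vecof c) y.
pose Q c := `[< exists u, matC (rev u) *m origin = vecof c >].
have s0 := @sqrt2_gt0 R; have s22 := @sqrt2_sq R.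
have code u : (matC u *m y) ord0 0 <= K -> exists c, matC (rev u) *m origin = vecof c.
  rewrite height_orbit; set p := matC (rev u) *m origin => hK.
  have Hp : H4 p by apply: (space_H4 CH); apply: (mat_space CH); exact: H3_origin.
  have [pp p0] := Hp; have lp : lattice p by exact/matC_lattice/lattice_origin.
  (* From [lorentz_pair_ge0], using that [- lorentz p y] is the height of the orbit point of [y],
     assumed to be at most [K]. *)
  have pK : p ord0 0 <= 2 * K ^+ 2.
    have := lorentz_pair_ge0 p y; rewrite pp yy -/K => h.
    have : p ord0 0 * p ord0 0 <= p ord0 0 * (2 * K * - lorentz p y).
      have := sqr_ge0 K; nra.
    rewrite ler_pM2l// => h2; apply: (le_trans h2).
    by rewrite expr2 mulrA ler_pM2l// mulr_gt0.
  have KN : 4 * K ^+ 2 < N%:R.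
    by rewrite /N; apply: archi_boundP; rewrite mulr_ge0// sqr_ge0.
  have K0 := sqr_ge0 K.
  have /choice[c hc] : forall i, exists k : 'I_(N + N).+1,
      p i 0 = if i == ord0 then k%:R - N%:R else (k%:R - N%:R) / Num.sqrt 2.
    move=> i; have [->|i0] := eqVneq i ord0.
      by apply: int_code; [exact: lp.1|rewrite gtr0_norm//; lra].
    have [||k kE] := @int_code N (Num.sqrt 2 * p i 0).
    - exact: lp.2.
    - have h1 := coord_le i pp; rewrite normrM gtr0_norm//.
      have : `|p i 0| <= p ord0 0.
        by rewrite -[leRHS]gtr0_norm// -ler_sqr ?nnegrE ?normr_ge0// !real_normK ?num_real.
      have : Num.sqrt 2 <= 2 :> R by nra.
      have := normr_ge0 (p i 0); nra.
    by exists k; rewrite -kE mulrAC mulfV ?mul1r// gt_eqF.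
  exists [ffun i => c i]; apply/matrixP => i j; rewrite ord1 [RHS]mxE hc.
  by case: ifP => _; rewrite ffunE.
have [|c0 c0E] := code [::]; first by rewrite /= mul1mx.
have Qc0 : Q c0 by apply/asboolP; exists [::].
have [c Qc cmin] := arg_minP F Qc0.
have [u uE] := asboolP _ Qc; exists u => u'.
have hE v d : matC (rev v) *m origin = vecof d -> (matC v *m y) ord0 0 = F d.
  by move=> e; rewrite height_orbit e.
rewrite (hE u c uE); have [le|/ltW lt] := leP ((matC u' *m y) ord0 0) K.
  have [c' c'E] := code u' le; rewrite (hE u' c' c'E); apply: cmin.
  by apply/asboolP; exists u'.
apply: le_trans lt; have := cmin c0 Qc0; rewrite -(hE [::] c0 c0E).
by rewrite /= mul1mx.
Qed.

(** A lowest point [z] of the orbit lies in [P_0]: reflecting it in a face changes the height by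
    [- 2 <f,z> f_0], and since [f_0 > 0] this is nonnegative only if [<f,z> <= 0]. *)
Lemma tessellation_cover y : H3 y -> exists u (x : @P0 R), y = matC u *m val x.
Proof.
move=> hy; have [u umin] := lowest_point hy.
have Xx : H3 (matC u *m y) by exact: (mat_space CH).
have Px : P0 (matC u *m y).
  split=> // f; have := umin (f :: u); rewrite /= -mulmxA reflectionE.
  set z := matC u *m y; rewrite face0_vec_self divr1.
  have -> : (z - (2 * lorentz (fv f) z) *: fv f) ord0 0 =
      z ord0 0 - (2 * lorentz (fv f) z) * fv f ord0 0 by rewrite !mxE.
  rewrite lerDl oppr_ge0 -mulrA pmulr_rle0//.
  by rewrite pmulr_lle0// face0_time.
by exists (rev u), (inset Px); rewrite /= mulmxA mat_revl mul1mx.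
Qed.

Lemma tessellation_unique u u' (x x' : @P0 R) : matC u *m val x = matC u' *m val x' ->
  x = x' /\ @cell _ _ (@P0 R) (@glued_along0 R) (flw (Y := CS) u base_copy0) x =
            cell (flw (Y := CS) u' base_copy0) x'.
Proof.
move=> e; have Px : P0 (val x) := set_valP x; have Px' : P0 (val x') := set_valP x'.
have [|/val_inj xx [v iv vE]] := fundamental (u := rev u' ++ u) Px Px'.
  by rewrite mat_cat -mulmxA e mulmxA mat_revl mul1mx.
subst x'; split => //; apply/(cellP CG); split => //; exists v => //.
rewrite -flw_cat; apply/flw_par => k; rewrite par_cat -vE par_cat par_rev.
by rewrite -addbA addbb addbF.
Qed.

Lemma int_small (r : R) : r \is a Num.int -> `|r| < 1 -> r = 0.
Proof.
move=> ri r1; apply/eqP; apply: contraTT r1 => r0.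
by rewrite -leNgt; exact: norm_intr_ge1.
Qed.

(** Applied to the lattice basis, the matrices have entries that are integral after multiplication
    by 1, [sqrt 2] or its inverse. A difference below [2^-1] stays below 1 after each of these
    scalings, hence vanishes. *)
Lemma matC_discrete u u' :
  (forall i j, `|matC u i j - matC u' i j| < 2^-1) -> matC u = matC u'.
Proof.
move=> h; have s0 := @sqrt2_gt0 R; have s22 := @sqrt2_sq R.
have s1 : 1 < Num.sqrt 2 :> R by nra.
have s2 : Num.sqrt 2 < 2 :> R by nra.
pose e (j : 'I_5) : 'cV[R]_5 := delta_mx j 0.
have col_e (A : 'M[R]_5) j i : (A *m e j) i 0 = A i j by rewrite -colE mxE.
have eq0 i : matC u i ord0 = matC u' i ord0.
  apply/eqP; rewrite -subr_eq0; apply/eqP.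
  have le : lattice (e ord0).
    split=> [|k k0]; first by rewrite /e mxE rpred_nat.
    by rewrite /e mxE (negPf k0) mulr0 rpred0.
  have [l0 l1] := matC_lattice u le; have [m0 m1] := matC_lattice u' le.
  have [->|i0] := eqVneq i ord0.
    apply: int_small; first by rewrite -!col_e rpredB.
    by apply: lt_trans (h _ _) _; rewrite invf_lt1// ltr1n.
  apply: (mulfI (lt0r_neq0 s0)); rewrite mulr0; apply: int_small.
    by rewrite mulrBr -!col_e rpredB//; [exact: l1|exact: m1].
  by rewrite normrM gtr0_norm//; have := h i ord0; nra.
apply/matrixP => i j; have [->//|j0] := eqVneq j ord0.
have [->|j4] := eqVneq j ord_max.
  have fix4 w : matC w *m e ord_max = e ord_max.
    elim: w => [|f w ih] /=; first by rewrite mul1mx.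
    rewrite -mulmxA ih; apply: reflection_id.
    rewrite lorentzC /lorentz mxE /= mul0r oppr0 add0r big1// => k _.
    have [kE|kN] := eqVneq (lift ord0 k) ord_max; first by rewrite kE face0_vec_flat mulr0.
    by rewrite mxE (negPf kN) mul0r.
  by rewrite -!col_e !fix4.
pose z := (Num.sqrt 2)^-1 *: e j.
have lz : lattice z.
  have sn : Num.sqrt 2 != 0 :> R by rewrite gt_eqF.
  split=> [|k k0]; rewrite /z mxE /e mxE; first by rewrite eq_sym (negPf j0) mulr0 rpred0.
  by rewrite mulVKf// rpred_nat.
have zE (A : 'M[R]_5) : (A *m z) i 0 = (Num.sqrt 2)^-1 * A i j.
  by rewrite /z -scalemxAr mxE col_e.
have [l0 l1] := matC_lattice u lz; have [m0 m1] := matC_lattice u' lz.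
have [iE|i0] := eqVneq i ord0.
  have si : (Num.sqrt 2)^-1 < 1 :> R by rewrite invf_lt1.
  have si0 : 0 < (Num.sqrt 2)^-1 :> R by rewrite invr_gt0.
  apply/eqP; rewrite -subr_eq0; apply/eqP.
  apply: (mulfI (lt0r_neq0 si0)); rewrite mulr0; apply: int_small.
    by rewrite mulrBr -!zE iE rpredB.
  by rewrite normrM gtr0_norm//; have := h i j; have := normr_ge0 (matC u i j - matC u' i j); nra.
apply/eqP; rewrite -subr_eq0; apply/eqP; apply: int_small.
  have := rpredB (l1 i i0) (m1 i i0); rewrite !zE !mulVKf//; exact: lt0r_neq0.
by apply: lt_trans (h _ _) _; rewrite invf_lt1// ltr1n.
Qed.

Lemma C_discrete : discrete_image C_loops (@rho R).
Proof.
rewrite /discrete_image C_image => _ [u eu <-]; split.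
  by rewrite inE; exists u.
exists (ball (matC u) 2^-1); first by apply: nbhsx_ballx; rewrite invr_gt0.
rewrite eqEsubset; split=> [A [b [u' eu' uE]]|_ ->].
  case: b => _ b; rewrite -uE /=; apply/esym; apply: matC_discrete => i j.
  by have := b i j; rewrite /ball /= -uE.
by split; [apply: ballxx; rewrite invr_gt0|exists u].
Qed.

End Integrality.

(** * Faithfulness and discreteness *)

Section Faithfulness.
Context {R : realType}.
Local Notation CS := (@C_system R).
Local Notation CG := (@C_gluing R).
Local Notation CH := (@C_chamber R).
Local Notation matC := (mat (Y := CS) tt).
Local Notation word := (seq face0).
Local Notation base := base_copy0.
Local Notation M := (@C R).
Local Notation cellC := (@cell _ _ (@P0 R) (@glued_along0 R)).
Implicit Types (y z : 'cV[R]_5) (u : word).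

(** A total function: the value at a point of [H3] is independent of the chosen tile by
    [tessellation_unique], and [C_base] is the default elsewhere. *)
Definition covering y : M :=
  if pselect (exists p : word * @P0 R, y = matC p.1 *m val p.2) is left h
  then cellC (flw (Y := CS) (projT1 (cid h)).1 base) (projT1 (cid h)).2 else C_base.

Lemma coveringE u (x : @P0 R) : covering (matC u *m val x) = cellC (flw (Y := CS) u base) x.
Proof.
rewrite /covering; case: pselect => [h|[]]; last by exists (u, x).
by case: cid => -[u' x'] /= e; have [_ ->] := tessellation_unique e.
Qed.

(** Continuity across tiles: around a point of [P_0] the neighbouring tiles are obtained by folding
    in the walls through it, and the gluing follows the same words. *)
Lemma covering_near y (U : set M) : H3 y -> nbhs (covering y) U ->
  \forall z \near y, H3 z -> U (covering z).
Proof.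
move=> hy; have [u [x yE]] := tessellation_cover hy; rewrite yE coveringE => nU.
have Xx := chamber_X CH x.
have rx : reg (on (g := CG) (val x)) by apply: C_regular; exact: (space_H4 CH Xx).
have sc := star_cover CH rx nU; set y' := matC u *m val x.
have e : val x = matC (rev u) *m y' by rewrite /y' mulmxA mat_revl mul1mx.
rewrite {1}e in sc.
have h := @mulmx_continuous R (matC (rev u)) y' _ sc.
apply: (@filterS _ _ (nbhs_filter y') _ _ _ h) => z /= hz Hz.
have [|v [x' [_ zE Ux']]] := hz; first exact: (mat_space CH).
have -> : z = matC (u ++ v) *m val x' by rewrite mat_cat -mulmxA -zE mulmxA mat_rev mul1mx.
by rewrite coveringE flw_cat flwC.
Qed.

Lemma lifted_path (g : R -> M) : C_loops g -> exists y : R -> 'cV[R]_5,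
  [/\ {within `[0, 1], continuous y}, forall s, 0 <= s <= 1 -> H3 (y s) /\ covering (y s) = g s,
      y 0 = origin & y 1 = rho g *m origin].
Proof.
move=> lg; have [u [lu u0 u1 ->]] := C_loop_word lg.
case: lg => gc g0 g1 _.
exists (fun s => matC (u s) *m val (pt (g s))).
have cellE s : 0 <= s <= 1 -> g s = cellC (flw (Y := CS) (u s) base) (pt (g s)).
  by move=> s01; have [v [iv ->]] := lu.1 s s01; rewrite (cell_flw (G := CG))// ptce.
split.
- apply: eps_within => s; rewrite /= in_itv /= => s01 U nU.
  have rs : reg (walls (G := CG) (g s)) by exact: C_reg.
  (* Near [s] the candidate lift is [g] followed by one fixed chart at [g s], hence continuous
     although its word and its representative may jump. *)
  have ds s' : 0 <= s' <= 1 -> adj (st CG (g s)) (u s) (st CG (g s')) (u s') ->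
      dev CH base (walls (G := CG) (g s)) (u s) (g s') = matC (u s') *m val (pt (g s')).
    move=> s01' [sub [v [iv e]]]; rewrite {1}(cellE s' s01') (equiv_flw base e) devE//.
    by rewrite e.1.
  have [V [[oV Vs] _ /subspace_continuousP dc _ _]] := star_chart CH rs (lu.1 s s01).
  have [e1 e10 he1] := lu.2 s s01.
  have dU : nbhs (dev CH base (walls (G := CG) (g s)) (u s) (g s)) U.
    by rewrite ds//; apply: nearst_adj; split => //; exists [::].
  have := dc (g s) Vs U dU => /= nVU.
  have nU' : nbhs (g s) [set p | U (dev CH base (walls (G := CG) (g s)) (u s) p)].
    have nV := open_nbhs_nbhs (conj oV Vs).
    apply: (@filterS _ _ (nbhs_filter (g s)) _ _ _ (@filterI _ _ (nbhs_filter (g s)) _ _ nVU nV)).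
    by move=> p [h Vp]; exact: h.
  have [|e2 e20 he2] := within_eps gc _ nU'; first by rewrite /= in_itv.
  exists (Num.min e1 e2); first by rewrite lt_min e10.
  move=> s'; rewrite in_itv /= lt_min => s01' /andP[se1 se2].
  rewrite -ds//; last exact: he1.
  by apply: he2 => //; rewrite /= in_itv.
- move=> s s01; split; last by rewrite coveringE -cellE.
  by apply: (mat_space CH); exact: (chamber_X CH).
- by rewrite u0 g0 mul1mx (pt_cell CG).
- by rewrite g1 (pt_cell CG).
Qed.

Lemma segment_H3 y z (r : R) : H3 y -> H3 z -> 0 <= r <= 1 ->
  cone ((1 - r) *: y + r *: z) /\ H3 (nrm ((1 - r) *: y + r *: z)).
Proof.
move=> [hy y4] [hz z4] /andP[r0 r1].
have c : cone ((1 - r) *: y + r *: z).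
  have [->|rn] := eqVneq r 0; first by rewrite subr0 scale1r scale0r addr0; exact: H4_cone.
  have cz : cone (r *: z) by apply: coneZ; [rewrite lt0r rn|exact: H4_cone].
  have [->|rn1] := eqVneq r 1; first by rewrite subrr scale0r add0r scale1r; exact: H4_cone.
  by apply: coneD => //; apply: coneZ; [rewrite subr_gt0 lt_neqAle rn1|exact: H4_cone].
split=> //; split; first exact: nrm_H4.
by rewrite /nrm /= !mxE y4 z4 !mulr0 addr0 mulr0.
Qed.

Lemma C_faithful : faithful C_loops (homotopic setT) (@rho R).
Proof.
move=> g h lg lh gh.
have [y [yc yP y0 y1]] := lifted_path lg; have [z [zc zP z0 z1]] := lifted_path lh.
rewrite -gh in z1.
have z01 : 0 <= (0 : R) <= 1 by rewrite lexx ler01.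
have o01 : 0 <= (1 : R) <= 1 by rewrite lexx ler01.
(* Equal holonomies give the two lifts the same end points. The normalized chords between the lifts
   are geodesics, and projecting them to [C] yields a homotopy that fixes the ends. *)
pose m (k : R * R) := (1 - k.2) *: y k.1 + k.2 *: z k.1.
exists (covering \o (@nrm R) \o m); split.
- apply/subspace_continuousP => -[s r] /= [s01 r01] U nU.
  have {}s01 : 0 <= s <= 1 by move: s01; rewrite /= in_itv.
  have {}r01 : 0 <= r <= 1 by move: r01; rewrite /= in_itv.
  have [cm hm] := segment_H3 (yP s s01).1 (zP s s01).1 r01.
  have n1 := covering_near hm nU.
  set A := `[0, 1] `*` `[0, 1]; pose F := within A (nbhs (s, r)).
  have FF : Filter F by exact: within_filter.
  have fstF : fst @ F --> within `[0, 1] (nbhs s).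
    move=> B nB; have : nbhs (s, r) [set k | `[0, 1]%classic k.1 -> B k.1].
      exact: (@cvg_fst _ _ (nbhs s) (nbhs r) _ _ nB).
    move=> nb; rewrite /F /within /=.
    apply: (@filterS _ _ (nbhs_filter (s, r)) _ _ _ nb) => k hk [k1 _]; exact: hk.
  have s01' : `[0, 1]%classic s by rewrite /= in_itv.
  have yF : (y \o fst) @ F --> y s.
    apply: (cvg_comp _ _ fstF); move/subspace_continuousP: yc => yc; exact: yc.
  have zF : (z \o fst) @ F --> z s.
    apply: (cvg_comp _ _ fstF); move/subspace_continuousP: zc => zc; exact: zc.
  have rF : snd @ F --> r.
    apply: cvg_within_filter; exact: (@cvg_snd _ _ (nbhs s) (nbhs r)).
  have mF : m @ F --> m (s, r).
    apply: (@cvgD _ _ _ F FF); apply: (@cvgZ _ _ _ F FF) => //.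
    by apply: (@cvgB _ _ _ F FF) => //; exact: cvg_cst.
  have nF : (@nrm R \o m) @ F --> nrm (m (s, r)) by exact: (@cvg_nrm _ _ _ FF).
  have A1 : F A by exact: withinT.
  apply: (@filterS _ _ FF _ _ _ (@filterI _ _ FF _ _ (nF _ n1) A1)) => -[s' r'] [hU] /= [].
  rewrite /= !in_itv /= => s01'' r01''; apply: hU.
  by have [] := segment_H3 (yP s' s01'').1 (zP s' s01'').1 r01''.
- by [].
- move=> s; rewrite in_itv /= => s01; have [hy ys] := yP s s01; have [hz zs] := zP s s01.
  rewrite /= /m /= subr0 scale1r scale0r addr0 subrr scale0r add0r scale1r.
  by rewrite !nrm_id ?ys ?zs//; [case: hz|case: hy].
move=> r _; have [hy0 ys0] := yP 0 z01; have [hy1 ys1] := yP 1 o01.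
rewrite /= /m /= z0 z1 -y1 -y0 -!scalerDl subrK !scale1r.
by rewrite !nrm_id ?ys0 ?ys1//; [case: hy1|case: hy0].
Qed.

End Faithfulness.

Theorem proposition4p14 (R : realType) :
  exists rho0 : (forall t : R, R -> W t) -> 'M[R]_5,
    [/\ representation W_loops W_homotopic W_mul IsomH4 rho0,
        (forall g, W_loops g -> rho_t (g t) @[t --> 0^'+] --> rho0 g),
        rho0 @` W_loops = rho @` C_loops,
        representation C_loops (homotopic setT) loop_mul IsomH3 (@rho R) /\
        faithful C_loops (homotopic setT) (@rho R)
      & discrete_image C_loops (@rho R)].
Proof.
have word g : W_loops g -> exists u, [/\ flw (Y := @W_system R) u base_copy = base_copy,
    forall t, 0 < t < t2 -> rho_t (g t) = mat (Y := @W_system R) t u &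
    limit_holonomy g = mat (Y := @W_system R) 0 u].
  by move=> /W_family_word[u e h]; exists u; split=> //; have [] := limit_holonomyP h.
exists limit_holonomy; split; last exact: C_discrete.
- split=> [g /word[u [_ _ ->]]|g h lg lh gh|g h lg lh].
  + exact: mat0_isom.
  + have [u [_ hu _]] := word g lg; have [v [_ hv ->]] := word h lh.
    (* The word of [h] also represents [g], because the holonomies agree at each [t]; the two limits
       are then the value of one word at 0. *)
    apply: (limit_holonomyP _).2 => t tt; rewrite -hv//.
    by apply: W_homotopic_holonomy (gh t tt) => //; [exact: lg.1|exact: lh.1].
  + have [u [_ hu ->]] := word g lg; have [v [_ hv ->]] := word h lh.
    rewrite -mat_cat; apply: (limit_holonomyP _).2 => t tt.
    rewrite mat_cat -hu// -hv//.
    by apply: W_mul_holonomy => //; [exact: lg.1|exact: lh.1].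
- move=> g /word[u [_ hu ->]]; exact: (limit_holonomyP hu).1.
- rewrite -limit_image eqEsubset; split=> [_ [g /word[u [e _ ->]] <-]|_ [u e <-]].
    by exists u.
  exists (word_family u); first exact: word_family_loops.
  by apply: (limit_holonomyP _).2 => t tt; exact: word_family_holonomy.
- by split; [exact: C_representation|exact: C_faithful].
Qed.
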